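(* Let $\theta=0$, $r>2^\star-1$ and $\left(\frac{r+1}{1-\gamma}\right)'\le m<\left(\frac{2^\star}{1-\gamma}\right)'$, and let $f\in L^m(\Omega)$ be non-negative and not a.e. equal to zero. Then the system $$\begin{cases} -\mathrm{div}(A(x)Du)+v\,u^{r-1}=\dfrac{f(x)}{u^\gamma} & \text{in }\Omega\\[4pt] -\mathrm{div}(A(x)Dv)=u^r & \text{in }\Omega\\ u=v=0 & \text{on }\partial\Omega\end{cases}$$ has a finite-energy solution $(u,v)$ with $u\in L^{r+1}(\Omega)$.
   Context: Setting: $d\ge 3$; $\Omega\subset\mathbb{R}^d$ is a bounded domain (open, connected; no boundary regularity is assumed); $A\in L^\infty(\Omega;\mathbb{R}^{d\times d})$ is a symmetric matrix field with $\alpha|\xi|^2\le A(x)\xi\cdot\xi\le\beta|\xi|^2$ for a.e. $x\in\Omega$ and all $\xi\in\mathbb{R}^d$, where $0<\alpha\le\beta$; the parameters satisfy $r\ge 2$, $\gamma\in(0,1)$. $D$ denotes the (weak) gradient. Exponents: $p'=\frac{p}{p-1}$ is the Hölder conjugate of $p$, and $2^\star=\frac{2d}{d-2}$. Finite-energy solution (for $\theta=0$): a pair $(u,v)\in H^1_0(\Omega)\times H^1_0(\Omega)$ with $u\ge0$ a.e. in $\Omega$ is a finite-energy solution to the system if $v>0$ a.e. in $\Omega$, $u>0$ a.e. in $\{f>0\}$, and, setting $g(x,u)=\frac{f(x)}{u^\gamma}$ in $\{f>0\}$ and $g(x,u)=0$ otherwise, $$g(\cdot,u)\varphi\in L^1(\Omega)\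 \ \forall\varphi\in H^1_0(\Omega)\cap L^\infty(\Omega),\qquad u^r\psi\in L^1(\Omega)\ \ \forall\psi\in H^1_0(\Omega),$$ and $$\int_\Omega A Du\cdot D\varphi+v\,u^{r-1}\varphi\,dx=\int_\Omega g(\cdot,u)\varphi\,dx\quad\forall\varphi\in H^1_0(\Omega)\cap L^\infty(\Omega),\qquad \int_\Omega ADv\cdot D\psi\,dx=\int_\Omega u^r\psi\,dx\quad\forall\psi\in H^1_0(\Omega)$$ (all integrals being well defined). *)

(* Defs.v *)
From HB Require Import structures.
From mathcomp Require Import all_boot all_order all_algebra.
From mathcomp Require Import all_classical all_reals all_analysis.
From mathcomp Require Import measurable_realfun.

Set Implicit Arguments.
Unset Strict Implicit.
Unset Printing Implicit Defensive.

Import Order.TTheory GRing.Theory Num.Theory.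
Import numFieldNormedType.Exports.

Local Open Scope classical_set_scope.
Local Open Scope ring_scope.

Definition rV_display : measure_display. Proof. exact: default_measure_display. Qed.

Definition rV_coord (R : realType) (n : nat) (i : 'I_n) (x : 'rV[R]_n) :
  measurableTypeR R := x ord0 i.

(* The sigma-algebra generated by the coordinates; it is the Borel
   sigma-algebra, see [measurable_rVE]. *)
Section measurable_rV.
Context (R : realType) (n : nat).

Let rV_set0 : g_sigma_preimage (@rV_coord R n) set0.
Proof. exact: sigma_algebra0. Qed.

Let rV_setC A : g_sigma_preimage (@rV_coord R n) A ->
  g_sigma_preimage (@rV_coord R n) (~` A).
Proof. exact: sigma_algebraC. Qed.

Let rV_bigcup (F : (set 'rV[R]_n)^nat) :
  (forall i, g_sigma_preimage (@rV_coord R n) (F i)) ->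
  g_sigma_preimage (@rV_coord R n) (\bigcup_i (F i)).
Proof. exact: sigma_algebra_bigcup. Qed.

HB.instance Definition _ := @isMeasurable.Build rV_display
  'rV[R]_n (g_sigma_preimage (@rV_coord R n)) rV_set0 rV_setC rV_bigcup.

End measurable_rV.

Lemma measurable_rV_coord (R : realType) (n : nat) (i : 'I_n) :
  measurable_fun [set: 'rV[R]_n] (@rV_coord R n i).
Proof.
move=> _ Y mY; rewrite setTI; apply: sub_sigma_algebra => /=.
rewrite -bigcup_seq/=; exists i => /=; first by rewrite mem_index_enum.
by exists Y => //; rewrite setTI.
Qed.

Lemma measurable_fun_rVP (R : realType) (n : nat) d (T : measurableType d)
    (f : T -> 'rV[R]_n) :
  (forall i, measurable_fun [set: T] (@rV_coord R n i \o f)) ->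
  measurable_fun [set: T] f.
Proof.
move=> mf _ A mA; rewrite setTI.
have : preimage_set_system [set: T] f (g_sigma_preimage (@rV_coord R n)) (f @^-1` A).
  by exists A => //; rewrite setTI.
rewrite -g_sigma_preimage_comp; apply: smallest_sub.
  exact: sigma_algebra_measurable.
rewrite -bigcup_seq/=; apply: bigcup_sub => i _ B [C mC <-]; exact: mf.
Qed.

Lemma measurable_rV_box (R : realType) (n : nat)
    (B : 'I_n -> set (measurableTypeR R)) :
  (forall i, measurable (B i)) ->
  measurable [set x | forall i, B i (rV_coord i x)].
Proof.
move=> mB; rewrite (_ : [set _ | _] =
    \bigcap_(i in [set: 'I_n]) (rV_coord i @^-1` B i)).
  apply: fin_bigcap_measurable => // i _; rewrite -[X in measurable X]setTI.
  exact: measurable_rV_coord.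
by apply/seteqP; split => [x Bx i _|x Bx i]; exact: Bx.
Qed.

Lemma open_measurable_rV (R : realType) (n : nat) (U : set 'rV[R]_n) :
  open U -> measurable U.
Proof.
move=> oU.
pose box (q : 'rV[rat]_n * 'rV[rat]_n) : set 'rV[R]_n :=
  [set x | forall i,
    ball (ratr (q.1 ord0 i) : R) (ratr (q.2 ord0 i)) (rV_coord i x : R)].
rewrite (_ : U = \bigcup_(q in [set q | box q `<=` U]) box q); last first.
  apply/seteqP; split => [x Ux|x [q qU]]; last exact: qU.
  have [B nB BU] : nbhs x U by exact: open_nbhs_nbhs.
  have H i : exists q : rat * rat, ball (ratr q.1 : R) (ratr q.2) (x ord0 i) /\
      ball (ratr q.1 : R) (ratr q.2) `<=` B ord0 i.
    have xB : x ord0 i \in ((B ord0 i)^° : set R) by rewrite inE; exact: nB.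
    have [c [r [/set_mem ? cr]]] := open_subball_rat (@open_interior _ _) xB.
    by exists (c, r); split => //; apply: (subset_trans cr); exact: interior_subset.
  have [q qP] := choice H.
  exists (\row_i (q i).1, \row_i (q i).2).
    move=> y /= yq; apply: BU => i j; rewrite (ord1 i).
    by have := yq j; rewrite !mxE; exact: (qP j).2.
  by move=> i; rewrite !mxE; exact: (qP i).1.
rewrite bigcup_mkcond; apply: countable_bigcupT_measurable; first exact: countableP.
move=> q.
case: ifPn => // _; apply: (@measurable_rV_box R n
  (fun i => ball (ratr (q.1 ord0 i) : R) (ratr (q.2 ord0 i)))) => i.
by apply: open_measurable; exact: ball_open.
Qed.

Lemma measurable_rVE (R : realType) (n : nat) :
  @measurable _ 'rV[R]_n = <<s open >>.
Proof.
apply/seteqP; split; last first.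
  by apply: smallest_sub; [exact: sigma_algebra_measurable|
    exact: open_measurable_rV].
apply: smallest_sub; first exact: smallest_sigma_algebra.
rewrite -bigcup_seq/=; apply: bigcup_sub => i _.
move=> _ [A mA <-].
have {}mA : (@RGenOpens.G R).-sigma.-measurable A by rewrite -RGenOpens.measurableE.
have : preimage_set_system [set: 'rV[R]_n] (@rV_coord R n i)
    (@RGenOpens.G R).-sigma.-measurable ([set: 'rV[R]_n] `&` rV_coord i @^-1` A) by exists A.
rewrite -g_sigma_preimageE; apply: sub_smallest2r.
  exact: smallest_sigma_algebra.
move=> _ [B [a [b ->]] <-]; rewrite setTI.
apply: open_comp; last exact: interval_open.
by move=> x _; exact: coord_continuous.
Qed.

Definition rV_cons (R : realType) (n : nat) (x : measurableTypeR R * 'rV[R]_n) :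
  'rV[R]_n.+1 := row_mx (x.1)%:M x.2.

Lemma rV_cons0 (R : realType) (n : nat) (x : measurableTypeR R * 'rV[R]_n) :
  rV_coord ord0 (rV_cons x) = x.1.
Proof.
transitivity (row_mx (x.1)%:M x.2 ord0 (lshift n (ord0 : 'I_1))).
  by rewrite /rV_coord /rV_cons; congr (row_mx _ _ _ _); exact: val_inj.
by rewrite row_mxEl mxE eqxx.
Qed.

Lemma rV_consS (R : realType) (n : nat) (j : 'I_n)
    (x : measurableTypeR R * 'rV[R]_n) :
  rV_coord (lift ord0 j) (rV_cons x) = rV_coord j x.2.
Proof.
transitivity (row_mx (x.1)%:M x.2 ord0 (rshift 1 j)).
  by rewrite /rV_coord /rV_cons; congr (row_mx _ _ _ _); exact: val_inj.
by rewrite row_mxEr.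
Qed.

Lemma measurable_rV_cons (R : realType) (n : nat) :
  measurable_fun setT (@rV_cons R n).
Proof.
apply: measurable_fun_rVP => i.
case: (unliftP ord0 i) => [j ->|->].
  rewrite (_ : _ \o _ = @rV_coord R n j \o snd).
    by apply: measurableT_comp => //; exact: measurable_rV_coord.
  by apply/funext => x; exact: rV_consS.
rewrite (_ : _ \o _ = fst); first exact: measurable_fst.
by apply/funext => x; exact: rV_cons0.
Qed.

Section lebesgue_rV_succ.
Local Open Scope ereal_scope.
Context (R : realType) (n : nat)
  (mu : {sigma_finite_measure set 'rV[R]_n -> \bar R}).

Definition lebesgue_rV_succ : set 'rV[R]_n.+1 -> \bar R :=
  pushforward (product_measure1 (@lebesgue_measure R) mu) (@rV_cons R n).

Let succ_measurable A : measurable A -> measurable (@rV_cons R n @^-1` A).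
Proof. by move=> mA; rewrite -[X in measurable X]setTI; exact: measurable_rV_cons. Qed.

Let succ0 : lebesgue_rV_succ set0 = 0.
Proof. by rewrite /lebesgue_rV_succ /pushforward preimage_set0 measure0. Qed.

Let succ_ge0 A : 0 <= lebesgue_rV_succ A.
Proof. by rewrite /lebesgue_rV_succ /pushforward. Qed.

Let succ_sigma_additive : semi_sigma_additive lebesgue_rV_succ.
Proof.
move=> F mF tF mUF; rewrite /lebesgue_rV_succ /pushforward preimage_bigcup.
apply: measure_semi_sigma_additive.
- by move=> k; exact: succ_measurable.
- apply/trivIsetP => /= i j _ _ ij; rewrite -preimage_setI.
  by move/trivIsetP : tF => /(_ _ _ _ _ ij) ->//; rewrite preimage_set0.
- by rewrite -preimage_bigcup; exact: succ_measurable.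
Qed.

HB.instance Definition _ := isMeasure.Build _ _ _ lebesgue_rV_succ
  succ0 succ_ge0 succ_sigma_additive.

Lemma lebesgue_rV_succE (B : 'I_n.+1 -> set (measurableTypeR R)) :
  (forall i, measurable (B i)) ->
  lebesgue_rV_succ [set x | forall i, B i (rV_coord i x)] =
  lebesgue_measure (B ord0) *
  mu [set x | forall i, B (lift ord0 i) (rV_coord i x)].
Proof.
move=> mB; rewrite /lebesgue_rV_succ /pushforward.
rewrite (_ : _ @^-1` _ = B ord0 `*`
    [set x | forall i, B (lift ord0 i) (rV_coord i x)]).
  apply: product_measure1E => //.
  exact: (measurable_rV_box (fun i => mB (lift ord0 i))).
apply/seteqP; split => [x Bx|x [x1 x2] i] /=.
  split; first by rewrite -(rV_cons0 x); exact: Bx.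
  by move=> i; rewrite -rV_consS; exact: Bx.
by case: (unliftP ord0 i) => [j ->|->]; rewrite ?rV_consS ?rV_cons0.
Qed.

Let succ_sigma_finite : sigma_finite setT lebesgue_rV_succ.
Proof.
have /sigma_finiteP[F [TF ndF Foo]] := sigma_finiteT (@lebesgue_measure R).
have /sigma_finiteP[G [TG ndG Goo]] := sigma_finiteT mu.
pose f (x : 'rV[R]_n.+1) : measurableTypeR R * 'rV[R]_n :=
  (rV_coord ord0 x, \row_i rV_coord (lift ord0 i) x).
have mf : measurable_fun setT f.
  apply/measurable_fun_pairP; split; first exact: measurable_rV_coord.
  apply: measurable_fun_rVP => i.
  rewrite (_ : _ \o _ = rV_coord (lift ord0 i)); first exact: measurable_rV_coord.
  by apply/funext => x; rewrite /= /rV_coord mxE.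
have fK x : f (rV_cons x) = x.
  case: x => x y; rewrite /f rV_cons0; congr (_, _).
  by apply/rowP => i; rewrite mxE rV_consS.
exists (fun k => f @^-1` (F k `*` G k)).
  apply/seteqP; split => // x _.
  have [i _ Fi] : (\bigcup_i F i) (f x).1 by rewrite -TF.
  have [j _ Gj] : (\bigcup_i G i) (f x).2 by rewrite -TG.
  exists (maxn i j) => //; split.
    by move: Fi; exact/subsetPset/ndF/leq_maxl.
  by move: Gj; exact/subsetPset/ndG/leq_maxr.
move=> k; have [mF Fk] := Foo k; have [mG Gk] := Goo k; split.
  by rewrite -[X in measurable X]setTI; apply: mf => //; exact: measurableX.
rewrite /lebesgue_rV_succ /pushforward.
rewrite -comp_preimage (_ : f \o _ = id) ?preimage_id; last exact/funext.
by rewrite product_measure1E// lte_mul_pinfty// ge0_fin_numE.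
Qed.

HB.instance Definition _ := Measure_isSigmaFinite.Build _ _ _
  lebesgue_rV_succ succ_sigma_finite.

End lebesgue_rV_succ.

Fixpoint lebesgue_rV (R : realType) (n : nat) :
    {sigma_finite_measure set 'rV[R]_n -> \bar R} :=
  match n with
  | 0 => dirac (0 : 'rV[R]_0)
  | n'.+1 => lebesgue_rV_succ (lebesgue_rV R n')
  end.

Lemma lebesgue_rV_box (R : realType) (n : nat)
    (B : 'I_n -> set (measurableTypeR R)) :
  (forall i, measurable (B i)) ->
  lebesgue_rV R n [set x | forall i, B i (rV_coord i x)] =
  (\prod_(i < n) lebesgue_measure (B i))%E.
Proof.
elim: n B => [|n IH] B mB.
  rewrite big_ord0 /= diracE (_ : _ \in _)//.
  by rewrite inE => -[].
rewrite big_ord_recl -IH//; exact: lebesgue_rV_succE.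
Qed.

(* Functions on [Om] are represented by functions on the whole space, whose
   values outside [Om] are irrelevant. *)

Section sobolev.
Context (R : realType) (d : nat).
Local Notation E := 'rV[R]_d.
Local Notation mu := (lebesgue_rV R d).
Implicit Types (Om : set E) (p : \bar R) (u w phi : E -> R).

Definition partial (i : 'I_d) phi : E -> R :=
  fun x => 'D_(delta_mx ord0 i) phi x.

Fixpoint Ck (k : nat) phi : Prop :=
  continuous phi /\
  match k with
  | 0 => True
  | k'.+1 => forall i, (forall x, derivable phi x (delta_mx ord0 i)) /\
                       Ck k' (partial i phi)
  end.

Definition smooth phi := forall k, Ck k phi.

Definition tsupport phi : set E := closure [set x | phi x != 0].

Definition test_function Om phi :=
  [/\ smooth phi, compact (tsupport phi) & tsupport phi `<=` Om].

(* [u \_ Om] is [u] extended by 0 outside [Om] *)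
Definition Lp_norm Om p u : \bar R := 'N[mu]_p[EFin \o (u \_ Om)]%E.

Definition in_Lp Om p u : Prop := u \_ Om \in Lfun mu p.

Definition weak_gradient Om u (G : E -> E) : Prop :=
  forall i, in_Lp Om 2%:E (fun x => G x ord0 i) /\
    forall phi, test_function Om phi ->
      \int[mu]_(x in Om) (u x * partial i phi x) =
      - \int[mu]_(x in Om) (G x ord0 i * phi x).

(* Some weak gradient of [u] if there is one; it is unique up to a null
   subset of [Om]. *)
Definition grad Om u : E -> E := get (weak_gradient Om u).

Definition H1 Om u : Prop :=
  in_Lp Om 2%:E u /\ exists G, weak_gradient Om u G.

(* Equivalent to the Hilbert norm of [H^1(Om)]. *)
Definition H1_norm Om u : \bar R :=
  (Lp_norm Om 2%:E u +
   \sum_(i < d) Lp_norm Om 2%:E (fun x => grad Om u x ord0 i))%E.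

Definition H10 Om u : Prop :=
  H1 Om u /\
  exists2 phi : nat -> E -> R, (forall n, test_function Om (phi n)) &
    H1_norm Om (phi n \- u) @[n --> \oo] --> 0%E.

End sobolev.

Section system.
Context (R : realType) (d : nat).
Local Notation E := 'rV[R]_d.
Local Notation mu := (lebesgue_rV R d).

(* Euclidean inner product; the library norm of ['rV[R]_d] is the sup norm. *)
Definition dot (a b : E) : R := (a *m b^T) ord0 ord0.

(* The matrix-vector product [M a], with row vectors. *)
Definition mxapply (M : 'M[R]_d) (a : E) : E := a *m M^T.

Definition bounded_domain (Om : set E) :=
  [/\ Om !=set0, open Om, connected Om & bounded_set Om].

Definition elliptic_field (Om : set E) (alpha beta : R) (A : E -> 'M[R]_d) :=
  [/\ forall i j, in_Lp Om +oo%E (fun x => A x i j),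
      {ae mu, forall x, Om x -> (A x)^T = A x} &
      {ae mu, forall x, Om x -> forall xi : E,
        alpha * dot xi xi <= dot (mxapply (A x) xi) xi <= beta * dot xi xi}].

Definition singular_term (gamma : R) (f u : E -> R) (x : E) : R :=
  if 0 < f x then f x / u x `^ gamma else 0.

Record finite_energy_solution (Om : set E) (A : E -> 'M[R]_d) (f : E -> R)
    (r gamma : R) (u v : E -> R) : Prop := {
  fes_H10_u : H10 Om u ;
  fes_H10_v : H10 Om v ;
  fes_u_ge0 : {ae mu, forall x, Om x -> 0 <= u x} ;
  fes_v_gt0 : {ae mu, forall x, Om x -> 0 < v x} ;
  fes_u_gt0 : {ae mu, forall x, Om x -> 0 < f x -> 0 < u x} ;
  fes_singular_L1 : forall phi, H10 Om phi -> in_Lp Om +oo%E phi ->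
    in_Lp Om 1%E (fun x => singular_term gamma f u x * phi x) ;
  fes_power_L1 : forall psi, H10 Om psi ->
    in_Lp Om 1%E (fun x => u x `^ r * psi x) ;
  (* integrability is required explicitly because the library integral is
     total; for [fes_lhs_v_L1] it is automatic *)
  fes_lhs_u_L1 : forall phi, H10 Om phi -> in_Lp Om +oo%E phi ->
    in_Lp Om 1%E (fun x => dot (mxapply (A x) (grad Om u x)) (grad Om phi x) +
                           v x * u x `^ (r - 1) * phi x) ;
  fes_eq_u : forall phi, H10 Om phi -> in_Lp Om +oo%E phi ->
    \int[mu]_(x in Om) (dot (mxapply (A x) (grad Om u x)) (grad Om phi x) +
                        v x * u x `^ (r - 1) * phi x) =
    \int[mu]_(x in Om) (singular_term gamma f u x * phi x) ;
  fes_lhs_v_L1 : forall psi, H10 Om psi ->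
    in_Lp Om 1%E (fun x => dot (mxapply (A x) (grad Om v x)) (grad Om psi x)) ;
  fes_eq_v : forall psi, H10 Om psi ->
    \int[mu]_(x in Om) dot (mxapply (A x) (grad Om v x)) (grad Om psi x) =
    \int[mu]_(x in Om) (u x `^ r * psi x) }.

End system.

Definition conj_exponent (R : realType) (p : R) : R := p / (p - 1).

Definition sobolev_exponent (R : realType) (d : nat) : R :=
  2 * d%:R / (d%:R - 2).

(* Main.v *)
Require Import Defs.
From mathcomp Require Import all_boot all_order all_algebra.
From mathcomp Require Import all_classical all_reals all_analysis.
From mathcomp Require Import measurable_realfun ess_sup_inf ring lra.

(** The system is variational.  Let [a] be the energy form of the operator, and
    consider the pairs [(u, v)] in the energy space with [u] nonnegative and [v]
    a supersolution of the second equation, that is, with [a v psi] at least the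
    integral of [u `^ r * psi] for all nonnegative [psi].  The solution minimises

      [a u u / 2 + a v v / (2 r) - (integral of f * u `^ (1 - gamma)) / (1 - gamma)]

    among these pairs.  They form a convex set, because [t `^ r] is convex, and
    the functional is uniformly convex, because [t `^ (1 - gamma)] is concave.
    Testing the constraint with [u] bounds the integral of [u `^ (r + 1)] by
    [a v u]; as [m] is at least [(r + 1) / (r + gamma)], this integral absorbs
    the singular term, and the functional is coercive.  Minimising sequences are
    Cauchy sequences, and Fatou's lemma gives a minimal pair
    ([minimal_pair_exists]), whose [v] solves the second equation exactly, since
    the solution has less energy than any supersolution.

    For the first equation, the minimal pair is compared with the pairs
    [(u + t phi, v + t (w - v))], where [phi] is nonnegative and [w] solves the
    second equation with source [(u + phi) `^ r] ([first_variation]).  In the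
    limit this gives the inequality [0 <= L phi], where [L phi] is [a u phi] plus
    the integral of [v * u `^ (r - 1) * phi] minus that of
    [f * u `^ (- gamma) * phi] ([minimal_singular]).  Comparison with
    [(t u, t `^ r v)] gives [L u <= 0] ([minimal_scaling]).  Equality for all
    bounded [phi] follows by writing
    [phi = (phi - n u)^+ - (n u - phi)^+ + n u] and letting [n] tend to infinity
    ([minimal_equation]).

    The passage to the limit requires [u > 0].  First, [u] does not vanish
    identically, because the singular term would then make the first variation
    infinite.  Positivity almost everywhere follows from a strong maximum
    principle ([strong_maximum_principle]) for functions of the space: if [Z] is
    the zero set of a supersolution, the functions [(phi - n u)^+] have bounded
    energy and decrease to [phi] times the indicator function of [Z], which
    therefore belongs to the space, for all test functions [phi].  An indicator
    function with this property is locally constant: its translates by [h]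
    differ from it by [O(|h| ^ 2)] in mean square, which for indicator functions
    is also the distance in mean, and a long translation divided into [n] short
    ones then shows that the distance is 0 ([shift_invariant_set]).  As the
    domain is connected, [Z] is null or of full measure.

    The properties of the energy space on which this rests are gathered in
    [dirichlet_form]: completeness, Poincare's inequality, and the fact that
    taking absolute values does not increase the energy.  They are derived from
    the approximation by test functions ([strong_grad]). *)

Import Order.TTheory GRing.Theory Num.Theory.
Import numFieldNormedType.Exports.

Local Open Scope classical_set_scope.
Local Open Scope ring_scope.

Set Implicit Arguments.
Unset Strict Implicit.
Unset Printing Implicit Defensive.

(** * Limits of real sequences *)

Lemma eq_cvg_to (R : realType) (u v : nat -> R) (l l' : R) :
  (forall n, u n = v n) -> l = l' -> u @ \oo --> l -> v @ \oo --> l'.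
Proof. by move=> /funext -> ->. Qed.

Lemma cvg_prod (R : realType) n (f : nat -> 'I_n -> R) (l : 'I_n -> R) :
  (forall i, (fun k => f k i) @ \oo --> l i) ->
  (fun k => \prod_(i < n) f k i) @ \oo --> \prod_(i < n) l i.
Proof.
elim: n f l => [|n IH] f l fl.
  rewrite big_ord0; under eq_fun do rewrite big_ord0; exact: cvg_cst.
rewrite big_ord_recl; under eq_fun do rewrite big_ord_recl.
by apply: cvgM => //; exact: (IH (fun k i => f k (lift ord0 i))).
Qed.

Lemma cvg_sum_ord (R : realType) n (f : nat -> 'I_n -> R) (l : 'I_n -> R) :
  (forall i, (fun k => f k i) @ \oo --> l i) ->
  (fun k => \sum_(i < n) f k i) @ \oo --> \sum_(i < n) l i.
Proof.
elim: n f l => [|n IH] f l fl.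
  rewrite big_ord0; under eq_fun do rewrite big_ord0; exact: cvg_cst.
rewrite big_ord_recl; under eq_fun do rewrite big_ord_recl.
by apply: cvgD => //; exact: (IH (fun k i => f k (lift ord0 i))).
Qed.

Lemma cvg_sqr0 (R : realType) (u : nat -> R) :
  (fun n => u n ^+ 2) @ \oo --> (0 : R) -> u @ \oo --> (0 : R).
Proof.
move=> u2; apply/cvgr0Pnorm_le => e e0.
have e2 : 0 < e ^+ 2 by rewrite exprn_gt0.
have [N _ NP] := cvgr_le _ u2 _ e2; exists N => // n /= Nn.
have := NP n Nn => /=; rewrite -(real_normK (num_real (u n))).
by rewrite ler_pXn2r// ?nnegrE// ltW.
Qed.

Lemma squeeze0 (R : realType) (u v : nat -> R) :
  (forall n, 0 <= u n <= v n) -> v @ \oo --> (0 : R) -> u @ \oo --> (0 : R).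
Proof.
move=> uv v0; apply: (squeeze_cvgr _ (cvg_cst 0) v0).
exact: nearW.
Qed.

Lemma cvg_subseq (R : realType) (sq : nat -> nat) (y : nat -> R) (l : R) :
  (forall n, (n <= sq n)%N) ->
  y @ \oo --> l -> (fun k => y (sq k)) @ \oo --> l.
Proof.
move=> ns cy A /cy[N _ NP]; exists N => // n /= Nn; apply: NP => /=.
exact: leq_trans Nn (ns n).
Qed.

Lemma le0_of_small (R : realType) (b c : R) :
  (forall t, 0 < t < 1 -> b <= t * c) -> b <= 0.
Proof.
move=> H; apply/ler_addgt0Pr => e e0; rewrite add0r.
pose t := e / (`|c| + 1 + e).
have c0 : 0 <= `|c| by [].
have d0 : 0 < `|c| + 1 + e by lra.
have t01 : 0 < t < 1 by rewrite divr_gt0//= ltr_pdivrMr// mul1r; lra.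
apply: (le_trans (H _ t01)); have /andP[t0 _] := t01.
apply: (@le_trans _ _ (t * (`|c| + 1 + e))); last by rewrite divfK ?gt_eqF.
by rewrite ler_pM2l//; have := ler_norm c; lra.
Qed.

(** * Real-valued integration up to null sets *)

Section real_integral.
Context d (T : measurableType d) (R : realType).
Variables (mu : {measure set T -> \bar R}) (D : set T).
Hypothesis mD : measurable D.
Implicit Types (f g h : T -> R) (c : R).

Definition L1 f : Prop := mu.-integrable D (EFin \o f).

Local Notation I f := (Rintegral mu D f).
Local Notation aeD P := {ae mu, forall x, D x -> P x}.

Lemma L1_measurable f : L1 f -> measurable_fun D f.
Proof. by move=> /integrableP[/measurable_EFinP]. Qed.

Lemma L1D f g : L1 f -> L1 g -> L1 (fun x => f x + g x).
Proof. by move=> lf lg; have := integrableD mD lf lg; apply: eq_integrable. Qed.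

Lemma L1Z c f : L1 f -> L1 (fun x => c * f x).
Proof. by move=> lf; have := integrableZl mD c lf; apply: eq_integrable. Qed.

Lemma L1N f : L1 f -> L1 (fun x => - f x).
Proof. by move=> lf; have := integrableN lf; apply: eq_integrable. Qed.

Lemma L1B f g : L1 f -> L1 g -> L1 (fun x => f x - g x).
Proof. by move=> lf lg; apply: L1D => //; exact: L1N. Qed.

Lemma L1_0 : L1 (fun=> 0).
Proof. exact: integrable0. Qed.

Lemma L1_norm f : L1 f -> L1 (fun x => `|f x|).
Proof. by move=> lf; have := integrable_abse lf; apply: eq_integrable. Qed.

Lemma L1_sum n (f : 'I_n -> T -> R) :
  (forall i, L1 (f i)) -> L1 (fun x => \sum_(i < n) f i x).
Proof.
elim: n f => [|n IH] f lf.
  by under eq_fun do rewrite big_ord0; exact: L1_0.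
under eq_fun do rewrite big_ord_recl.
by apply: L1D => //; apply: IH.
Qed.

Lemma L1_eq f g : (forall x, D x -> f x = g x) -> L1 f -> L1 g.
Proof. by move=> fg; apply: (eq_integrable mD) => x /set_mem/fg/= ->. Qed.

(** Since [mu] need not be complete, the measurability of [f] cannot be
    derived from the almost everywhere bound. *)
Lemma L1_dom f g : measurable_fun D f -> L1 g ->
  aeD (fun x => `|f x| <= g x) -> L1 f.
Proof.
move=> mf lg fg; apply/integrableP; split; first exact/measurable_EFinP.
have /integrableP[mg] := lg; apply: le_lt_trans.
apply: ae_ge0_le_integral => //.
- by apply: measurableT_comp => //; exact/measurable_EFinP.
- by apply: measurableT_comp.
- apply: filterS fg => x /[apply] fgx /=; rewrite lee_fin.
  exact: le_trans (ler_norm _).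
Qed.

Lemma I_Z c f : L1 f -> I (fun x => c * f x) = c * I f.
Proof. by move=> lf; rewrite RintegralZl. Qed.

Lemma I_D f g : L1 f -> L1 g -> I (fun x => f x + g x) = I f + I g.
Proof. by move=> lf lg; rewrite RintegralD. Qed.

Lemma I_B f g : L1 f -> L1 g -> I (fun x => f x - g x) = I f - I g.
Proof. by move=> lf lg; rewrite RintegralB. Qed.

Lemma I_0 : I (fun=> 0) = 0.
Proof. by rewrite Rintegral_cst// mul0r. Qed.

Lemma I_sum n (f : 'I_n -> T -> R) : (forall i, L1 (f i)) ->
  I (fun x => \sum_(i < n) f i x) = \sum_(i < n) I (f i).
Proof.
elim: n f => [|n IH] f lf.
  by under eq_Rintegral do rewrite big_ord0; rewrite I_0 big_ord0.
under eq_Rintegral do rewrite big_ord_recl.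
rewrite I_D ?big_ord_recl// ?IH//.
exact: (L1_sum (fun i => lf _)).
Qed.

Lemma EFin_I f : L1 f -> (\int[mu]_(x in D) (f x)%:E)%E = (I f)%:E.
Proof. by move=> lf; rewrite fineK//; exact: integrable_fin_num. Qed.

Lemma I_ge0 f : aeD (fun x => 0 <= f x) -> measurable_fun D f -> 0 <= I f.
Proof.
move=> f0 mf; apply: fine_ge0.
have mf' : measurable_fun D (fun x => Num.max 0 (f x)).
  exact: measurable_maxr.
rewrite (@ae_eq_integral _ _ _ _ _ (fun x => (Num.max 0 (f x))%:E))//.
- by apply: integral_ge0 => x Dx; rewrite lee_fin le_max lexx.
- exact/measurable_EFinP.
- exact/measurable_EFinP.
- by apply: filterS f0 => x /[apply] f0x; rewrite max_r.
Qed.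

Lemma I_le f g : L1 f -> L1 g -> aeD (fun x => f x <= g x) -> I f <= I g.
Proof.
move=> lf lg fg; rewrite -subr_ge0 -I_B//; apply: I_ge0.
  by apply: filterS fg => x /[apply]; rewrite subr_ge0.
by apply: measurable_funB; exact: L1_measurable.
Qed.

Lemma I_ae_eq f g : L1 f -> L1 g -> aeD (fun x => f x = g x) -> I f = I g.
Proof.
by move=> lf lg fg; apply/eqP; rewrite eq_le; apply/andP; split; apply: I_le => //;
  apply: filterS fg => x /[apply] ->.
Qed.

Lemma I_norm f : L1 f -> `|I f| <= I (fun x => `|f x|).
Proof. exact: le_normr_Rintegral. Qed.

Lemma I_eq0 f : L1 f -> aeD (fun x => 0 <= f x) -> I f <= 0 ->
  aeD (fun x => f x = 0).
Proof.
move=> lf f0 If0.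
have I0 : I (fun x => `|f x|) = 0.
  rewrite (_ : I _ = I f).
    by apply/eqP; rewrite eq_le If0 I_ge0//; exact: L1_measurable.
  apply: I_ae_eq => //; first exact: L1_norm.
  by apply: filterS f0 => x /[apply] /ger0_norm.
have mf : measurable_fun D (EFin \o f) by exact/measurable_EFinP/L1_measurable.
have /(ae_eq_integral_abs _ mD mf) : (\int[mu]_(x in D) `|(EFin \o f) x| = 0)%E.
  by rewrite (EFin_I (L1_norm lf)) I0.
by apply: filterS => x /[apply] -[].
Qed.

Lemma measurable_fun_ae_limit (f_ : nat -> T -> R) f :
  (forall n, measurable_fun D (f_ n)) ->
  aeD (fun x => f_ ^~ x @ \oo --> f x) ->
  exists2 g, measurable_fun D g & aeD (fun x => f x = g x).
Proof.
move=> mf fcv.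
exists (fun x => fine (limn_esup (fun n => (f_ n x)%:E))).
  apply: measurableT_comp => //; apply: measurable_fun_limn_esup => n.
  exact/measurable_EFinP.
apply: filterS fcv => x /[apply] fx.
have fx' : (fun n => (f_ n x)%:E) @ \oo --> (f x)%:E by apply: cvg_EFin fx; exact: nearW.
rewrite is_cvg_limn_esupE; last by apply/cvg_ex; exists (f x)%:E.
by rewrite (cvg_lim _ fx').
Qed.

(** Fatou's lemma, for almost everywhere convergence. *)
Lemma fatou_L1 (f_ : nat -> T -> R) f (c_ : nat -> R) c :
  (forall n, L1 (f_ n)) -> measurable_fun D f ->
  (forall n, aeD (fun x => 0 <= f_ n x)) ->
  aeD (fun x => f_ ^~ x @ \oo --> f x) ->
  (forall n, I (f_ n) <= c_ n) -> c_ @ \oo --> c ->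
  L1 f /\ I f <= c.
Proof.
move=> lf mf f0 fcv Ic cc.
pose g n x := (Num.max 0 (f_ n x)).
have mg n : measurable_fun D (g n) by apply: measurable_maxr => //; exact: L1_measurable.
have f00 : aeD (fun x => forall n, 0 <= f_ n x).
  have : {ae mu, forall x n, D x -> 0 <= f_ n x} by apply: ae_foralln => n; exact: f0.
  by apply: filterS => x + + n => /(_ n)/[apply].
have fcv0 : aeD (fun x => 0 <= f x).
  apply: filterS2 f00 fcv => x + + Dx => /(_ Dx) f0x /(_ Dx) fx.
  by apply: (cvgr_to_ge fx); exact: nearW.
have fle : (\int[mu]_(x in D) `|(f x)%:E| <= c%:E)%E.
  have := @fatou _ _ _ mu D mD (fun n x => (g n x)%:E)
    (fun n => (measurable_EFinP _ _).2 (mg n)) _.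
  rewrite (@ae_eq_integral _ _ _ mu D (fun x => limn_einf (fun n => (g n x)%:E))
     (fun x => `|(f x)%:E|%E))//; last 3 first.
  - by do 2 apply: measurableT_comp => //.
  - rewrite (_ : (fun x => _) = (fun x => - limn_esup (fun n => (- g n x)%:E))%E).
      apply: measurableT_comp => //; apply: measurable_fun_limn_esup => n.
      by apply/measurable_EFinP; apply: measurableT_comp.
    apply/funext => x; rewrite -limn_einfN; congr limn_einf.
    by apply/funext => n /=; rewrite opprK.
  - apply: filterS3 f00 fcv fcv0 => x + + + Dx.
    move=> /(_ Dx) f0x /(_ Dx) fx /(_ Dx) f0'.
    have fx' : (fun n => (g n x)%:E) @ \oo --> (f x)%:E.
      apply: cvg_EFin; first exact: nearW.
      rewrite (_ : _ \o _ = f_ ^~ x)//.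
      by apply/funext => n; rewrite /= /g max_r.
    rewrite is_cvg_limn_einfE; last by apply/cvg_ex; exists (f x)%:E.
    by rewrite (cvg_lim _ fx')// gee0_abs// lee_fin.
  move=> H; apply: (le_trans (H _)) => [n x Dx|].
    by rewrite lee_fin /g le_max lexx.
  have Ig n : (\int[mu]_(x in D) (g n x)%:E = (I (f_ n))%:E)%E.
    rewrite -EFin_I//; apply: ae_eq_integral => //.
    - exact/measurable_EFinP.
    - exact/measurable_EFinP/L1_measurable.
    - by apply: filterS (f0 n) => x /[apply] f0x; rewrite /g max_r.
  under eq_fun do rewrite Ig.
  have cc' : (fun n => (c_ n)%:E) @ \oo --> c%:E by apply: cvg_EFin cc; exact: nearW.
  rewrite -(cvg_lim _ cc')// -is_cvg_limn_einfE; last by apply/cvg_ex; exists c%:E.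
  rewrite !limn_einf_lim; apply: lee_lim.
  - exact: is_cvg_einfs.
  - exact: is_cvg_einfs.
  - apply: nearW => n; apply: le_ereal_inf_tmp => _ [k /= nk <-].
    by apply: ge_ereal_inf; exists (I (f_ k))%:E; [exists k|rewrite lee_fin].
have lf1 : L1 f.
  apply/integrableP; split; first exact/measurable_EFinP.
  by rewrite (le_lt_trans fle)// ltry.
split=> //; rewrite -lee_fin -EFin_I//; apply: le_trans fle.
by rewrite (EFin_I (L1_norm lf1)) EFin_I// lee_fin (le_trans (ler_norm _))// I_norm.
Qed.

Lemma dominated_L1 (f_ : nat -> T -> R) f g :
  (forall n, measurable_fun D (f_ n)) -> measurable_fun D f -> L1 g ->
  (forall n, aeD (fun x => `|f_ n x| <= g x)) ->
  aeD (fun x => f_ ^~ x @ \oo --> f x) ->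
  L1 f /\ (fun n => I (f_ n)) @ \oo --> I f.
Proof.
move=> mf_ mf lg fg fcv.
have lf n : L1 (f_ n) by exact: L1_dom (fg n).
have := @dominated_convergence _ _ _ mu D mD (fun n x => (f_ n x)%:E)
  (fun x => (f x)%:E) (fun x => (g x)%:E)
  (fun n => (measurable_EFinP _ _).2 (mf_ n)) ((measurable_EFinP _ _).2 mf) _ lg _.
case.
- apply: filterS fcv => x /[apply] fx.
  by apply: cvg_EFin fx; exact: nearW.
- have : {ae mu, forall x n, D x -> `|f_ n x| <= g x} by apply: ae_foralln.
  by apply: filterS => x + n Dx => /(_ n Dx); rewrite lee_fin.
move=> lf1 _ cv; split=> //.
have {}cv : (fun n => (I (f_ n))%:E) @ \oo --> (I f)%:E.
  rewrite -(EFin_I lf1); apply: cvg_trans cv.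
  by under eq_fun do rewrite -EFin_I//.
by move/fine_cvgP : cv => [].
Qed.

End real_integral.

(** * Square-integrable functions on a set of finite measure *)

Section square_integrable.
Context d (T : measurableType d) (R : realType).
Variables (mu : {measure set T -> \bar R}) (D : set T).
Hypotheses (mD : measurable D) (muD : (mu D < +oo)%E).
Implicit Types (f g h : T -> R) (c : R).

Local Notation I f := (Rintegral mu D f).
Local Notation L1 := (L1 mu D).
Local Notation aeD P := {ae mu, forall x, D x -> P x}.

Definition L2 f : Prop := measurable_fun D f /\ L1 (fun x => f x ^+ 2).

Lemma L1_cst c : L1 (fun=> c).
Proof.
apply/integrableP; split; first exact: measurable_cst.
by rewrite integral_cst//= lte_mul_pinfty// lee_fin.
Qed.

Lemma L2M f g : L2 f -> L2 g -> L1 (fun x => f x * g x).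
Proof.
move=> [mf lf] [mg lg]; apply: (L1_dom mD _ (L1D mD lf lg)).
  exact: measurable_funM.
apply: aeW => x _; rewrite normrM.
rewrite -(@real_normK _ (f x)) ?num_real// -(@real_normK _ (g x)) ?num_real//.
have := sqr_ge0 (`|f x| - `|g x|).
have : 0 <= `|f x| by []. have : 0 <= `|g x| by [].
by move: `|f x| `|g x| => a b *; nra.
Qed.

Lemma L2D f g : L2 f -> L2 g -> L2 (fun x => f x + g x).
Proof.
move=> lf lg; split; first exact: measurable_funD lf.1 lg.1.
have := L1D mD (L1D mD lf.2 (L1Z mD 2 (L2M lf lg))) lg.2.
by apply: (L1_eq mD) => x _; ring.
Qed.

Lemma L2Z c f : L2 f -> L2 (fun x => c * f x).
Proof.
move=> [mf lf]; split; first exact: measurable_funM.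
by have := L1Z mD (c ^+ 2) lf; apply: (L1_eq mD) => x _; ring.
Qed.

Lemma L2N f : L2 f -> L2 (fun x => - f x).
Proof.
by move=> /(L2Z (-1)); under eq_fun do rewrite mulN1r.
Qed.

Lemma L2B f g : L2 f -> L2 g -> L2 (fun x => f x - g x).
Proof. by move=> lf lg; apply: L2D => //; exact: L2N. Qed.

Lemma L2_0 : L2 (fun=> 0).
Proof.
by split=> //; apply: (L1_eq mD) (L1_0 mu D) => x _; rewrite expr0n.
Qed.

Lemma L2_dom f g : measurable_fun D f -> L2 g ->
  aeD (fun x => `|f x| <= `|g x|) -> L2 f.
Proof.
move=> mf [mg lg] fg; split=> //.
apply: (L1_dom mD _ lg); first exact: measurable_funX.
apply: filterS fg => x /[apply] fgx.
by rewrite ger0_norm ?sqr_ge0// -(real_normK (num_real (f x)))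
  -(real_normK (num_real (g x))) lerXn2r ?nnegrE.
Qed.

Lemma L2_L1 f : L2 f -> L1 f.
Proof.
move=> lf; have l1 : L2 (fun=> 1) by split=> //; exact: L1_cst.
by have := L2M lf l1; under eq_fun do rewrite mulr1.
Qed.

Lemma I_sqr_ge0 f : measurable_fun D f -> 0 <= I (fun x => f x ^+ 2).
Proof.
move=> mf; apply: I_ge0 => //; last exact: measurable_funX.
by apply: aeW => x _; exact: sqr_ge0.
Qed.

Lemma I_sqrD f g : L2 f -> L2 g -> I (fun x => (f x + g x) ^+ 2) <=
  2 * I (fun x => f x ^+ 2) + 2 * I (fun x => g x ^+ 2).
Proof.
move=> lf lg.
rewrite -(I_Z mD _ lf.2) -(I_Z mD _ lg.2).
rewrite -I_D//; [|exact: (L1Z mD _ lf.2)|exact: (L1Z mD _ lg.2)].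
apply: I_le => //; first exact: (L2D lf lg).2.
  by apply: L1D => //; [exact: (L1Z mD _ lf.2)|exact: (L1Z mD _ lg.2)].
apply: aeW => x _; have := sqr_ge0 (f x - g x); nra.
Qed.

(** The sum has a finite integral, hence it is finite almost everywhere. *)
Lemma ae_summable (w : nat -> T -> R) c :
  (forall k, L1 (w k)) ->
  (forall k, I (fun x => `|w k x|) <= c * 2^-1 ^+ k) ->
  aeD (fun x => cvgn (series (fun k => `|w k x|))).
Proof.
move=> lw wc.
have c0 : 0 <= c.
  have := wc 0; rewrite expr0 mulr1; apply: le_trans; apply: I_ge0 => //.
    by apply: aeW => x _.
  exact/L1_measurable/L1_norm.
pose S x := (\sum_(k <oo) `|w k x|%:E)%E.
have mw k : measurable_fun D (fun x => `|w k x|%:E).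
  exact/measurable_EFinP/L1_measurable/L1_norm.
have IS : mu.-integrable D S.
  apply/integrableP; split.
    by apply: ge0_emeasurable_sum => // k x Dx _; rewrite lee_fin.
  under eq_integral => x _.
    rewrite gee0_abs; last by apply: nneseries_ge0 => n _ _; rewrite lee_fin.
  over.
  rewrite integral_nneseries//.
  apply: (@le_lt_trans _ _ (c * 2)%:E); last exact: ltry.
  apply: lime_le.
    by apply: is_cvg_ereal_nneg_natsum => n _; apply: integral_ge0 => x _; rewrite lee_fin.
  apply: nearW => n.
  under eq_bigr => k _ do rewrite (EFin_I mD (L1_norm mD (lw k))).
  rewrite sumEFin lee_fin.
  apply: (@le_trans _ _ (\sum_(0 <= k < n) c * 2^-1 ^+ k)); first exact: ler_sum.
  rewrite -mulr_sumr ler_wpM2l//.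
  have -> : \sum_(0 <= k < n) 2^-1 ^+ k = 2 * (1 - 2^-1 ^+ n) :> R.
    elim: n => [|n IH]; first by rewrite big_geq// expr0 subrr mulr0.
    by rewrite big_nat_recr//= IH exprS; lra.
  by have : 0 <= (2^-1 : R) ^+ n by []; lra.
have := integrable_ae mD IS; apply: filterS => x /[apply].
rewrite /S => Sfin.
apply: (@nondecreasing_is_cvgn R).
  by apply/nondecreasing_seqP => n; rewrite !seriesEnat /= big_nat_recr//= lerDl.
exists (fine (\sum_(k <oo) `|w k x|%:E)) => _ [n _ <-].
rewrite -lee_fin fineK// seriesEnat /= -sumEFin.
by apply: nneseries_lim_ge => k _; rewrite lee_fin.
Qed.

Lemma I_abs_sqr f k : L2 f -> I (fun x => f x ^+ 2) <= (2^-1 ^+ k) ^+ 2 ->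
  I (fun x => `|f x|) <= (1 + fine (mu D)) * 2^-1 ^+ k.
Proof.
move=> lf fk; set e := 2^-1 ^+ k in fk *.
have e0 : 0 < e by rewrite exprn_gt0.
have l1 : L2 (fun=> 1) by split=> //; exact: L1_cst.
apply: (@le_trans _ _ (I (fun x => e^-1 * f x ^+ 2 + e * 1))).
  apply: I_le => //; first exact/L1_norm/L2_L1.
    by apply: L1D => //; [exact: (L1Z mD _ lf.2)|exact: L1_cst].
  apply: aeW => x _; rewrite -(real_normK (num_real (f x))).
  have : 0 <= `|f x| by []. move: `|f x| => a a0.
  have -> : e^-1 * a ^+ 2 + e * 1 = e^-1 * (a - e) ^+ 2 + 2 * a.
    by field; exact: lt0r_neq0.
  have : 0 <= e^-1 * (a - e) ^+ 2 by rewrite mulr_ge0 ?sqr_ge0// invr_ge0 ltW.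
  by lra.
rewrite I_D//; [|exact: (L1Z mD _ lf.2)|exact: L1_cst].
rewrite (I_Z mD _ lf.2) Rintegral_cst// mulr1 mulrDl mul1r [_ * e]mulrC lerD2r.
by rewrite ler_pdivrMl// -expr2.
Qed.

Lemma L2_cvg_ae_subseq (u : nat -> T -> R) f : (forall n, L2 (u n)) -> L2 f ->
  (fun n => I (fun x => (u n x - f x) ^+ 2)) @ \oo --> (0 : R) ->
  exists2 s : nat -> nat, (forall n, (n <= s n)%N) &
    aeD (fun x => (fun k => u (s k) x) @ \oo --> f x).
Proof.
move=> lu lf uf.
have N k : exists n, (k <= n)%N /\
    I (fun x => (u n x - f x) ^+ 2) <= (2^-1 ^+ k) ^+ 2.
  have e0 : 0 < (2^-1 ^+ k) ^+ 2 :> R by rewrite !exprn_gt0.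
  have [n _ nP] := cvgr_le _ uf _ e0.
  by exists (maxn k n); split; [exact: leq_maxl|apply: nP; exact: leq_maxr].
have [s sP] := choice N; exists s => [n|]; first by case: (sP n).
have lw k : L2 (fun x => u (s k) x - f x) by exact: L2B.
have := @ae_summable (fun k x => u (s k) x - f x) (1 + fine (mu D))
  (fun k => L2_L1 (lw k)) (fun k => I_abs_sqr (lw k) (sP k).2).
apply: filterS => x /[apply] /normed_cvg /cvg_series_cvg_0 h.
by apply/subr_cvg0.
Qed.

(** The Riesz-Fischer theorem. *)
Lemma L2_complete (u : nat -> T -> R) : (forall n, L2 (u n)) ->
  (forall e, 0 < e -> exists N, forall n m, (N <= n)%N -> (N <= m)%N ->
     I (fun x => (u n x - u m x) ^+ 2) <= e) ->
  exists2 f, L2 f & (fun n => I (fun x => (u n x - f x) ^+ 2)) @ \oo --> (0 : R).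
Proof.
move=> lu uC.
have N k : exists N, forall n m, (N <= n)%N -> (N <= m)%N ->
    I (fun x => (u n x - u m x) ^+ 2) <= (2^-1 ^+ k) ^+ 2.
  by apply: uC; rewrite !exprn_gt0.
have [N_ NP] := choice N.
pose s k := (\max_(j < k.+1) N_ j + k)%N.
have sN j k : (j <= k)%N -> (N_ j <= s k)%N.
  move=> jk; rewrite /s; apply: leq_trans (leq_addr _ _).
  have jk' : (j < k.+1)%N by rewrite ltnS.
  exact: (@leq_bigmax _ (fun i : 'I_k.+1 => N_ i) (Ordinal jk')).
have lw k : L2 (fun x => u (s k.+1) x - u (s k) x) by exact: L2B.
have wP k : I (fun x => (u (s k.+1) x - u (s k) x) ^+ 2) <= (2^-1 ^+ k) ^+ 2.
  by apply: NP; apply: sN.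
have ucv : aeD (fun x => cvgn (fun k => u (s k) x)).
  have := @ae_summable _ (1 + fine (mu D))
    (fun k => L2_L1 (lw k)) (fun k => I_abs_sqr (lw k) (wP k)).
  apply: filterS => x /[apply] /normed_cvg.
  rewrite -[X in series X]/(telescope (fun k => u (s k) x)) => h.
  have /cvg_ex[l hl] := h.
  apply/cvg_ex; exists (u (s 0%N) x + l).
  rewrite (_ : (fun k => _) = (fun k => u (s 0) x + series (telescope (fun k => u (s k) x)) k)).
    by apply: cvgD => //; exact: cvg_cst.
  by apply/funext => k; rewrite telescopeK /=; ring.
pose f0 x := limn (fun k => u (s k) x).
have uf0 : aeD (fun x => (fun k => u (s k) x) @ \oo --> f0 x).
  by apply: filterS ucv => x /[apply].
have [f mf f0f] := measurable_fun_ae_limit (fun k => (lu (s k)).1) uf0.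
have uf : aeD (fun x => (fun k => u (s k) x) @ \oo --> f x).
  by apply: filterS2 uf0 f0f => x + + Dx => /(_ Dx) + /(_ Dx) <-.
have H n e : (forall m, (n <= m)%N -> I (fun x => (u n x - u m x) ^+ 2) <= e) ->
    L1 (fun x => (u n x - f x) ^+ 2) /\ I (fun x => (u n x - f x) ^+ 2) <= e.
  move=> ne.
  apply: (@fatou_L1 _ _ _ mu D mD (fun k x => (u n x - u (s (k + n)%N) x) ^+ 2) _
    (fun=> e)).
  - by move=> k; exact: (L2B (lu n) (lu _)).2.
  - by apply: measurable_funX; apply: measurable_funB => //; exact: (lu n).1.
  - by move=> k; apply: aeW => x _; exact: sqr_ge0.
  - apply: filterS uf => x /[apply] ux.
    have ux' : (fun k => u (s (k + n)%N) x) @ \oo --> f x.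
      by move: ux; rewrite -(cvg_shiftn n).
    have h : (fun k => u n x - u (s (k + n)%N) x) @ \oo --> u n x - f x.
      by apply: cvgB => //; exact: cvg_cst.
    by rewrite expr2; under eq_fun do rewrite expr2; exact: (cvgM h h).
  - by move=> k; apply: ne; rewrite /s addnA leq_addl.
  - exact: cvg_cst.
have lf : L2 f.
  have [n nP] := uC 1 ltr01.
  have lnf : L2 (fun x => u n x - f x).
    split; first by apply: measurable_funB => //; exact: (lu n).1.
    by apply: (H n 1 _).1 => m nm; exact: nP.
  have := L2B (lu n) lnf.
  by under eq_fun do rewrite opprB addrC subrK.
exists f => //; apply/cvgrPdist_le => e e0.
have [n nP] := uC e e0; exists n => // m /= nm.
rewrite sub0r normrN ger0_norm; last exact/I_sqr_ge0/(L2B _ lf).1.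
by apply: (H m e _).2 => k mk; apply: nP => //; exact: leq_trans mk.
Qed.

End square_integrable.

(** * Minimising sequences of uniformly convex functionals *)

(** Uniform midpoint convexity forces near-minimisers to be close to each
    other: the midpoint of two of them cannot go far below the infimum.  The
    constraint sets [C k] are allowed to shrink; their infima then increase to
    a finite limit, with which the midpoint is compared. *)
Lemma cauchy_near_minimizers (R : realType) (X : Type) (F : X -> R)
    (mid : X -> X -> X) (D : X -> X -> R) (C : nat -> set X) (m M : R) :
  (forall k l, (k <= l)%N -> C l `<=` C k) ->
  (forall k x y, C k x -> C k y -> C k (mid x y)) ->
  (forall x y, C 0%N x -> C 0%N y -> F (mid x y) <= (F x + F y) / 2 - D x y) ->
  (forall x, C 0%N x -> m <= F x) ->
  (forall k, exists2 x, C k x & F x <= M) ->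
  exists x : nat -> X, [/\ forall k, C k (x k),
    forall k y, C k y -> F (x k) <= F y + k.+1%:R^-1 &
    forall e, 0 < e -> exists N, forall k l, (N <= k)%N -> (N <= l)%N ->
      D (x k) (x l) <= e].
Proof.
move=> Cdecr Cmid Fmid Fm FM.
have C0 k x : C k x -> C 0%N x by exact: Cdecr.
pose dk k := inf (F @` C k).
have hi k : has_inf (F @` C k).
  split; first by have [x Cx _] := FM k; exists (F x), x.
  by exists m => _ [x /C0 Cx <-]; exact: Fm.
have dk_le k x : C k x -> dk k <= F x.
  by move=> Cx; apply: (ge_inf (hi k).2); exists x.
have near_min k : exists x, C k x /\ F x <= dk k + k.+1%:R^-1.
  have k0 : 0 < k.+1%:R^-1 :> R by rewrite invr_gt0.
  have [_ [x Cx <-] lt] := inf_adherent k0 (hi k).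
  by exists x; split=> //; exact: ltW.
have [x xP] := choice near_min.
have dk_mono k l : (k <= l)%N -> dk k <= dk l.
  move=> kl; apply: lb_le_inf; first exact: (hi l).1.
  by move=> _ [y Cy <-]; apply: dk_le; exact: (Cdecr _ _ kl).
have hs : has_sup (range dk).
  split; first by exists (dk 0%N), 0%N.
  exists M => _ [k _ <-]; have [y Cy yM] := FM k; exact: le_trans (dk_le _ _ Cy) yM.
exists x; split=> [k|k y Cy|e e0]; first by case: (xP k).
  by rewrite (le_trans (xP k).2)// lerD2r dk_le.
have e20 : 0 < e / 2 by rewrite divr_gt0.
have [_ [n _ <-] nP] := sup_adherent e20 hs.
have [p pP] : exists p, p.+1%:R^-1 <= e / 2.
  have [p _ pP] := cvgr_le _ (@cvg_harmonic R) _ e20.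
  by exists p; exact: (pP p (leqnn p)).
exists (maxn n p) => k l; rewrite !geq_max => /andP[nk pk] /andP[nl pl].
have Cn j : (n <= j)%N -> C n (x j) by move=> nj; exact: (Cdecr _ _ nj _ (xP j).1).
have dmid := dk_le _ _ (Cmid _ _ _ (Cn _ nk) (Cn _ nl)).
have Fm' := Fmid _ _ (C0 _ _ (xP k).1) (C0 _ _ (xP l).1).
have inv_le j : (p <= j)%N -> j.+1%:R^-1 <= e / 2.
  move=> pj; apply: le_trans pP; rewrite lef_pV2 ?posrE//.
  by rewrite ler_nat.
have ds j : dk j <= sup (range dk) by apply: ub_le_sup; [exact: hs.2|exists j].
have := (xP k).2; have := (xP l).2; have := inv_le _ pk; have := inv_le _ pl.
have := ds k; have := ds l; move: nP dmid Fm'.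
move: (k.+1%:R^-1) (l.+1%:R^-1) (F (mid _ _)) (F (x k)) (F (x l)) (D _ _) (sup _).
by move: (dk n) (dk k) (dk l) => *; lra.
Qed.

(** * Positive bilinear forms on function spaces *)

Record psd_form (R : realType) (Y : Type) (V : set (Y -> R))
    (a : (Y -> R) -> (Y -> R) -> R) : Prop := PsdForm {
  form0_in : V (fun=> 0) ;
  formD_in : forall u w, V u -> V w -> V (fun x => u x + w x) ;
  formZ_in : forall c u, V u -> V (fun x => c * u x) ;
  formC : forall u w, V u -> V w -> a u w = a w u ;
  formD : forall u1 u2 w, V u1 -> V u2 -> V w ->
    a (fun x => u1 x + u2 x) w = a u1 w + a u2 w ;
  formZ : forall c u w, V u -> V w -> a (fun x => c * u x) w = c * a u w ;
  form_ge0 : forall u, V u -> 0 <= a u u }.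

Section form.
Context (R : realType) (Y : Type) (V : set (Y -> R)) (a : (Y -> R) -> (Y -> R) -> R).
Hypothesis Fa : psd_form V a.
Let V0 := form0_in Fa.
Let VD := formD_in Fa.
Let VZ := formZ_in Fa.
Let aC := formC Fa.
Let aD := formD Fa.
Let aZ := formZ Fa.
Let a_ge0 := form_ge0 Fa.

Lemma formN_in u : V u -> V (fun x => - u x).
Proof. by move=> /(VZ (-1)); under eq_fun do rewrite mulN1r. Qed.

Lemma formB_in u w : V u -> V w -> V (fun x => u x - w x).
Proof. by move=> Vu Vw; apply: VD => //; exact: formN_in. Qed.

Lemma formN u w : V u -> V w -> a (fun x => - u x) w = - a u w.
Proof.
by move=> Vu Vw; under eq_fun do rewrite -mulN1r; rewrite aZ// mulN1r.
Qed.

Lemma formB u1 u2 w : V u1 -> V u2 -> V w ->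
  a (fun x => u1 x - u2 x) w = a u1 w - a u2 w.
Proof. by move=> V1 V2 Vw; rewrite (aD V1 (formN_in V2))// formN. Qed.

Lemma formDr u w1 w2 : V u -> V w1 -> V w2 ->
  a u (fun x => w1 x + w2 x) = a u w1 + a u w2.
Proof.
by move=> Vu V1 V2; rewrite aC// ?aD//; [rewrite !(aC _ Vu)|exact: VD].
Qed.

Lemma formBr u w1 w2 : V u -> V w1 -> V w2 ->
  a u (fun x => w1 x - w2 x) = a u w1 - a u w2.
Proof.
by move=> Vu V1 V2; rewrite aC// ?formB//; [rewrite !(aC _ Vu)|exact: formB_in].
Qed.

Lemma formZr c u w : V u -> V w -> a u (fun x => c * w x) = c * a u w.
Proof. by move=> Vu Vw; rewrite aC ?aZ//; [rewrite aC|exact: VZ]. Qed.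

Lemma form_sqrD u w : V u -> V w ->
  a (fun x => u x + w x) (fun x => u x + w x) = a u u + 2 * a u w + a w w.
Proof.
move=> Vu Vw; rewrite (aD Vu Vw (VD Vu Vw)) !formDr// (aC Vw Vu); ring.
Qed.

Lemma form_sqrB u w : V u -> V w ->
  a (fun x => u x - w x) (fun x => u x - w x) = a u u - 2 * a u w + a w w.
Proof.
move=> Vu Vw; rewrite (formB Vu Vw (formB_in Vu Vw)) !formBr// (aC Vw Vu); ring.
Qed.

Lemma form_sqrZ c u : V u -> a (fun x => c * u x) (fun x => c * u x) = c ^+ 2 * a u u.
Proof. by move=> Vu; rewrite (aZ c Vu (VZ c Vu)) formZr//; ring. Qed.

Lemma form_mid u w : V u -> V w ->
  a (fun x => 2^-1 * (u x + w x)) (fun x => 2^-1 * (u x + w x)) =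
  (a u u + a w w) / 2 - 4^-1 * a (fun x => u x - w x) (fun x => u x - w x).
Proof.
move=> Vu Vw; rewrite (form_sqrZ _ (VD Vu Vw)) form_sqrD// form_sqrB//.
by field.
Qed.

Lemma form_CS u w : V u -> V w -> (a u w) ^+ 2 <= a u u * a w w.
Proof.
move=> Vu Vw.
have := a_ge0 Vw; rewrite le_eqVlt => /predU1P[w0|w0].
  rewrite -w0 mulr0.
  suff -> : a u w = 0 by rewrite expr0n.
  apply/eqP/contraT => uw0.
  pose t := (a u u + 1) / a u w.
  have := a_ge0 (formB_in Vu (VZ (t / 2) Vw)).
  rewrite (form_sqrB Vu (VZ _ Vw)) form_sqrZ// -w0 formZr// mulr0 addr0.
  have -> : 2 * (t / 2 * a u w) = a u u + 1 by rewrite /t; field.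
  lra.
have := a_ge0 (formB_in (VZ (a w w) Vu) (VZ (a u w) Vw)).
rewrite (form_sqrB (VZ _ Vu) (VZ _ Vw)) !form_sqrZ// (aZ _ Vu (VZ _ Vw)) formZr//.
rewrite (_ : _ + _ = a w w * (a u u * a w w - a u w ^+ 2)); last ring.
by rewrite pmulr_rge0// subr_ge0.
Qed.

Lemma form_young u w : V u -> V w -> 2 * a u w <= a u u + a w w.
Proof. by move=> Vu Vw; have := a_ge0 (formB_in Vu Vw); rewrite form_sqrB//; lra. Qed.

Lemma form_cvg0 (z : nat -> Y -> R) w : (forall k, V (z k)) -> V w ->
  (fun k => a (z k) (z k)) @ \oo --> (0 : R) ->
  (fun k => a w (z k)) @ \oo --> (0 : R).
Proof.
move=> Vz Vw z0; apply: cvg_sqr0.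
apply: (@squeeze0 _ _ (fun k => a w w * a (z k) (z k))).
  by move=> k; rewrite sqr_ge0 form_CS.
by rewrite -[X in _ --> X](mulr0 (a w w)); apply: cvgM => //; exact: cvg_cst.
Qed.

Lemma form_cvg (u : nat -> Y -> R) u0 w : (forall k, V (u k)) -> V u0 -> V w ->
  (fun k => a (fun x => u k x - u0 x) (fun x => u k x - u0 x)) @ \oo --> (0 : R) ->
  (fun k => a w (u k)) @ \oo --> a w u0.
Proof.
move=> Vu Vu0 Vw u0cv; apply/subr_cvg0.
under eq_fun do rewrite -formBr//.
by apply: form_cvg0 => // k; exact: formB_in.
Qed.

Lemma form_cvg_sqr (u : nat -> Y -> R) u0 : (forall k, V (u k)) -> V u0 ->
  (fun k => a (fun x => u k x - u0 x) (fun x => u k x - u0 x)) @ \oo --> (0 : R) ->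
  (fun k => a (u k) (u k)) @ \oo --> a u0 u0.
Proof.
move=> Vu Vu0 u0cv.
have E k : a (u k) (u k) = a (fun x => u k x - u0 x) (fun x => u k x - u0 x)
    + 2 * a u0 (u k) - a u0 u0.
  by rewrite form_sqrB// (aC (Vu k) Vu0); ring.
have H : (fun k => a (fun x => u k x - u0 x) (fun x => u k x - u0 x)
    + 2 * a u0 (u k) - a u0 u0) @ \oo --> 0 + 2 * a u0 u0 - a u0 u0.
  apply: cvgB; last exact: cvg_cst.
  apply: cvgD => //; apply: cvgM; first exact: cvg_cst.
  exact: form_cvg.
rewrite (_ : 0 + 2 * a u0 u0 - a u0 u0 = a u0 u0) in H; last ring.
by apply: cvg_trans H; apply: near_eq_cvg; apply: nearW => k; rewrite E.
Qed.

Definition form_cauchy (u : nat -> Y -> R) : Prop :=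
  forall e, 0 < e -> exists N, forall n m, (N <= n)%N -> (N <= m)%N ->
     a (fun x => u n x - u m x) (fun x => u n x - u m x) <= e.

Hypothesis V_complete : forall u : nat -> Y -> R, (forall n, V (u n)) ->
  form_cauchy u -> exists2 u0, V u0 &
  (fun k => a (fun x => u k x - u0 x) (fun x => u k x - u0 x)) @ \oo --> (0 : R).

Lemma linear_part_eq0 (b c : R) : (forall t, 0 <= t * b + t ^+ 2 * c) -> b = 0.
Proof.
move=> H; apply/eqP/contraT => b0.
pose s : R := `|c| + 1.
have s0 : 0 < s by rewrite /s ltr_pwDr.
have := H (- b / (2 * s)).
have -> : - b / (2 * s) * b + (- b / (2 * s)) ^+ 2 * c =
   - (b ^+ 2 / (4 * s ^+ 2)) * (2 * s - c) by field; exact: lt0r_neq0.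
rewrite mulNr oppr_ge0 pmulr_rle0.
  by rewrite /s; have := ler_norm c; have := normr_ge0 c; lra.
by apply: divr_gt0; [rewrite exprn_even_gt0|rewrite mulr_gt0 ?exprn_gt0].
Qed.

(** The representer is the minimiser of [a w w / 2 - l w]. *)
Lemma riesz (l : (Y -> R) -> R) (C : R) :
  (forall u w, V u -> V w -> l (fun x => u x + w x) = l u + l w) ->
  (forall c u, V u -> l (fun x => c * u x) = c * l u) ->
  (forall u, V u -> l u ^+ 2 <= C * a u u) ->
  exists2 u, V u & forall w, V w -> a u w = l w.
Proof.
move=> lD lZ lC.
pose F w := 2^-1 * a w w - l w.
pose K := `|C| + 1.
have K0 : 0 < K by rewrite /K ltr_pwDr.
have Fm w : V w -> - (K / 2) <= F w.
  move=> Vw; rewrite /F.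
  have h1 : l w ^+ 2 <= K * a w w.
    apply: (le_trans (lC _ Vw)); rewrite ler_wpM2r ?a_ge0// /K.
    by have := ler_norm C; lra.
  have h2 : l w ^+ 2 / K <= a w w by rewrite ler_pdivrMr// mulrC.
  have : l w ^+ 2 / K + K - 2 * l w = (l w - K) ^+ 2 / K by field; exact: lt0r_neq0.
  have : 0 <= (l w - K) ^+ 2 / K by rewrite divr_ge0 ?sqr_ge0// ltW.
  lra.
have lB u w : V u -> V w -> l (fun x => u x - w x) = l u - l w.
  move=> Vu Vw; rewrite lD//; last exact: formN_in.
  congr (_ + _); rewrite -mulN1r -lZ//; congr l.
  by apply/funext => x; rewrite mulN1r.
have [x [Vx xmin xC]] := @cauchy_near_minimizers R _ F
  (fun u w x => 2^-1 * (u x + w x))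
  (fun u w => 8^-1 * a (fun x => u x - w x) (fun x => u x - w x))
  (fun=> V) (- (K / 2)) (F (fun=> 0))
  (fun k l _ => @subset_refl _ V)
  (fun k u w Vu Vw => VZ _ (VD Vu Vw))
  (ltac:(by move=> u w Vu Vw; rewrite /F form_mid// lZ ?lD//; [lra|exact: VD]))
  Fm (ltac:(by move=> k; exists (fun=> 0))).
have [u Vu xu] : exists2 u0, V u0 &
  (fun k => a (fun y => x k y - u0 y) (fun y => x k y - u0 y)) @ \oo --> (0 : R).
  apply: V_complete => // e e0.
  have [N NP] := xC (8^-1 * e) (ltac:(by rewrite mulr_gt0)).
  by exists N => n m Nn Nm; have := NP _ _ Nn Nm; lra.
exists u => // w Vw; apply/eqP; rewrite -subr_eq0; apply/eqP.
have lx : (fun k => l (x k)) @ \oo --> l u.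
  apply/subr_cvg0; under eq_fun do rewrite -lB//.
  apply: cvg_sqr0.
  apply: (@squeeze0 _ _ (fun k => C * a (fun y => x k y - u y) (fun y => x k y - u y))).
    by move=> k; rewrite sqr_ge0 lC//; exact: formB_in.
  by rewrite -[X in _ --> X](mulr0 C); apply: cvgM => //; exact: cvg_cst.
have Fx : (fun k => F (x k)) @ \oo --> F u.
  apply: cvgB => //; apply: cvgM; first exact: cvg_cst.
  exact: form_cvg_sqr.
have Fu y : V y -> F u <= F y.
  move=> Vy.
  have h : (fun k => F y + k.+1%:R^-1) @ \oo --> F y + 0.
    by apply: cvgD; [exact: cvg_cst|exact: cvg_harmonic].
  rewrite addr0 in h; apply: ler_cvg_to Fx h _.
  by apply: nearW => k; exact: xmin.
apply: (@linear_part_eq0 _ (2^-1 * a w w)) => t.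
have := Fu _ (VD Vu (VZ t Vw)).
rewrite /F (form_sqrD Vu (VZ t Vw)) (form_sqrZ t Vw) (formZr t Vu Vw).
rewrite (lD _ _ Vu (VZ t Vw)) (lZ _ _ Vw).
lra.
Qed.

End form.

(** * Lebesgue measure on row vectors *)

Section lebesgue_rV_theory.
Context (R : realType) (d : nat).
Local Notation E := 'rV[R]_d.
Local Notation mu := (lebesgue_rV R d).
Implicit Types (x h a b : E) (A U : set E).

Lemma coord_le_norm x i : `|x ord0 i| <= `|x|.
Proof.
rewrite [leRHS]/Num.norm/= mx_normrE.
by apply: (le_trans _ (@le_bigmax _ _ _ 0 (fun k : 'I_1 * 'I_d => `|x k.1 k.2|) (ord0, i))).
Qed.

Lemma norm_le_coord x c : 0 <= c -> (forall i, `|x ord0 i| <= c) -> `|x| <= c.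
Proof.
move=> c0 xc; rewrite [leLHS]/Num.norm/= mx_normrE.
by apply: bigmax_le => // -[i j] _ /=; rewrite (ord1 i).
Qed.

Definition box (a b : E) : set E :=
  [set x | forall i, [set` `]a ord0 i, b ord0 i[] (rV_coord i x)].

Lemma measurable_box a b : measurable (box a b).
Proof.
by apply: (measurable_rV_box (B := fun i => [set` `]a ord0 i, b ord0 i[])) => i.
Qed.

Lemma ball_box x c : 0 < c ->
  ball x c = box (x - const_mx c) (x + const_mx c).
Proof.
move=> c0; apply/seteqP; split=> [y [_ xy] i|y yb].
  have := xy ord0 i; rewrite /box /rV_coord /ball/= in_itv/= !mxE ltr_norml => /andP[? ?].
  by apply/andP; split; lra.
split=> // i j; rewrite (ord1 i) /ball/= ltr_norml.
by have := yb j; rewrite /rV_coord /= in_itv/= !mxE => /andP[? ?]; apply/andP; split; lra.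
Qed.

Lemma measurable_ball x c : measurable (ball x c).
Proof. by apply: open_measurable_rV; exact: ball_open. Qed.

Lemma lebesgue_box a b : (forall i, a ord0 i <= b ord0 i) ->
  mu (box a b) = (\prod_(i < d) (b ord0 i - a ord0 i))%:E.
Proof.
move=> ab.
rewrite (lebesgue_rV_box (B := fun i => [set` `]a ord0 i, b ord0 i[]))//.
rewrite -prodEFin; apply: eq_bigr => i _.
rewrite lebesgue_measure_itv/= lte_fin; case: ltP => // ba.
by rewrite (_ : b ord0 i = a ord0 i) ?subrr//; apply/eqP; rewrite eq_le ba ab.
Qed.

Lemma lebesgue_ball_lty x c : (mu (ball x c) < +oo)%E.
Proof.
have [c0|c0] := ltP 0 c; last first.
  rewrite (_ : ball x c = set0) ?measure0//; apply/seteqP; split => // y [].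
  by rewrite ltNge c0.
rewrite ball_box// lebesgue_box ?ltry// => i; rewrite !mxE; lra.
Qed.

Lemma lebesgue_ball_gt0 x c : 0 < c -> (0 < mu (ball x c))%E.
Proof.
move=> c0; rewrite ball_box// lebesgue_box => [|i]; last by rewrite !mxE; lra.
by rewrite lte_fin; apply: prodr_gt0 => i _; rewrite !mxE; lra.
Qed.

Lemma bounded_lebesgue_lty A : measurable A -> bounded_set A -> (mu A < +oo)%E.
Proof.
move=> mA [M [_ /(_ (M + 1))]]; rewrite ltrDl => /(_ ltr01) AM.
apply: (le_lt_trans _ (lebesgue_ball_lty 0 (M + 2))).
apply: le_measure; rewrite ?inE//; first exact: measurable_ball.
move=> x /AM xM; rewrite -ball_normE /= sub0r normrN.
by apply: (le_lt_trans xM); lra.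
Qed.

Lemma ae_open_ex U (P : E -> Prop) : open U -> U !=set0 ->
  {ae mu, forall x, U x -> P x} -> exists2 x, U x & P x.
Proof.
move=> oU [x Ux] UP; apply: contrapT => noP.
have [c /= c0 cU] : nbhs_ball x U by apply/nbhs_ballP; exact: open_nbhs_nbhs.
have : mu.-negligible (ball x c).
  apply: negligibleS UP => y yc /= yP; apply: noP; exists y; first exact: cU.
  exact/yP/cU.
move=> /negligibleP/= => /(_ (measurable_ball _ _)) mu0.
by have := lebesgue_ball_gt0 x c0; rewrite mu0 ltxx.
Qed.

Definition rational_box (q : 'rV[rat]_d * 'rV[rat]_d) : set E :=
  box (map_mx ratr q.1) (map_mx ratr q.2).

Lemma nbhs_rational_box x U : nbhs x U ->
  exists2 q, rational_box q x & rational_box q `<=` U.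
Proof.
move=> /nbhs_ballP[c /= c0 cU].
have near i : exists q : rat * rat, [/\ x ord0 i - c < ratr q.1, ratr q.1 < x ord0 i,
    x ord0 i < ratr q.2 & ratr q.2 < x ord0 i + c].
  have h1 : x ord0 i - c < x ord0 i by lra.
  have h2 : x ord0 i < x ord0 i + c by lra.
  have [p] := rat_in_itvoo h1; have [q] := rat_in_itvoo h2.
  by rewrite !in_itv/= => /andP[? ?] /andP[? ?]; exists (p, q).
have [q qP] := choice near.
exists (\row_i (q i).1, \row_i (q i).2).
  by move=> i; have [? ? ? ?] := qP i; rewrite /rV_coord/= in_itv/= !mxE; apply/andP.
move=> y yq; apply: cU; rewrite ball_box// => i.
have [? ? ? ?] := qP i; have := yq i; rewrite /rV_coord/= !in_itv/= !mxE => /andP[? ?].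
by apply/andP; split; lra.
Qed.

(** Lindelof's property. *)
Lemma ae_local A (P : E -> Prop) :
  (forall x, A x -> exists2 U, nbhs x U & {ae mu, forall y, U y -> P y}) ->
  {ae mu, forall x, A x -> P x}.
Proof.
move=> H.
pose Q := [set q | {ae mu, forall y, rational_box q y -> P y}].
have : {ae mu, forall x (q : 'rV[rat]_d * 'rV[rat]_d), Q q -> rational_box q x -> P x}.
  have cQ n : {ae mu, forall x, if unpickle n is Some q then Q q -> rational_box q x -> P x else True}.
    case: unpickle => [q|]; last exact: aeW.
    have [Qq|nQ] := pselect (Q q); last by apply: aeW => x /nQ.
    by apply: filterS Qq => x + _; apply.
  have := ae_foralln cQ; apply: filterS => x Hx q; have := Hx (pickle q).
  by rewrite pickleK.
apply: filterS => x Hx Ax.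
have [U Ux UP] := H _ Ax; have [q qx qU] := nbhs_rational_box Ux.
by apply: (Hx q) => //; apply: filterS UP => y yP /qU.
Qed.

Lemma boxI a b a' b' :
  box a b `&` box a' b' = box (\row_i Num.max (a ord0 i) (a' ord0 i))
                              (\row_i Num.min (b ord0 i) (b' ord0 i)).
Proof.
apply/seteqP; split=> [x [xb xb'] i|x xb]; last split=> i.
- have := xb i; have := xb' i; rewrite /= !in_itv/= !mxE => /andP[? ?] /andP[? ?].
  by rewrite gt_max lt_min; apply/andP; split; apply/andP.
- by have := xb i; rewrite /= !in_itv/= !mxE gt_max lt_min => /andP[/andP[-> _] /andP[-> _]].
- by have := xb i; rewrite /= !in_itv/= !mxE gt_max lt_min => /andP[/andP[_ ->] /andP[_ ->]].
Qed.

Definition boxes : set (set E) := [set A | exists a b, A = box a b].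

Lemma setI_boxes : setI_closed boxes.
Proof. by move=> _ _ [a [b ->]] [a' [b' ->]]; rewrite boxI; do 2 eexists. Qed.

Lemma measurable_boxesE : @measurable _ E = <<s boxes >>.
Proof.
rewrite measurable_rVE; apply/seteqP; split; last first.
  apply: smallest_sub; first exact: smallest_sigma_algebra.
  move=> _ [a [b ->]]; rewrite -measurable_rVE; exact: measurable_box.
apply: smallest_sub; first exact: smallest_sigma_algebra.
move=> U oU.
rewrite (_ : U = \bigcup_(q in [set q | rational_box q `<=` U]) rational_box q); last first.
  apply/seteqP; split => [x Ux|x [q qU]]; last exact: qU.
  have [q qx qU] : exists2 q, rational_box q x & rational_box q `<=` U.
    by apply: nbhs_rational_box; exact: open_nbhs_nbhs.
  by exists q.
have sig : sigma_algebra setT (<<s boxes >>) by exact: smallest_sigma_algebra.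
rewrite bigcup_mkcond; apply: (@countable_bigcupT_measurable _
  (g_sigma_algebraType boxes)); first exact: countableP.
move=> q; case: ifPn => _; last exact: measurable0.
by apply: sub_sigma_algebra; do 2 eexists.
Qed.

Lemma measurable_shift h : measurable_fun setT (fun x => x + h).
Proof.
apply: measurable_fun_rVP => i.
rewrite (_ : _ \o _ = fun x => rV_coord i x + h ord0 i).
  by apply: measurable_funD => //; exact: measurable_rV_coord.
by apply/funext => x; rewrite /= /rV_coord mxE.
Qed.

Lemma ball_nat_cover : \bigcup_k ball (0 : E) k.+1%:R = setT.
Proof.
apply/seteqP; split => // x _.
have [k xk] : exists k, `|x| < k.+1%:R.
  by exists (Num.truncn `|x|); exact: truncnS_gt.
by exists k => //; rewrite -ball_normE /= sub0r normrN.
Qed.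

Lemma shift_preimage_box h a b :
  (fun x => x + h) @^-1` (box a b) = box (a - h) (b - h).
Proof.
by apply/seteqP; split => x xb i; have := xb i; rewrite /= /rV_coord/= !in_itv/= !mxE =>
  /andP[? ?]; apply/andP; split; lra.
Qed.

(** Boxes determine a measure that is finite on balls, and the volume of a box
    depends on its side lengths only. *)
Lemma lebesgue_shift h A : measurable A -> mu ((fun x => x + h) @^-1` A) = mu A.
Proof.
move=> mA; have mh := measurable_shift h.
pose pushed := [the {measure set E -> \bar R} of pushforward mu (fun x => x + h)].
pose shifted := pushed mh.
rewrite -[LHS]/(shifted A).
apply: (@measure_unique _ R E boxes (fun k => ball 0 k.+1%:R)) => //.
- exact: measurable_boxesE.
- exact: setI_boxes.
- by move=> k; rewrite ball_box//; do 2 eexists.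
- exact: ball_nat_cover.
- move=> _ [a [b ->]]; rewrite /shifted/pushed/= /pushforward shift_preimage_box.
  have [ab|] := pselect (forall i, a ord0 i <= b ord0 i).
    rewrite !lebesgue_box//; last by move=> i; rewrite !mxE lerD2r.
    by congr (_%:E); apply: eq_bigr => i _; rewrite !mxE; ring.
  move=> /existsNP[i /negP]; rewrite -ltNge => ba.
  have b0 a' b' : b' ord0 i < a' ord0 i -> box a' b' = set0.
    move=> ba'; apply/seteqP; split=> // x /(_ i); rewrite /= in_itv/= => /andP[? ?].
    lra.
  by rewrite !b0// !mxE ltrD2r.
- move=> k; rewrite /shifted/pushed/= /pushforward ball_box// shift_preimage_box lebesgue_box ?ltry// => i.
  by rewrite !mxE; have : 0 <= k.+1%:R :> R by []; lra.
Qed.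

Lemma L1_shift h (f : E -> R) : L1 mu setT f -> L1 mu setT (fun x => f (x + h)).
Proof.
move=> lf; have mf := L1_measurable lf.
apply/integrableP; split.
  by apply/measurable_EFinP; apply: (measurableT_comp mf); exact: measurable_shift.
have mf' : measurable_fun setT (fun x => `|(f x)%:E|)%E.
  by apply: measurableT_comp => //; exact/measurable_EFinP.
have := @ge0_integral_pushforward _ _ _ _ R _ (measurable_shift h) mu setT
  (fun x => `|(f x)%:E|%E) measurableT mf' (fun _ _ => abse_ge0 _).
rewrite preimage_setT => <-.
rewrite (@eq_measure_integral _ _ _ _ mu); last 2 first.
- exact: measurable_shift.
- by move=> mh A mA _; exact: lebesgue_shift.
by have /integrableP[] := lf.
Qed.

Lemma I_shift h (f : E -> R) : L1 mu setT f ->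
  \int[mu]_x f (x + h) = \int[mu]_x f x.
Proof.
move=> lf; have mf := L1_measurable lf.
have := @integral_pushforward _ _ _ _ R _ (measurable_shift h) mu setT (EFin \o f)
  ((measurable_EFinP _ _).2 mf).
rewrite preimage_setT => /(_ (L1_shift h lf) measurableT).
rewrite (@eq_measure_integral _ _ _ _ mu); last 2 first.
- exact: measurable_shift.
- by move=> mh A mA _; exact: lebesgue_shift.
by rewrite /Rintegral => /= ->.
Qed.

End lebesgue_rV_theory.

(** * Continuously differentiable functions of several variables *)

Section continuity.
Context (R : realType) (T : topologicalType).
Implicit Types f g : T -> R.

Lemma continuous_funD f g : continuous f -> continuous g ->
  continuous (fun x => f x + g x).
Proof. by move=> cf cg x; apply: cvgD; [exact: cf|exact: cg]. Qed.

Lemma continuous_funM f g : continuous f -> continuous g ->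
  continuous (fun x => f x * g x).
Proof. by move=> cf cg x; apply: cvgM; [exact: cf|exact: cg]. Qed.

Lemma continuous_funV f : (forall x, f x != 0) -> continuous f ->
  continuous (fun x => (f x)^-1).
Proof. by move=> f0 cf x; apply: cvgV => //; exact: cf. Qed.

Lemma continuous_fun_comp (phi : R -> R) f : continuous phi -> continuous f ->
  continuous (fun x => phi (f x)).
Proof. by move=> cphi cf x; apply: continuous_comp; [exact: cf|exact: cphi]. Qed.

End continuity.

Section directional_derivative.
Context (R : realType) (d : nat).
Local Notation E := 'rV[R]_d.
Implicit Types (f g : E -> R) (x v : E).

Lemma growth_rate_line f x v s :
  (fun h : R => h^-1 *: ((f \o shift (x + s *: v)) (h *: v) - f (x + s *: v))) =
  (fun h : R => h^-1 *: (((fun t => f (x + t *: v)) \o shift s) (h *: 1) - f (x + s *: v))).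
Proof.
apply/funext => h /=; congr (_ *: (f _ - _)).
by rewrite addrC -addrA -scalerDl [_%:A]mulr1 [h + s]addrC.
Qed.

Lemma is_derive_line f x v s l :
  is_derive (x + s *: v) v f l <-> is_derive s (1 : R) (fun t => f (x + t *: v)) l.
Proof.
by split=> -[h1 h2]; constructor; move: h1 h2;
  rewrite /derivable /derive growth_rate_line.
Qed.

Lemma is_derive_comp (phi : R -> R) g x v l l' :
  is_derive x v g l -> is_derive (g x) (1 : R) phi l' ->
  is_derive x v (fun y => phi (g y)) (l' * l).
Proof.
rewrite -{1}[x]addr0 -(scale0r v) => /is_derive_line gl phil.
rewrite -[x]addr0 -(scale0r v); apply/is_derive_line.
rewrite -[x in g x]addr0 -(scale0r v) in phil.
exact: (@is_derive1_comp _ phi (fun t => g (x + t *: v))).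
Qed.

(** The mean value theorem along a line. *)
Lemma lipschitz_line f v M : (forall x, derivable f x v) ->
  (forall x, `|'D_v f x| <= M) ->
  forall x t, `|f (x + t *: v) - f x| <= M * `|t|.
Proof.
move=> df fM x t.
have dg s : is_derive s (1 : R) (fun t => f (x + t *: v)) ('D_v f (x + s *: v)).
  by apply/is_derive_line; exact: derivableP.
have cg (a b : R) : {within `[a, b], continuous (fun t => f (x + t *: v))}.
  by apply: derivable_within_continuous => s _; case: (dg s).
have H (a b : R) : a < b ->
    `|f (x + b *: v) - f (x + a *: v)| <= M * (b - a).
  move=> ab; have [c _ ->] := MVT ab (fun s _ => dg s) (cg a b).
  by rewrite normrM (gtr0_norm (_ : 0 < b - a)) ?subr_gt0// ler_wpM2r// subr_ge0 ltW.
have [t0|t0|<-] := ltgtP 0 t.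
- by have := H _ _ t0; rewrite scale0r addr0 subr0 (gtr0_norm t0).
- have := H _ _ t0; rewrite scale0r addr0 sub0r distrC; by rewrite (ltr0_norm t0).
- by rewrite scale0r addr0 subrr !normr0 mulr0.
Qed.

Lemma CkS_Ck k f : Ck k.+1 f -> Ck k f.
Proof.
elim: k f => [|k IH] f [cf df]; split => // i.
by split; [exact: (df i).1|exact/IH/(df i).2].
Qed.

Lemma Ck_continuous k f : Ck k f -> continuous f.
Proof. by case: k => [|k] []. Qed.

Lemma Ck_eq k f g : (forall x, f x = g x) -> Ck k f -> Ck k g.
Proof. by move=> /funext ->. Qed.

Lemma continuous_is_derive (phi : R -> R) t l : is_derive t (1 : R) phi l ->
  {for t, continuous phi}.
Proof. by move=> [/derivable1_diffP/differentiable_continuous]. Qed.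

(** The recursive step of all closure properties of [Ck] below: each operation
    is handled by induction on [k], simultaneously for all its arguments,
    through the formula that gives its partial derivatives. *)
Lemma CkSI k f (df : 'I_d -> E -> R) : continuous f ->
  (forall i x, is_derive x (delta_mx ord0 i) f (df i x)) ->
  (forall i, Ck k (df i)) -> Ck k.+1 f.
Proof.
move=> cf dfE Cdf; split=> // i; split; first by move=> x; case: (dfE i x).
by apply: Ck_eq (Cdf i) => x; rewrite /partial; case: (dfE i x).
Qed.

Lemma CkS_derive k f : Ck k.+1 f ->
  forall i x, is_derive x (delta_mx ord0 i) f (partial i f x).
Proof. by move=> [_ df] i x; apply: derivableP; exact: (df i).1. Qed.

Lemma Ck_partial k f i : Ck k.+1 f -> Ck k (partial i f).
Proof. by move=> [_ df]; exact: (df i).2. Qed.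

Lemma Ck_cst k (c : R) : Ck k (fun _ : E => c).
Proof.
elim: k c => [|k IH] c; first by split=> //; exact: cst_continuous.
apply: (@CkSI k (fun=> c) (fun _ _ => 0)) => [|i]; last exact: IH.
exact: cst_continuous.
Qed.

Lemma CkD k f g : Ck k f -> Ck k g -> Ck k (fun x => f x + g x).
Proof.
elim: k f g => [|k IH] f g Cf Cg.
  by split=> //; apply: continuous_funD; [exact: (Ck_continuous Cf)|exact: (Ck_continuous Cg)].
apply: (@CkSI _ _ (fun i x => partial i f x + partial i g x)) => [|i x|i].
- by apply: continuous_funD; [exact: (Ck_continuous Cf)|exact: (Ck_continuous Cg)].
- by apply: is_deriveD; [exact: (CkS_derive Cf)|exact: (CkS_derive Cg)].
- by apply: IH; [exact: (Ck_partial i Cf)|exact: (Ck_partial i Cg)].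
Qed.

Lemma CkM k f g : Ck k f -> Ck k g -> Ck k (fun x => f x * g x).
Proof.
elim: k f g => [|k IH] f g Cf Cg.
  by split=> //; apply: continuous_funM; [exact: (Ck_continuous Cf)|exact: (Ck_continuous Cg)].
apply: (@CkSI _ _ (fun i x => f x * partial i g x + g x * partial i f x)) => [|i x|i].
- by apply: continuous_funM; [exact: (Ck_continuous Cf)|exact: (Ck_continuous Cg)].
- by apply: is_deriveM; [exact: (CkS_derive Cf)|exact: (CkS_derive Cg)].
- by apply: CkD; apply: IH; (exact: (Ck_partial i Cf) || exact: (Ck_partial i Cg) || exact: (CkS_Ck Cf) || exact: (CkS_Ck Cg)).
Qed.

Lemma is_derive_coord i j x :
  is_derive x (delta_mx ord0 j) (fun x : E => x ord0 i) (j == i)%:R.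
Proof.
have -> : (j == i)%:R = (delta_mx ord0 j : E) ord0 i :> R by rewrite mxE eqxx eq_sym.
set v := delta_mx ord0 j.
have cv : (fun h : R => h^-1 *: (((fun x : E => x ord0 i) \o shift x) (h *: v) - x ord0 i))
    @ 0^' --> v ord0 i.
  apply: cvg_near_cst; near=> h.
  rewrite /= 2!mxE addrK /GRing.scale/= mulrA mulVf ?mul1r//.
  by near: h; exact: nbhs_dnbhs_neq.
by constructor; [apply/cvg_ex; exists (v ord0 i)|exact: cvg_lim cv].
Unshelve. all: by end_near. Qed.

Lemma Ck_coord k i : Ck k (fun x : E => x ord0 i).
Proof.
have cc : continuous (fun x : E => x ord0 i) by exact: coord_continuous.
case: k => [|k]; first by split.
apply: (@CkSI _ _ (fun j _ => (j == i)%:R)) => // [j x|j]; last exact: Ck_cst.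
exact: is_derive_coord.
Qed.

Lemma Ck_prod k n (f : 'I_n -> E -> R) : (forall i, Ck k (f i)) ->
  Ck k (fun x => \prod_(i < n) f i x).
Proof.
elim: n f => [|n IH] f Cf.
  by under eq_fun do rewrite big_ord0; exact: Ck_cst.
under eq_fun do rewrite big_ord_recl.
by apply: CkM => //; exact: IH.
Qed.

Lemma Ck_inv k f : (forall x, f x != 0) -> Ck k f -> Ck k (fun x => (f x)^-1).
Proof.
move=> f0; elim: k => [|k IH] Cf.
  by split=> //; apply: continuous_funV => //; exact: (Ck_continuous Cf).
apply: (@CkSI _ _ (fun i x => (-1 * (f x)^-1 * (f x)^-1) * partial i f x)) => [|i x|i].
- by apply: continuous_funV => //; exact: (Ck_continuous Cf).
- apply: (@is_derive_comp GRing.inv); first exact: (CkS_derive Cf).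
  apply: is_derive_eq; first exact: (@is_deriveV _ id).
  by rewrite /= scaler1 expr2 invfM mulN1r mulNr.
- have Cf' := CkS_Ck Cf; apply: CkM; last exact: (Ck_partial i Cf).
  by apply: CkM; [apply: CkM; [exact: Ck_cst|]|]; exact: IH.
Qed.

Lemma Ck_sqrt k f : (forall x, 0 < f x) -> Ck k f -> Ck k (fun x => Num.sqrt (f x)).
Proof.
move=> f0; elim: k => [|k IH] Cf.
  by split=> //; apply: continuous_fun_comp; [exact: sqrt_continuous|exact: (Ck_continuous Cf)].
apply: (@CkSI _ _ (fun i x => (2 * Num.sqrt (f x))^-1 * partial i f x)) => [|i x|i].
- by apply: continuous_fun_comp; [exact: sqrt_continuous|exact: (Ck_continuous Cf)].
- by apply: is_derive_comp; [exact: (CkS_derive Cf)|exact: is_derive1_sqrt].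
- have Cf' := CkS_Ck Cf; apply: CkM; last exact: (Ck_partial i Cf).
  apply: Ck_inv => [x|]; first by rewrite mulf_neq0 ?gt_eqF ?sqrtr_gt0.
  by apply: CkM; [exact: Ck_cst|exact: IH].
Qed.

(** The functions [t ^- k * exp (- 1 / t)], extended by 0 to [t <= 0], are
    closed under differentiation up to linear combinations. *)
Definition flat k (t : R) : R := if 0 < t then t^-1 ^+ k * expR (- t^-1) else 0.

Lemma flat_ge0 k t : 0 <= flat k t.
Proof.
rewrite /flat; case: ifPn => // t0; rewrite mulr_ge0 ?expR_ge0// exprn_ge0//.
by rewrite invr_ge0 ltW.
Qed.

Lemma flat_bound k t : flat k t <= k.+2`!%:R * t ^+ 2.
Proof.
rewrite /flat; case: ifPn => t0; last by rewrite mulr_ge0 ?sqr_ge0.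
have s0 : 0 < t^-1 by rewrite invr_gt0.
have h := expR_ge1Dxn k.+1 (ltW s0).
rewrite expRN ler_pdivrMr ?expR_gt0//.
have h2 : t^-1 ^+ k.+2 / k.+2`!%:R <= expR t^-1.
  by apply: le_trans h; rewrite lerDr.
have f0 : 0 < k.+2`!%:R :> R by rewrite ltr0n fact_gt0.
apply: (@le_trans _ _ (k.+2`!%:R * t ^+ 2 * (t^-1 ^+ k.+2 / k.+2`!%:R))).
  move: (k.+2`!%:R) f0 => c c0; rewrite 2!(exprS t^-1).
  move: (t^-1 ^+ k) => y; suff -> : c * t ^+ 2 * (t^-1 * (t^-1 * y) / c) = y by [].
  by field; rewrite (gt_eqF c0) (gt_eqF t0).
by rewrite ler_wpM2l// mulr_ge0 ?ltW// exprn_gt0.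
Qed.

Lemma is_derive_flat k t :
  is_derive t (1 : R) (flat k) (flat k.+2 t - k%:R * flat k.+1 t).
Proof.
have [t0|t0|->] := ltgtP t 0.
- rewrite /flat !ltNge (ltW t0) /= mulr0 subr0.
  apply: (@near_eq_is_derive _ _ _ (cst 0)).
  by near=> s; rewrite ltNge (_ : s <= 0)// ltW//; near: s; exact: lt_nbhsl.
- rewrite /flat t0 /=; apply: (@near_eq_is_derive _ _ _ (fun s : R => s^-1 ^+ k * expR (- s^-1))).
    by near=> s; rewrite ifT//; near: s; exact: lt_nbhsr.
  have dV : is_derive t (1 : R) (fun s : R => s^-1) (- t ^- 2).
    apply: is_derive_eq; first by apply: (@is_deriveV _ id); rewrite gt_eqF.
    by rewrite /= scaler1.
  have dX : is_derive t (1 : R) (fun s : R => s^-1 ^+ k) ((k%:R * t^-1 ^+ k.-1) *: - t ^- 2).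
    rewrite (_ : (fun _ => _) = (fun s : R => s^-1) ^+ k); first exact: is_deriveX.
    by apply/funext => s; rewrite exprfctE.
  have dE : is_derive t (1 : R) (fun s : R => expR (- s^-1)) (expR (- t^-1) * - (- t ^- 2)).
    apply: (@is_derive1_comp _ expR (fun s => - s^-1)).
  apply: (is_derive_eq (is_deriveM dX dE)).
  rewrite /= /GRing.scale/= opprK.
  rewrite -!exprVn; move: (t^-1) (expR _) => s e.
  by case: k {dX} => [|k]; rewrite /= ?exprS; ring.
- rewrite /flat ltxx mulr0 subr0.
  have cv : (fun h : R => h^-1 *: ((flat k \o shift 0) (h *: (1 : R)) - flat k 0)) @ 0^' --> (0 : R).
    apply/cvgr0Pnorm_le => e e0; near=> h.
    rewrite /= addr0 [_%:A]mulr1 {2}/flat ltxx subr0 normrM normfV.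
    have h0 : h != 0 by near: h; exact: nbhs_dnbhs_neq.
    rewrite ler_pdivrMl ?normr_gt0// (ger0_norm (flat_ge0 _ _)).
    apply: (le_trans (flat_bound _ _)); rewrite -(real_normK (num_real h)) expr2 mulrA mulrC.
    rewrite ler_wpM2l// mulrC -ler_pdivlMr ?ltr0n ?fact_gt0//.
    near: h; apply: nbhs_dnbhs; apply/nbhs_ballP.
    exists (e / k.+2`!%:R); first by rewrite /= divr_gt0// ltr0n fact_gt0.
    by move=> h; rewrite /ball/= sub0r normrN => /ltW.
  by constructor; [apply/cvg_ex; exists 0|exact: cvg_lim].
Unshelve. all: by end_near. Qed.

Lemma Ck_flat k j f : Ck k f -> Ck k (fun x => flat j (f x)).
Proof.
have cflat i : continuous (flat i).
  by move=> t; exact: (continuous_is_derive (is_derive_flat i t)).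
elim: k j f => [|k IH] j f Cf.
  by split=> //; apply: continuous_fun_comp; [exact: cflat|exact: (Ck_continuous Cf)].
apply: (@CkSI _ _ (fun i x => (flat j.+2 (f x) + - j%:R * flat j.+1 (f x)) * partial i f x)) => [|i x|i].
- by apply: continuous_fun_comp; [exact: cflat|exact: (Ck_continuous Cf)].
- apply: is_derive_comp; first exact: (CkS_derive Cf).
  by apply: is_derive_eq; [exact: is_derive_flat|rewrite mulNr].
- have Cf' := CkS_Ck Cf; apply: CkM; last exact: (Ck_partial i Cf).
  by apply: CkD; [exact: IH|apply: CkM; [exact: Ck_cst|exact: IH]].
Qed.

End directional_derivative.

(** * Integration of compactly supported functions of class C^1 *)

Lemma sum_sqr_le (R : realFieldType) (a : nat -> R) n :
  (\sum_(0 <= k < n) a k) ^+ 2 <= n%:R * \sum_(0 <= k < n) a k ^+ 2.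
Proof.
elim: n => [|n IH]; first by rewrite !big_geq// expr0n mul0r.
rewrite !big_nat_recr//=; move: IH.
set S := \sum_(0 <= k < n) _; set Q := \sum_(0 <= k < n) _ => IH.
case: n @S @Q IH => [|n] S Q IH.
  by rewrite /S /Q !big_geq// !add0r mul1r.
have n0 : 0 < n.+1%:R :> R by rewrite ltr0n.
rewrite -[n.+2]addn1 natrD; move: (n.+1%:R) n0 IH => c c0 IH.
rewrite -(ler_pM2l c0).
have := sqr_ge0 (S - c * a n.+1); move: (a n.+1) (Q) (S) IH => y q s IH h.
nra.
Qed.

Lemma L1_restrict d (T : measurableType d) (R : realType)
    (mu : {measure set T -> \bar R}) (D : set T) (f : T -> R) :
  measurable D -> L1 mu D f <-> L1 mu setT (f \_ D).
Proof.
move=> mD; rewrite /L1; split.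
  by move/(integrable_mkcond _ mD); rewrite restrict_EFin.
by move=> h; apply/(integrable_mkcond _ mD); rewrite restrict_EFin.
Qed.

Lemma restrict_zero (T : Type) (R : realType) (D : set T) (f : T -> R) :
  (forall x, ~ D x -> f x = 0) -> f \_ D = f.
Proof.
move=> f0; apply/funext => x; rewrite /patch; case: ifPn => // /negP nD.
by rewrite f0// => Dx; apply: nD; exact/mem_set.
Qed.

Section compactly_supported.
Context (R : realType) (d : nat).
Local Notation E := 'rV[R]_d.
Local Notation mu := (lebesgue_rV R d).
Local Notation I f := (Rintegral mu setT f).
Implicit Types (f g : E -> R) (x h : E) (r s b M : R).

Lemma continuous_measurable_rV f : continuous f -> measurable_fun setT f.
Proof.
move=> cf; apply: (measurability _ (RGenOpens.measurableE R)) => _ [_ [a [b ->] <-]].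
rewrite setTI; apply: open_measurable_rV.
apply: open_comp; last exact: interval_open.
by move=> x _; exact: cf.
Qed.

Lemma continuous_supp_bounded f r : continuous f ->
  (forall x, r < `|x| -> f x = 0) -> exists2 M, 0 <= M & forall x, `|f x| <= M.
Proof.
move=> cf f0; pose A := closed_ball (0 : E) (`|r| + 1).
have r0 : 0 < `|r| + 1 by rewrite ltr_pwDr.
have AE : A = [set x : E | `|x| <= `|r| + 1].
  rewrite /A closed_ballE// /closed_ball_; apply/funext => x /=.
  by rewrite sub0r normrN.
have cA : compact A.
  apply: bounded_closed_compact; last exact: closed_ball_closed.
  exists (`|r| + 1); split; first exact: num_real.
  by move=> M rM x; rewrite AE /= => /le_trans; apply; exact: ltW.
have cnf : {within A, continuous (fun x => `|f x|)}.
  apply: continuous_subspaceT => x.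
  by apply: (@continuous_comp _ _ _ f (@Num.norm R R)); [exact: cf|exact: norm_continuous].
have A0 : A !=set0 by exists 0; rewrite AE /= normr0 ltW.
have [c _ cM] := compact_EVT_max A0 cA cnf.
exists `|f c| => // x.
have [Ax|nAx] := pselect (A x); first by apply: cM; rewrite inE.
rewrite f0 ?normr0//; move: nAx; rewrite AE /= => /negP; rewrite -ltNge.
by apply: le_lt_trans; rewrite (le_trans (ler_norm r))// lerDl.
Qed.

Lemma L1_bounded_supp f r M : measurable_fun setT f ->
  (forall x, `|f x| <= M) -> (forall x, r < `|x| -> f x = 0) -> L1 mu setT f.
Proof.
move=> mf fM f0; pose B := ball (0 : E) (`|r| + 1).
have mB : measurable B by exact: measurable_ball.
have fB : f \_ B = f.
  apply: restrict_zero => x nB; apply: f0; apply: contra_notT nB.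
  rewrite -leNgt => xr; rewrite /B -ball_normE /= sub0r normrN.
  by rewrite (le_lt_trans xr)// (le_lt_trans (ler_norm _))// ltrDl.
rewrite -fB; apply/(L1_restrict _ _ mB).
apply: (@L1_dom _ _ _ mu B mB _ (fun=> M)).
- exact: measurable_funTS.
- by apply: L1_cst => //; exact: lebesgue_ball_lty.
- by apply: aeW => x _; exact: fM.
Qed.

Definition C1c f := Ck 1 f /\ exists r, forall x, r < `|x| -> f x = 0.

Lemma C1c_continuous f : C1c f -> continuous f.
Proof. by move=> [/Ck_continuous]. Qed.

Lemma C1c_measurable f : C1c f -> measurable_fun setT f.
Proof. by move=> /C1c_continuous/continuous_measurable_rV. Qed.

Lemma partial_eq0 f i x : nbhs x [set y | f y = 0] -> partial i f x = 0.
Proof.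
move=> fx; rewrite /partial (@near_eq_derive _ _ _ f (cst 0)) ?derive_cst//.
Qed.

Lemma partial_supp f r : (forall x, r < `|x| -> f x = 0) ->
  forall i x, r < `|x| -> partial i f x = 0.
Proof.
move=> f0 i x rx; apply: partial_eq0.
have /(@norm_continuous R E x) : nbhs `|x| [set y | r < y] by exact: lt_nbhsr.
by move=> rn; apply: (@filterS _ _ (nbhs_filter x) _ _ _ rn) => y /= /f0.
Qed.

Lemma C1c_partial_continuous f i : C1c f -> continuous (partial i f).
Proof. by move=> [/(Ck_partial i)/Ck_continuous]. Qed.

Lemma C1c_partial_measurable f i : C1c f -> measurable_fun setT (partial i f).
Proof. by move=> /(@C1c_partial_continuous _ i)/continuous_measurable_rV. Qed.

Lemma C1c_bounded f : C1c f -> exists2 M, 0 <= M & forall x, `|f x| <= M.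
Proof. by move=> cf; have [r fr] := cf.2; apply: continuous_supp_bounded fr; exact: C1c_continuous. Qed.

Lemma C1c_partial_bounded f i : C1c f ->
  exists2 M, 0 <= M & forall x, `|partial i f x| <= M.
Proof.
move=> cf; have [r fr] := cf.2.
by apply: (continuous_supp_bounded _ (partial_supp fr i)); exact: C1c_partial_continuous.
Qed.

Lemma C1c_L1 f : C1c f -> L1 mu setT f.
Proof.
move=> cf; have [r fr] := cf.2; have [M _ fM] := C1c_bounded cf.
by apply: (L1_bounded_supp _ fM fr); exact: C1c_measurable.
Qed.

Lemma C1c_L2 f : C1c f -> L2 mu setT f.
Proof.
move=> cf; split; first exact: C1c_measurable.
have [r fr] := cf.2; have [M M0 fM] := C1c_bounded cf.
apply: (@L1_bounded_supp _ r (M ^+ 2)).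
- by apply: measurable_funX; exact: C1c_measurable.
- by move=> x; rewrite normrX lerXn2r ?nnegrE.
- by move=> x /fr ->; rewrite expr0n.
Qed.

Lemma C1c_partial_L2 f i : C1c f -> L2 mu setT (partial i f).
Proof.
move=> cf; split; first exact: C1c_partial_measurable.
have [r fr] := cf.2; have [M M0 fM] := C1c_partial_bounded i cf.
apply: (@L1_bounded_supp _ r (M ^+ 2)).
- by apply: measurable_funX; exact: C1c_partial_measurable.
- by move=> x; rewrite normrX lerXn2r ?nnegrE.
- by move=> x /(partial_supp fr i) ->; rewrite expr0n.
Qed.

Lemma C1cM f g : Ck 1 f -> C1c g -> C1c (fun x => f x * g x).
Proof.
move=> Cf [Cg [r gr]]; split; first exact: CkM.
by exists r => x /gr ->; rewrite mulr0.
Qed.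

Lemma C1c_lipschitz f i : C1c f ->
  exists2 M, 0 <= M & forall x t, `|f (x + t *: delta_mx ord0 i) - f x| <= M * `|t|.
Proof.
move=> cf; have [M M0 fM] := C1c_partial_bounded i cf; exists M => //.
by have [[_ df] _] := cf; apply: lipschitz_line => //; exact: (df i).1.
Qed.

Definition quotient f i (t : R) x := t^-1 * (f (x + t *: delta_mx ord0 i) - f x).

Lemma quotient_cvg f i (t : nat -> R) x : C1c f -> (forall n, t n != 0) ->
  t @ \oo --> (0 : R) -> (fun n => quotient f i (t n) x) @ \oo --> partial i f x.
Proof.
move=> [[_ df] _] tn0 t0; have /cvg_ex[l fl] := (df i).1 x.
rewrite /partial /derive (cvg_lim _ fl)//.
move: fl => /cvgr_dnbhsP/(_ t) fl.
rewrite (_ : (fun n => _) = (fun n => (t n)^-1 *: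
    ((f \o shift x) (t n *: delta_mx ord0 i) - f x))).
  exact: fl.
by apply/funext => n; rewrite /quotient /= [x + _]addrC.
Qed.

Lemma quotient_measurable f i t : C1c f -> measurable_fun setT (quotient f i t).
Proof.
move=> cf; apply: measurable_funM => //; apply: measurable_funB; last exact: C1c_measurable.
by apply: (measurableT_comp (C1c_measurable cf)); exact: measurable_shift.
Qed.

(** The Lipschitz constant, on a ball that contains the supports of all the
    translates. *)
Lemma quotient_dom f i b : C1c f -> exists2 g, L1 mu setT g /\ L2 mu setT g &
  forall t x, t != 0 -> `|t| <= b -> `|quotient f i t x| <= g x.
Proof.
move=> cf; have [M M0 fM] := C1c_lipschitz i cf; have [r fr] := cf.2.
pose B := ball (0 : E) (`|r| + `|b| + 1).
have mB : measurable B by exact: measurable_ball.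
exists ((fun=> M) \_ B); first (split; last split).
- by apply/(L1_restrict _ _ mB)/L1_cst => //; exact: lebesgue_ball_lty.
- by apply/(measurable_restrictT _ mB); exact: measurable_cst.
- have : L1 mu B (fun=> M ^+ 2) by apply: L1_cst => //; exact: lebesgue_ball_lty.
  move/(L1_restrict _ _ mB); congr L1; apply/funext => x; rewrite /patch.
  by case: ifP => // _; rewrite expr0n.
- move=> t x t0 tb; rewrite /patch; case: ifPn => [_|/negP nB].
    rewrite /quotient normrM normfV mulrC ler_pdivrMr ?normr_gt0//.
  have {}nB : `|r| + `|b| + 1 <= `|x|.
    rewrite leNgt; apply/negP => xB; apply: nB; apply/mem_set.
    by rewrite /B -ball_normE /= sub0r normrN.
  have rx : r < `|x|.
    by have := ler_norm r; have := normr_ge0 b; lra.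
  have rxt : r < `|x + t *: delta_mx ord0 i|.
    have : `|x| <= `|x + t *: delta_mx ord0 i| + `|t *: (delta_mx ord0 i : E)|.
      by have := ler_normB (x + t *: delta_mx ord0 i) (t *: delta_mx ord0 i); rewrite addrK.
    have : `|t *: (delta_mx ord0 i : E)| <= `|b|.
      apply: norm_le_coord => // j; rewrite !mxE eqxx /=.
      case: eqP => _; rewrite ?mulr1 ?mulr0 ?normr0//.
      exact: (le_trans tb (ler_norm _)).
    by have := ler_norm r; lra.
  by rewrite /quotient !fr// subrr mulr0 normr0.
Qed.

Lemma inv_nat_cvg0 (c : R) : (fun n => c * n.+1%:R^-1) @ \oo --> (0 : R).
Proof.
rewrite -[X in _ --> X](mulr0 c); apply: cvgM; first exact: cvg_cst.
exact: cvg_harmonic.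
Qed.

Lemma inv_nat_le (c : R) n : `|c * n.+1%:R^-1| <= `|c|.
Proof.
rewrite normrM ler_piMr// ger0_norm ?invr_ge0// invf_le1 ?ltr0n//.
by rewrite ler1n.
Qed.

(** Translation invariance makes the integrals of all difference quotients
    vanish. *)
Lemma I_partial f i : C1c f -> I (partial i f) = 0.
Proof.
move=> cf; have [g [lg _] fg] := quotient_dom i 1 cf.
have tn0 n : 1 * n.+1%:R^-1 != 0 :> R by rewrite mul1r.
have tn1 n : `|1 * n.+1%:R^-1| <= 1 :> R by rewrite (le_trans (inv_nat_le 1 n))// normr1.
have [r fr] := cf.2; have [M _ fM] := C1c_partial_bounded i cf.
have lp : L1 mu setT (partial i f).
  by apply: (L1_bounded_supp _ fM (partial_supp fr i)); exact: C1c_partial_measurable.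
have Iq n : I (quotient f i (1 * n.+1%:R^-1)) = 0.
  rewrite /quotient I_Z//; last by apply: L1B => //; [apply: L1_shift|]; exact: C1c_L1.
  rewrite I_B//; [|by apply: L1_shift; exact: C1c_L1|exact: C1c_L1].
  by rewrite I_shift ?subrr ?mulr0//; exact: C1c_L1.
have [_ cv] : L1 mu setT (partial i f) /\
    (fun n => I (quotient f i (1 * n.+1%:R^-1))) @ \oo --> I (partial i f).
  apply: (@dominated_L1 _ _ _ mu setT measurableT _ _ g) => //.
  - by move=> n; exact: quotient_measurable.
  - exact: C1c_partial_measurable.
  - by move=> n; apply: aeW => x _; exact: fg.
  - by apply: aeW => x _; apply: quotient_cvg => //; exact: inv_nat_cvg0.
by rewrite -(cvg_lim _ cv)// (_ : (fun n => _) = cst 0) ?lim_cst//; apply/funext.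
Qed.

Lemma L2_shift h f : L2 mu setT f -> L2 mu setT (fun x => f (x + h)).
Proof.
move=> [mf lf]; split; last exact: (L1_shift h lf).
by apply: (measurableT_comp mf); exact: measurable_shift.
Qed.

Lemma shift_sum_le f (w : nat -> E) n : L2 mu setT f ->
  I (fun x => (f (x + \sum_(0 <= k < n) w k) - f x) ^+ 2) <=
  n%:R * \sum_(0 <= k < n) I (fun x => (f (x + w k) - f x) ^+ 2).
Proof.
move=> lf.
have lk h : L1 mu setT (fun x => (f (x + h) - f x) ^+ 2).
  by have [] := L2B measurableT (L2_shift h lf) lf.
pose S k := \sum_(0 <= j < k) w j.
have lS k : L1 mu setT (fun x => (f (x + S k.+1) - f (x + S k)) ^+ 2).
  by have [] := L2B measurableT (L2_shift (S k.+1) lf) (L2_shift (S k) lf).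
have IS k : I (fun x => (f (x + S k.+1) - f (x + S k)) ^+ 2) =
    I (fun x => (f (x + w k) - f x) ^+ 2).
  rewrite -(I_shift (S k) (lk _)); apply: eq_Rintegral => x _.
  by rewrite /S big_nat_recr//= addrA.
under [in leRHS]eq_bigr do rewrite -IS.
rewrite [in leRHS]big_mkord -I_sum// -I_Z//; last exact: (L1_sum _ (fun i : 'I_n => lS i)).
apply: I_le => //.
  by apply: L1Z => //; exact: (L1_sum _ (fun i : 'I_n => lS i)).
apply: aeW => x _.
rewrite -[X in f (X) - _]/(x + S n).
have -> : f (x + S n) - f x = \sum_(0 <= k < n) (f (x + S k.+1) - f (x + S k)).
  rewrite (telescope_sumr (fun k => f (x + S k)))//.
  by rewrite [S 0%N]big_geq// addr0.
rewrite -(big_mkord xpredT (fun k => (f (x + S k.+1) - f (x + S k)) ^+ 2)).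
exact: sum_sqr_le.
Qed.

(** The translation is divided into [n] steps, whose difference quotients tend to
    the partial derivative. *)
Lemma shift_coord_le f i s : C1c f ->
  I (fun x => (f (x + s *: delta_mx ord0 i) - f x) ^+ 2) <=
  s ^+ 2 * I (fun x => partial i f x ^+ 2).
Proof.
move=> cf; have [->|s0] := eqVneq s 0.
  rewrite expr0n mul0r; under eq_Rintegral do rewrite scale0r addr0 subrr expr0n.
  by rewrite I_0.
have [g [_ [_ lg]] fg] := quotient_dom i `|s| cf.
pose t n : R := s * n.+1%:R^-1.
have tn0 n : t n != 0 by rewrite mulf_neq0// invr_neq0.
have lk h : L1 mu setT (fun x => (f (x + h) - f x) ^+ 2).
  by have [] := L2B measurableT (L2_shift h (C1c_L2 cf)) (C1c_L2 cf).
have [_ cv] : L1 mu setT (fun x => partial i f x ^+ 2) /\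
    (fun n => I (fun x => quotient f i (t n) x ^+ 2)) @ \oo --> I (fun x => partial i f x ^+ 2).
  apply: (@dominated_L1 _ _ _ mu setT measurableT _ _ (fun x => g x ^+ 2)) => //.
  - by move=> n; apply: measurable_funX; exact: quotient_measurable.
  - by apply: measurable_funX; exact: C1c_partial_measurable.
  - move=> n; apply: aeW => x _; rewrite normrX.
    have q0 := fg (t n) x (tn0 n) (inv_nat_le s n).
    by rewrite lerXn2r ?nnegrE// (le_trans _ q0).
  - apply: aeW => x _; rewrite expr2; under eq_fun do rewrite expr2.
    by apply: cvgM; apply: quotient_cvg => //; exact: inv_nat_cvg0.
have cv2 : (fun n => s ^+ 2 * I (fun x => quotient f i (t n) x ^+ 2)) @ \oo -->
    s ^+ 2 * I (fun x => partial i f x ^+ 2).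
  by apply: cvgM => //; exact: cvg_cst.
apply: (cvgr_to_ge cv2); apply: nearW => n.
have -> : s *: delta_mx ord0 i = \sum_(0 <= k < n.+1) (t n *: delta_mx ord0 i) :> E.
  by rewrite sumr_const_nat subn0 -scaler_nat scalerA /t mulrCA mulfV ?mulr1.
apply: (le_trans (shift_sum_le _ _ (C1c_L2 cf))).
rewrite sumr_const_nat subn0 -(mulr_natl (I _) n.+1).
rewrite /quotient; under [in leRHS]eq_Rintegral do rewrite exprMn.
rewrite I_Z// le_eqVlt; apply/orP; left; apply/eqP; move: (I _) => J.
have n0 : n.+1%:R != 0 :> R by rewrite pnatr_eq0.
by rewrite /t; move: (n.+1%:R) n0 => c c0; field; rewrite s0 c0.
Qed.

Definition grad_sqr f := \sum_(i < d) I (fun x => partial i f x ^+ 2).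

(** The translation is decomposed along the coordinate axes.  The bound involves
    the gradient only, so that it extends to limits of such functions. *)
Lemma shift_le f h : C1c f ->
  I (fun x => (f (x + h) - f x) ^+ 2) <= d%:R * `|h| ^+ 2 * grad_sqr f.
Proof.
move=> cf.
pose w k : E := if insub k is Some i then h ord0 i *: delta_mx ord0 i else 0.
have hE : h = \sum_(0 <= k < d) w k.
  rewrite big_mkord [LHS]row_sum_delta; apply: eq_bigr => i _.
  by rewrite /w valK.
have := shift_sum_le w d (C1c_L2 cf); rewrite -hE => /le_trans; apply.
rewrite -mulrA ler_wpM2l// /grad_sqr mulr_sumr big_mkord.
apply: ler_sum => i _; rewrite /w valK.
apply: (le_trans (shift_coord_le i _ cf)); apply: ler_wpM2r.
  by apply: Rintegral_ge0 => x _; exact: sqr_ge0.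
rewrite -(real_normK (num_real (h ord0 i))) lerXn2r ?nnegrE//.
exact: coord_le_norm.
Qed.

Lemma partialM f g i x : Ck 1 f -> Ck 1 g ->
  partial i (fun x => f x * g x) x = f x * partial i g x + g x * partial i f x.
Proof.
by move=> Cf Cg; have [] := is_deriveM (CkS_derive Cf i x) (CkS_derive Cg i x).
Qed.

Lemma C1cM_L1 f g i : C1c f -> C1c g -> L1 mu setT (fun x => f x * partial i g x).
Proof. by move=> cf cg; apply: L2M => //; [exact: C1c_L2|exact: C1c_partial_L2]. Qed.

Lemma I_by_parts f g i : C1c f -> C1c g ->
  I (fun x => f x * partial i g x) = - I (fun x => partial i f x * g x).
Proof.
move=> cf cg; apply/eqP; rewrite -subr_eq0 opprK; apply/eqP.
rewrite (_ : (fun x => partial i f x * g x) = (fun x => g x * partial i f x)).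
  rewrite -I_D//; [|exact: C1cM_L1|exact: C1cM_L1].
  rewrite -[RHS](@I_partial (fun x => f x * g x) i); last exact: (C1cM cf.1 cg).
  by apply: eq_Rintegral => x _; rewrite -(partialM i x cf.1 cg.1).
by apply/funext => x; rewrite mulrC.
Qed.

(** Poincare's inequality, by integrating the [i]-th partial derivative of
    [x_i * f x ^+ 2], which vanishes on average. *)
Lemma poincare_C1c (i : 'I_d) f r : C1c f -> (forall x, r < `|x| -> f x = 0) ->
  I (fun x => f x ^+ 2) <= 4 * r ^+ 2 * I (fun x => partial i f x ^+ 2).
Proof.
move=> cf fr.
have lf := C1c_L2 cf; have lp := C1c_partial_L2 i cf.
have cxf : C1c (fun x => x ord0 i * f x) by apply: C1cM => //; exact: Ck_coord.
have ibp := I_by_parts i cxf cf.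
have pE x : partial i (fun x => x ord0 i * f x) x = x ord0 i * partial i f x + f x.
  rewrite (partialM i x (Ck_coord R 1 i) cf.1) [f x * _]mulrC.
  congr (_ + _); rewrite -[RHS]mul1r; congr (_ * _).
  by rewrite /partial; have [_ ->] := is_derive_coord i i x; rewrite eqxx.
have fpE : I (fun x => x ord0 i * f x * partial i f x) =
    - (I (fun x => x ord0 i * f x * partial i f x) + I (fun x => f x ^+ 2)).
  rewrite {1}ibp -I_D//; [|exact: C1cM_L1|exact: lf.2].
  by congr (- _); apply: eq_Rintegral => x _; rewrite pE; ring.
have lx : L1 mu setT (fun x => x ord0 i * f x * partial i f x) by exact: C1cM_L1.
have fE : I (fun x => f x ^+ 2) = I (fun x => -2 * (x ord0 i * f x * partial i f x)).
  by rewrite I_Z//; lra.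
have : I (fun x => -2 * (x ord0 i * f x * partial i f x)) <=
    2^-1 * I (fun x => f x ^+ 2) + 2 * r ^+ 2 * I (fun x => partial i f x ^+ 2).
  rewrite -(I_Z _ _ lf.2)// -(I_Z _ _ lp.2)// -I_D//; last 2 first.
    by apply: L1Z => //; exact: lf.2.
    by apply: L1Z => //; exact: lp.2.
  apply: I_le => //; first exact: L1Z.
    by apply: L1D => //; apply: L1Z => //; [exact: lf.2|exact: lp.2].
  apply: aeW => x _.
  have [xr|xr] := ltP r `|x|.
    rewrite fr// !(mulr0, mul0r) expr0n /= mulr0 add0r.
    by rewrite mulr_ge0 ?sqr_ge0// mulr_ge0 ?sqr_ge0.
  have x0 : `|x ord0 i| <= r by exact: le_trans (coord_le_norm x i) xr.
  have x2 : x ord0 i ^+ 2 <= r ^+ 2.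
    by rewrite -(real_normK (num_real (x ord0 i))) lerXn2r ?nnegrE// (le_trans _ x0).
  have : 0 <= (r ^+ 2 - x ord0 i ^+ 2) * partial i f x ^+ 2.
    by rewrite mulr_ge0 ?sqr_ge0// subr_ge0.
  have := sqr_ge0 (f x + 2 * (x ord0 i * partial i f x)).
  by lra.
by rewrite -fE; lra.
Qed.

End compactly_supported.

(** * Lebesgue spaces, test functions and the fundamental lemma *)

Section lebesgue_spaces.
Context (R : realType) (d : nat) (Om : set 'rV[R]_d).
Local Notation E := 'rV[R]_d.
Local Notation mu := (lebesgue_rV R d).
Hypothesis mO : measurable Om.
Local Notation I f := (Rintegral mu Om f).
Local Notation aeO P := {ae mu, forall x, Om x -> P x}.
Implicit Types (u w phi : E -> R).

Lemma restrict_powR u p x : 0 < p -> `|(u \_ Om) x| `^ p = ((fun x => `|u x| `^ p) \_ Om) x.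
Proof.
by move=> p0; rewrite /patch; case: ifP => // _; rewrite normr0 powR0// gt_eqF.
Qed.

Lemma in_LpP u p : 1 <= p ->
  in_Lp Om p%:E u <-> measurable_fun Om u /\ L1 mu Om (fun x => `|u x| `^ p).
Proof.
move=> p1; have p0 : 0 < p by exact: lt_le_trans p1.
split.
  move=> lu; split.
    by apply/(measurable_restrictT _ mO); move: lu => /andP[/set_mem].
  apply/(L1_restrict _ _ mO); have := Lfun_integrable p1 lu.
  by congr integrable; apply/funext => x /=; rewrite restrict_powR.
move=> [mu_ lu]; have mu' := (measurable_restrictT _ mO).1 mu_.
apply/andP; split; rewrite inE//=.
rewrite /finite_norm unlock poweR_lty//.
move/(L1_restrict _ _ mO)/integrableP : lu => [_].
congr (_ < _)%E; apply: eq_integral => x _ /=.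
by rewrite -restrict_powR// ger0_norm ?powR_ge0.
Qed.

Lemma in_L2P u : in_Lp Om 2%:E u <-> L2 mu Om u.
Proof.
rewrite in_LpP ?ler1n// /L2 (_ : (fun x => `|u x| `^ 2) = (fun x => u x ^+ 2))//.
by apply/funext => x; rewrite powR_mulrn// real_normK// num_real.
Qed.

Lemma in_L1P u : in_Lp Om 1%E u <-> L1 mu Om u.
Proof.
rewrite (in_LpP u (lexx 1)).
have -> : (fun x => `|u x| `^ 1) = (fun x => `|u x|).
  by apply/funext => x; rewrite powRr1.
split=> [[mu_ lu]|lu]; last by split; [exact: L1_measurable lu|exact: L1_norm].
by apply: (L1_dom mO mu_ lu); apply: aeW => x _.
Qed.

Lemma in_Loo_bounded u : in_Lp Om +oo%E u ->
  measurable_fun Om u /\ exists2 M, 0 <= M & aeO (fun x => `|u x| <= M).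
Proof.
move=> lu; split.
  by apply/(measurable_restrictT _ mO); move: lu => /andP[/set_mem].
move: lu => /andP[_ /set_mem /=]; rewrite /finite_norm unlock.
case: ifPn => [_ /ess_supr_bounded[M uM]|muT _].
  exists (`|M|) => //; apply: filterS uM => x + Ox.
  by rewrite /patch mem_set// => /le_trans; apply; exact: ler_norm.
exists 0 => //; exists setT; split => //.
by apply/eqP; rewrite eq_le measure_ge0 andbT leNgt.
Qed.

Lemma Lp_norm2E u : L2 mu Om u ->
  Lp_norm Om 2%:E u = (Num.sqrt (I (fun x => u x ^+ 2)))%:E.
Proof.
move=> lu; rewrite /Lp_norm unlock.
have -> : (\int[mu]_x (`|(EFin \o u \_ Om) x| `^ 2))%E = (I (fun x => u x ^+ 2))%:E.
  rewrite -(EFin_I mO lu.2) [RHS]integral_mkcond; apply: eq_integral => x _ /=.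
  rewrite restrict_powR// /patch; case: ifP => // _.
  by rewrite powR_mulrn// real_normK// num_real.
rewrite poweR_EFin powR12_sqrt//; apply: I_sqr_ge0 => //; exact: lu.1.
Qed.

Lemma I_setT u : (forall x, ~ Om x -> u x = 0) -> I u = Rintegral mu setT u.
Proof. by move=> u0; rewrite Rintegral_mkcond restrict_zero. Qed.

Lemma L1_setT u : (forall x, ~ Om x -> u x = 0) -> L1 mu Om u <-> L1 mu setT u.
Proof. by move=> u0; rewrite L1_restrict// restrict_zero. Qed.

Lemma L2_setT u : (forall x, ~ Om x -> u x = 0) -> L2 mu setT u -> L2 mu Om u.
Proof.
move=> u0 [mu_ lu]; split; first exact: measurable_funTS.
by apply/L1_setT => // x /u0 ->; rewrite expr0n.
Qed.

Lemma test_supp0 phi x : test_function Om phi -> ~ Om x -> phi x = 0.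
Proof.
move=> [_ _ sO] nO; apply: contrapT => /eqP px; apply: nO; apply: sO.
exact: subset_closure.
Qed.

Lemma test_partial_supp0 phi i x : test_function Om phi -> ~ Om x ->
  partial i phi x = 0.
Proof.
move=> [_ _ sO] nO; apply: partial_eq0.
have : open_nbhs x (~` tsupport phi).
  by split; [exact/closed_openC/closed_closure|move=> /sO].
move=> /open_nbhs_nbhs H; apply: (@filterS _ _ (nbhs_filter x) _ _ _ H) => y ny /=.
by apply: contrapT => /eqP py; apply: ny; exact: subset_closure.
Qed.

Lemma test_C1c phi : test_function Om phi -> C1c phi.
Proof.
move=> [sm cphi _]; split; first exact: sm.
have [M [_ bM]] := compact_bounded cphi.
exists (M + 1) => x Mx; apply: contrapT => /eqP px.
have : (`|x| <= M + 1) by apply: bM; [rewrite ltrDl|exact: subset_closure].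
by rewrite leNgt Mx.
Qed.

Lemma test_L2 phi : test_function Om phi -> L2 mu Om phi.
Proof.
move=> tphi; apply: L2_setT => [x|]; first exact: test_supp0.
exact/C1c_L2/test_C1c.
Qed.

Lemma test_partial_L2 phi i : test_function Om phi -> L2 mu Om (partial i phi).
Proof.
move=> tphi; apply: L2_setT => [x|]; first exact: test_partial_supp0.
exact/C1c_partial_L2/test_C1c.
Qed.

(** Smooth approximations from below of the indicator function of a box. *)
Definition bump (k : nat) (a b : E) : E -> R := fun x =>
  \prod_(i < d) (flat 0 (k%:R * (x ord0 i + - a ord0 i)) *
                 flat 0 (k%:R * (b ord0 i + -1 * x ord0 i))).

Lemma flat0_le1 (t : R) : flat 0 t <= 1.
Proof.
rewrite /flat; case: ifPn => // t0; rewrite expr0 mul1r -expR0 ler_expR.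
by rewrite oppr_le0 invr_ge0 ltW.
Qed.

Lemma bump_smooth k (a b : E) : smooth (bump k a b).
Proof.
move=> n; apply: Ck_prod => i; apply: CkM; apply: Ck_flat.
  by apply: CkM; [exact: Ck_cst|apply: CkD; [exact: Ck_coord|exact: Ck_cst]].
apply: CkM; [exact: Ck_cst|apply: CkD; [exact: Ck_cst|]].
by apply: CkM; [exact: Ck_cst|exact: Ck_coord].
Qed.

Lemma bump_ge0 k (a b : E) x : 0 <= bump k a b x.
Proof. by apply: prodr_ge0 => i _; rewrite mulr_ge0 ?flat_ge0. Qed.

Lemma bump_le1 k (a b : E) x : bump k a b x <= 1.
Proof.
apply: prodr_ile1 => i; rewrite mulr_ge0 ?flat_ge0//=.
by rewrite -[leRHS]mulr1 ler_pM ?flat_ge0 ?flat0_le1.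
Qed.

Lemma bump_supp0 k (a b : E) x : ~ box a b x -> bump k a b x = 0.
Proof.
move=> /existsNP[i /negP]; rewrite in_itv/= negb_and -!leNgt => xi.
rewrite /rV_coord in xi; apply/eqP; rewrite prodf_seq_eq0; apply/hasP; exists i.
  by rewrite mem_index_enum.
rewrite mulf_eq0 /flat; apply/orP; case/orP: xi => xi; [left|right];
  by rewrite ifF//; apply/negbTE; rewrite -leNgt; apply: mulr_ge0_le0 => //; lra.
Qed.

Lemma bump_gt0 k (a b : E) x : box a b x -> 0 < bump k.+1 a b x.
Proof.
move=> bx; apply: prodr_gt0 => i _.
have := bx i; rewrite /= in_itv/= /rV_coord => /andP[ax xb].
have k0 : 0 < k.+1%:R :> R by rewrite ltr0n.
by apply: mulr_gt0; rewrite /flat ifT ?expr0 ?mul1r ?expR_gt0// mulr_gt0//; lra.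
Qed.

Lemma flat0_cvg1 (t : R) : 0 < t -> (fun k => flat 0 (k.+1%:R * t)) @ \oo --> (1 : R).
Proof.
move=> t0; have E k : flat 0 (k.+1%:R * t) = expR (- (t^-1 * k.+1%:R^-1)).
  by rewrite /flat ifT ?mulr_gt0// expr0 mul1r invfM mulrC.
apply: (@eq_cvg_to _ (fun k => expR (- (t^-1 * k.+1%:R^-1))) _ (expR (- 0))) => //.
  by rewrite oppr0 expR0.
apply: continuous_cvg; first exact: continuous_expR.
by apply: cvgN; exact: inv_nat_cvg0.
Qed.

Lemma bump_cvg (a b x : E) : (fun k => bump k.+1 a b x) @ \oo --> (\1_(box a b) x : R).
Proof.
rewrite indicE; case: (boolP (x \in box a b)) => [/set_mem bx|/negP nb].
  have E1 : \prod_(i < d) (1 : R) = 1 by rewrite big1.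
  rewrite -[X in _ --> X]E1.
  apply: cvg_prod => i; rewrite -[X in _ --> X]mulr1.
  have := bx i; rewrite /= in_itv/= /rV_coord => /andP[ax xb].
  by apply: cvgM; apply: flat0_cvg1; lra.
rewrite (_ : (fun k => _) = cst 0); first exact: cvg_cst.
by apply/funext => k; rewrite bump_supp0// => /mem_set.
Qed.

Definition cbox (a b : E) : set E := [set x | forall i, a ord0 i <= x ord0 i <= b ord0 i].

Lemma closed_cbox (a b : E) : closed (cbox a b).
Proof.
rewrite (_ : cbox a b = \bigcap_(i in [set: 'I_d])
   ((fun x : E => x ord0 i) @^-1` [set t | a ord0 i <= t <= b ord0 i])).
  apply: closed_bigI => i _; apply: preimage_closed => [x _|].
    exact: coord_continuous.
  rewrite (_ : [set t | _] = [set t : R^o | t \in `[a ord0 i, b ord0 i]%R]).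
    exact: interval_closed.
  by apply/funext => t /=; rewrite in_itv.
by apply/seteqP; split=> [x xb i _|x xb i]; exact: xb.
Qed.

Lemma bump_test k (a b : E) : cbox a b `<=` Om -> test_function Om (bump k a b).
Proof.
move=> bO.
have sub : tsupport (bump k a b) `<=` cbox a b.
  rewrite /tsupport [X in _ `<=` X](closure_id _).1; last exact: closed_cbox.
  apply: closureS => x /= /eqP px; have bx : box a b x.
    by apply: contrapT => nb; apply: px; exact: bump_supp0.
  by move=> i; have := bx i; rewrite /= in_itv/= => /andP[/ltW -> /ltW ->].
split; [exact: bump_smooth| |exact: subset_trans sub bO].
apply: (subclosed_compact _ _ sub); first exact: closed_closure.
apply: bounded_closed_compact; last exact: closed_cbox.
exists (`|a| + `|b|); split; first exact: num_real.
move=> M abM x xb; apply: norm_le_coord.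
  by rewrite (le_trans _ (ltW abM))// addr_ge0.
move=> i; have /andP[ax xb'] := xb i; rewrite (le_trans _ (ltW abM))//.
have := coord_le_norm a i; have := coord_le_norm b i.
rewrite !ler_norml => /andP[? ?] /andP[? ?]; apply/andP; split; lra.
Qed.

Lemma I_bump_box (g : E -> R) (a b : E) : cbox a b `<=` Om -> L1 mu Om g ->
  (forall phi, test_function Om phi -> I (fun x => g x * phi x) = 0) ->
  Rintegral mu (box a b) g = 0.
Proof.
move=> bO lg g0; have mb := measurable_box a b.
have bsub : box a b `<=` Om.
  move=> x bx; apply: bO => i; have := bx i.
  by rewrite /= in_itv/= => /andP[/ltW -> /ltW ->].
have mg := L1_measurable lg.
have [_ cv] : L1 mu Om (fun x => g x * \1_(box a b) x) /\
    (fun k => I (fun x => g x * bump k.+1 a b x)) @ \oo --> I (fun x => g x * \1_(box a b) x).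
  apply: (@dominated_L1 _ _ _ mu Om mO _ _ (fun x => `|g x|)).
  - move=> k; apply: measurable_funM => //; apply: measurable_funTS.
    apply: continuous_measurable_rV; exact: (Ck_continuous (bump_smooth k.+1 a b 0)).
  - by apply: measurable_funM => //; apply: measurable_funTS; exact: measurable_indic.
  - exact: L1_norm.
  - move=> k; apply: aeW => x _; rewrite normrM ler_piMr//.
    by rewrite ger0_norm ?bump_ge0 ?bump_le1.
  - by apply: aeW => x _; apply: cvgM; [exact: cvg_cst|exact: bump_cvg].
have -> : Rintegral mu (box a b) g = I (fun x => g x * \1_(box a b) x).
  rewrite Rintegral_mkcond [RHS]Rintegral_mkcond; apply: eq_Rintegral => x _.
  rewrite /patch indicE; have [bx|nb] := boolP (x \in box a b).
    by rewrite mulr1 mem_set//; exact/bsub/set_mem.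
  by rewrite mulr0; case: ifP.
rewrite -(cvg_lim _ cv)// (_ : (fun k => _) = cst 0) ?lim_cst//.
by apply/funext => k; apply: g0; exact: bump_test.
Qed.

End lebesgue_spaces.

(** * Weak gradients and the space of functions vanishing on the boundary *)

Section weak_gradients.
Context (R : realType) (d : nat) (Om : set 'rV[R]_d).
Local Notation E := 'rV[R]_d.
Local Notation mu := (lebesgue_rV R d).
Hypotheses (oO : open Om) (bO : bounded_set Om).
Local Notation I f := (Rintegral mu Om f).
Local Notation L1O := (L1 mu Om).
Local Notation L2O := (L2 mu Om).
Local Notation aeO P := {ae mu, forall x, Om x -> P x}.
Implicit Types (u w phi : E -> R) (G H : E -> E).

Let mO : measurable Om. Proof. exact: open_measurable_rV. Qed.
Let muO : (mu Om < +oo)%E. Proof. exact: bounded_lebesgue_lty. Qed.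

(** The fundamental lemma of the calculus of variations: [g] integrates to 0 on
    small boxes, hence, by Dynkin's theorem, on all small Borel sets. *)
Lemma fundamental_lemma (g : E -> R) : L1O g ->
  (forall phi, test_function Om phi -> I (fun x => g x * phi x) = 0) ->
  aeO (fun x => g x = 0).
Proof.
move=> lg g0; apply: ae_local => x Ox.
have [c /= c0 cO] : nbhs_ball x Om by apply/nbhs_ballP; exact: open_nbhs_nbhs.
pose K := ball x (c / 2).
have c20 : 0 < c / 2 by rewrite divr_gt0.
have KE : K = box (x - const_mx (c / 2)) (x + const_mx (c / 2)) by rewrite /K ball_box.
have cKO : cbox (x - const_mx (c / 2)) (x + const_mx (c / 2)) `<=` Om.
  move=> y yb; apply: cO; rewrite ball_box// => i.
  have := yb i; rewrite /= in_itv/= /rV_coord !mxE => /andP[? ?].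
  by apply/andP; split; lra.
have KO : K `<=` Om.
  by apply: subset_trans cO; apply: le_ball; lra.
have mK : measurable K by exact: measurable_ball.
have lS S : measurable S -> L1 mu (S `&` K) g.
  move=> mS; apply: (integrableS mO) lg; first exact: measurableI.
  by move=> y [_ /KO].
have key : forall S, <<s @boxes R d >> S -> Rintegral mu (S `&` K) g = 0.
  apply: dynkin_induction.
  - exact: measurable_boxesE.
  - exact: setI_boxes.
  - by rewrite setTI KE; exact: (@I_bump_box _ _ Om).
  - move=> _ [a [b ->]]; rewrite KE boxI.
    apply: (@I_bump_box _ _ Om) => // y yb; apply: cKO => i.
    by have := yb i; rewrite !mxE ge_max le_min => /andP[/andP[_ ->] /andP[_ ->]].
  - move=> S mS S0.
    have KS : K = (S `&` K) `|` (~` S `&` K) by rewrite -setIUl setUv setTI.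
    have : Rintegral mu K g = 0 by rewrite KE; exact: (@I_bump_box _ _ Om).
    rewrite {1}KS Rintegral_setU ?S0 ?add0r//.
    + exact: measurableI.
    + by apply: measurableI => //; exact: measurableC.
    + by rewrite -KS -[K]setTI; apply: lS.
    + by apply/disj_setPS => y [[Sy _] [nSy _]].
  - move=> F mF tF F0; rewrite /Rintegral setI_bigcupl integral_bigcup.
    + rewrite eseries0// => k _ _.
      by rewrite -[LHS]fineK ?(integrable_fin_num _ (lS _ (mF k)))//; [congr (_%:E); exact: F0|exact: measurableI].
    + exact: trivIset_setIr.
    + by move=> k; exact: measurableI.
    + by rewrite -setI_bigcupl; apply: lS; exact: bigcup_measurable.
exists K; first exact: nbhsx_ballx.
have lK : L1 mu K g by rewrite -[K]setTI; exact: lS.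
have : ae_eq mu K (EFin \o g) (cst 0%E).
  apply: integral_ae_eq => // S SK mS; rewrite integral0.
  have lgS : L1 mu S g by rewrite -(setIidl SK); exact: lS.
  rewrite -[LHS]fineK ?(integrable_fin_num mS)//; congr (_%:E).
  by rewrite -(setIidl SK); apply: key; rewrite -measurable_boxesE.
by apply: filterS => y + Ky => /(_ Ky)[].
Qed.

Definition pgrad phi : E -> E := fun x => \row_i partial i phi x.

Lemma test_op (psi phi w : E -> R) : test_function Om phi -> test_function Om w ->
  smooth psi -> (forall x, phi x = 0 -> w x = 0 -> psi x = 0) ->
  test_function Om psi.
Proof.
move=> [s1 c1 o1] [s2 c2 o2] spsi psi0.
have sub : tsupport psi `<=` tsupport phi `|` tsupport w.
  rewrite /tsupport -closureU; apply: closureS => x /= /eqP px.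
  apply: contrapT => /not_orP[/negP/negPn/eqP p0 /negP/negPn/eqP w0].
  by apply: px; exact: psi0.
split=> //; last by move=> x /sub[/o1|/o2].
apply: (subclosed_compact _ _ sub); first exact: closed_closure.
exact: compactU.
Qed.

Lemma testD phi w : test_function Om phi -> test_function Om w ->
  test_function Om (fun x => phi x + w x).
Proof.
move=> tp tw; apply: (test_op tp tw) => [k|x -> ->]; last by rewrite addr0.
by apply: CkD; [case: tp => + _ _; apply|case: tw => + _ _; apply].
Qed.

Lemma testZ c phi : test_function Om phi -> test_function Om (fun x => c * phi x).
Proof.
move=> tp; apply: (test_op tp tp) => [k|x -> _]; last by rewrite mulr0.
by apply: CkM; [exact: Ck_cst|case: tp => + _ _; apply].
Qed.

Lemma partialD phi w i x : Ck 1 phi -> Ck 1 w ->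
  partial i (fun x => phi x + w x) x = partial i phi x + partial i w x.
Proof.
by move=> Cp Cw; have [] := is_deriveD (CkS_derive Cp i x) (CkS_derive Cw i x).
Qed.

Lemma partialZ c phi i x : Ck 1 phi ->
  partial i (fun x => c * phi x) x = c * partial i phi x.
Proof. by move=> Cp; have [] := is_deriveZ c (CkS_derive Cp i x). Qed.

Lemma test_Ck1 phi : test_function Om phi -> Ck 1 phi.
Proof. by move=> [sm _ _]; exact: (sm 1%N). Qed.

Lemma test_by_parts phi psi i : test_function Om phi -> test_function Om psi ->
  I (fun x => phi x * partial i psi x) = - I (fun x => partial i phi x * psi x).
Proof.
move=> tp ts; rewrite I_setT => [|x nO]; last by rewrite (test_supp0 tp nO) mul0r.
rewrite I_setT => [|x nO]; last by rewrite (test_supp0 ts nO) mulr0.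
by rewrite I_by_parts//; [exact: (test_C1c tp)|exact: (test_C1c ts)].
Qed.

Lemma L2_form : psd_form L2O (fun f g => I (fun x => f x * g x)).
Proof.
split.
- exact: L2_0.
- by move=> f g lf lg; exact: L2D.
- by move=> c f lf; exact: L2Z.
- by move=> f g _ _; apply: eq_Rintegral => x _; rewrite mulrC.
- move=> f g h lf lg lh; rewrite -I_D//; [|exact: L2M|exact: L2M].
  by apply: eq_Rintegral => x _; rewrite mulrDl.
- move=> c f h lf lh; rewrite -I_Z//; last exact: L2M.
  by apply: eq_Rintegral => x _; rewrite mulrA.
- by move=> f [mf _]; exact: I_sqr_ge0.
Qed.

Lemma L2_cvg_pair (u : nat -> E -> R) u0 w : (forall k, L2O (u k)) -> L2O u0 -> L2O w ->
  (fun k => I (fun x => (u k x - u0 x) ^+ 2)) @ \oo --> (0 : R) ->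
  (fun k => I (fun x => w x * u k x)) @ \oo --> I (fun x => w x * u0 x).
Proof.
by move=> lu l0 lw cv; exact: (form_cvg L2_form).
Qed.

Lemma weak_unique u G H : weak_gradient Om u G -> weak_gradient Om u H ->
  forall i, aeO (fun x => G x ord0 i = H x ord0 i).
Proof.
move=> wG wH i; have [/(in_L2P mO) lG uG] := wG i; have [/(in_L2P mO) lH uH] := wH i.
suff : aeO (fun x => G x ord0 i - H x ord0 i = 0).
  by apply: filterS => x /[apply] /eqP; rewrite subr_eq0 => /eqP.
apply: fundamental_lemma => [|phi tphi]; first exact/(L2_L1 mO muO)/L2B.
under eq_Rintegral do rewrite mulrBl.
have lphi := test_L2 mO tphi.
rewrite I_B//; [|exact: L2M|exact: L2M].
by apply/eqP; rewrite subr_eq0 -eqr_opp -uG// -uH.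
Qed.

Lemma weakD u w G H : L2O u -> L2O w -> weak_gradient Om u G -> weak_gradient Om w H ->
  weak_gradient Om (fun x => u x + w x) (fun x => G x + H x).
Proof.
move=> lu lw wG wH i; have [/(in_L2P mO) lG uG] := wG i; have [/(in_L2P mO) lH uH] := wH i.
split.
  by apply/(in_L2P mO); have := L2D mO lG lH; congr (L2 mu Om); apply/funext => x; rewrite mxE.
move=> phi tphi; have lphi := test_L2 mO tphi; have lp := test_partial_L2 mO i tphi.
under eq_Rintegral do rewrite mulrDl.
under [in RHS]eq_Rintegral do rewrite mxE mulrDl.
rewrite I_D//; [|exact: L2M|exact: L2M].
rewrite [in RHS]I_D//; [|exact: L2M|exact: L2M].
by rewrite opprD uG// uH.
Qed.

Lemma weakZ c u G : L2O u -> weak_gradient Om u G ->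
  weak_gradient Om (fun x => c * u x) (fun x => c *: G x).
Proof.
move=> lu wG i; have [/(in_L2P mO) lG uG] := wG i; split.
  by apply/(in_L2P mO); have := L2Z mO c lG; congr (L2 mu Om); apply/funext => x; rewrite mxE.
move=> phi tphi; have lphi := test_L2 mO tphi; have lp := test_partial_L2 mO i tphi.
under eq_Rintegral do rewrite -mulrA.
under [in RHS]eq_Rintegral do rewrite mxE -mulrA.
rewrite I_Z//; last exact: L2M.
rewrite [in RHS]I_Z//; last exact: L2M.
by rewrite uG// mulrN.
Qed.

Lemma test_weak phi : test_function Om phi -> weak_gradient Om phi (pgrad phi).
Proof.
move=> tphi i; split.
  apply/(in_L2P mO); have := test_partial_L2 mO i tphi.
  by congr (L2 mu Om); apply/funext => x; rewrite mxE.
move=> psi tpsi; rewrite test_by_parts//; congr (- _).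
by apply: eq_Rintegral => x _; rewrite mxE.
Qed.

Lemma grad_weak u G : weak_gradient Om u G -> weak_gradient Om u (grad Om u).
Proof. by move=> wG; apply: getPex; exists G. Qed.

(** [G] is the gradient of [u], and test functions approximate both at once.
    Contrary to membership in [H10], this relation does not mention the chosen
    gradient [grad], so that linear operations and limits act on it directly. *)
Definition strong_grad u G : Prop :=
  [/\ L2O u, forall i, L2O (fun x => G x ord0 i) &
    forall e, 0 < e -> exists2 phi, test_function Om phi &
      I (fun x => (phi x - u x) ^+ 2) <= e /\
      forall i, I (fun x => (partial i phi x - G x ord0 i) ^+ 2) <= e].

Lemma strong_seq u G : strong_grad u G -> exists phi : nat -> E -> R,
  [/\ forall n, test_function Om (phi n),
    (fun n => I (fun x => (phi n x - u x) ^+ 2)) @ \oo --> (0 : R) &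
    forall i, (fun n => I (fun x => (partial i (phi n) x - G x ord0 i) ^+ 2)) @ \oo --> (0 : R)].
Proof.
move=> [lu lG H].
have step n : exists phi, test_function Om phi /\
    (I (fun x => (phi x - u x) ^+ 2) <= n.+1%:R^-1 /\
     forall i, I (fun x => (partial i phi x - G x ord0 i) ^+ 2) <= n.+1%:R^-1).
  have n0 : 0 < n.+1%:R^-1 :> R by rewrite invr_gt0.
  by have [phi tphi P] := H _ n0; exists phi.
have [phi phiP] := choice step; exists phi; split.
- by move=> n; case: (phiP n).
- apply: (@squeeze0 _ _ (fun n => n.+1%:R^-1)); last exact: cvg_harmonic.
  move=> n; have [tn [-> _]] := phiP n; rewrite andbT.
  by apply: I_sqr_ge0 => //; exact: (L2B mO (test_L2 mO tn) lu).1.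
- move=> i; apply: (@squeeze0 _ _ (fun n => n.+1%:R^-1)); last exact: cvg_harmonic.
  move=> n; have [tn [_ ->]] := phiP n; rewrite andbT.
  by apply: I_sqr_ge0 => //; exact: (L2B mO (test_partial_L2 mO i tn) (lG i)).1.
Qed.

Lemma strong_weak u G : strong_grad u G -> weak_gradient Om u G.
Proof.
move=> sG; have [lu lG _] := sG; have [phi [tphi cvu cvG]] := strong_seq sG.
move=> i; split; first exact/(in_L2P mO).
move=> psi tpsi; have lpsi := test_L2 mO tpsi; have lp := test_partial_L2 mO i tpsi.
have h1 := L2_cvg_pair (fun n => test_L2 mO (tphi n)) lu lp cvu.
have h2 := L2_cvg_pair (fun n => test_partial_L2 mO i (tphi n)) (lG i) lpsi (cvG i).
have e1 : (fun n => I (fun x => partial i psi x * phi n x)) =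
          (fun n => - I (fun x => psi x * partial i (phi n) x)).
  apply/funext => n; rewrite -[LHS]opprK; congr (- _).
  rewrite -(test_by_parts i tpsi (tphi n)); exact: erefl.
rewrite e1 in h1.
have h3 : (fun n => - I (fun x => psi x * partial i (phi n) x)) @ \oo -->
    - I (fun x => psi x * G x ord0 i) by exact: cvgN.
transitivity (I (fun x => partial i psi x * u x)).
  by apply: eq_Rintegral => x _; rewrite mulrC.
rewrite (cvg_unique _ h1 h3)//; congr (- _).
by apply: eq_Rintegral => x _; rewrite mulrC.
Qed.

Lemma H1_norm_test phi u G : test_function Om phi -> L2O u -> weak_gradient Om u G ->
  H1_norm Om (phi \- u) = (Num.sqrt (I (fun x => (phi x - u x) ^+ 2)) +
    \sum_(i < d) Num.sqrt (I (fun x => (partial i phi x - G x ord0 i) ^+ 2)))%:E.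
Proof.
move=> tphi lu wG; have lphi := test_L2 mO tphi.
have wB : weak_gradient Om (phi \- u) (fun x => pgrad phi x + (-1) *: G x).
  have := weakD lphi (L2Z mO (-1) lu) (test_weak tphi) (weakZ (-1) lu wG).
  by congr (weak_gradient Om); apply/funext => x; rewrite mulN1r.
rewrite /H1_norm (Lp_norm2E mO (L2B mO lphi lu)).
suff -> : (\sum_(i < d) Lp_norm Om 2%:E (fun x => grad Om (phi \- u)%R x ord0 i))%E =
   (\sum_(i < d) Num.sqrt (I (fun x => (partial i phi x - G x ord0 i) ^+ 2)))%:E by [].
rewrite -sumEFin; apply: eq_bigr => i _.
have [/(in_L2P mO) lg _] := grad_weak wB i.
rewrite (Lp_norm2E mO lg); congr (Num.sqrt _)%:E.
have lG : L2O (fun x => G x ord0 i) by have [/(in_L2P mO)] := wG i.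
apply: I_ae_eq => //; first exact: lg.2.
  exact: (L2B mO (test_partial_L2 mO i tphi) lG).2.
apply: filterS (weak_unique (grad_weak wB) wB i) => x /[apply] ->.
by rewrite !mxE mulN1r.
Qed.

Lemma H10_strong_grad u : H10 Om u -> strong_grad u (grad Om u).
Proof.
move=> [[/(in_L2P mO) lu [G wG]] [phi tphi cv]].
have wg := grad_weak wG.
have lg i : L2O (fun x => grad Om u x ord0 i) by have [/(in_L2P mO)] := wg i.
split=> // e e0.
have se0 : (0 < (Num.sqrt e)%:E)%E by rewrite lte_fin sqrtr_gt0.
have [N _ NP] : \forall n \near \oo, (H1_norm Om (phi n \- u)%R <= (Num.sqrt e)%:E)%E.
  have cv' : (fun n => Num.sqrt (I (fun x => (phi n x - u x) ^+ 2)) +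
      \sum_(i < d) Num.sqrt (I (fun x => (partial i (phi n) x - grad Om u x ord0 i) ^+ 2)))
      @ \oo --> (0 : R).
    have : (fun n => H1_norm Om (phi n \- u)) @ \oo --> 0%E by exact: cv.
    by under eq_fun do rewrite (H1_norm_test (tphi _) lu wg); move/fine_cvgP => [].
  rewrite lte_fin in se0; have [N _ NP] := cvgr_le _ cv' _ se0; exists N => // n Nn.
  by rewrite (H1_norm_test (tphi _) lu wg) lee_fin; exact: NP.
have := NP N (leqnn N); rewrite /= (H1_norm_test (tphi _) lu wg) lee_fin.
set S := \sum_(i < d) _ => Hs.
exists (phi N) => //; split.
  rewrite -(ler_sqrt _ (ltW e0)); apply: le_trans Hs; rewrite lerDl.
  by apply: sumr_ge0 => i _; exact: sqrtr_ge0.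
move=> i; rewrite -(ler_sqrt _ (ltW e0)); apply: le_trans Hs.
rewrite /S (bigD1 i)//= addrCA lerDl addr_ge0 ?sqrtr_ge0//.
by apply: sumr_ge0 => j _; exact: sqrtr_ge0.
Qed.

Lemma strong_H10 u G : strong_grad u G -> H10 Om u.
Proof.
move=> sG; have wG := strong_weak sG; have [lu lG _] := sG.
have [phi [tphi cvu cvG]] := strong_seq sG.
split; first by split; [exact/(in_L2P mO)|exists G].
exists phi => //; under eq_fun do rewrite (H1_norm_test (tphi _) lu wG).
have sq0 (v : nat -> R) : v @ \oo --> (0 : R) -> (fun n => Num.sqrt (v n)) @ \oo --> (0 : R).
  move=> v0; rewrite -[X in _ --> X](@sqrtr0 R).
  by apply: continuous_cvg => //; exact: sqrt_continuous.
apply: cvg_EFin; first exact: nearW.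
have cvS : (fun n => \sum_(i < d) Num.sqrt (I (fun x => (partial i (phi n) x - G x ord0 i) ^+ 2)))
    @ \oo --> \sum_(i < d) (0 : R).
  by apply: cvg_sum_ord => i; exact: sq0.
rewrite big1// in cvS.
by apply: (eq_cvg_to (fun _ => erefl) (addr0 0)); apply: cvgD => //; exact: sq0.
Qed.

End weak_gradients.

(** * The Dirichlet form of an elliptic operator *)

Section strong_gradients.
Context (R : realType) (d : nat) (Om : set 'rV[R]_d).
Local Notation E := 'rV[R]_d.
Local Notation mu := (lebesgue_rV R d).
Hypotheses (oO : open Om) (bO : bounded_set Om).
Local Notation I f := (Rintegral mu Om f).
Local Notation L2O := (L2 mu Om).
Local Notation aeO P := {ae mu, forall x, Om x -> P x}.
Implicit Types (u w phi : E -> R) (G H : E -> E).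

Let mO : measurable Om. Proof. exact: open_measurable_rV. Qed.

Lemma test_strong phi : test_function Om phi -> strong_grad Om phi (pgrad phi).
Proof.
move=> tphi; split.
- exact: test_L2.
- by move=> i; have := test_partial_L2 mO i tphi; congr (L2 mu Om); apply/funext => x; rewrite mxE.
- move=> e e0; exists phi => //; split.
    under eq_Rintegral do rewrite subrr expr0n.
    by rewrite I_0// ltW.
  move=> i; under eq_Rintegral do rewrite mxE subrr expr0n.
  by rewrite I_0// ltW.
Qed.

Lemma strong_closed u G : L2O u -> (forall i, L2O (fun x => G x ord0 i)) ->
  (forall e, 0 < e -> exists w H, [/\ strong_grad Om w H,
      I (fun x => (w x - u x) ^+ 2) <= e &
      forall i, I (fun x => (H x ord0 i - G x ord0 i) ^+ 2) <= e]) ->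
  strong_grad Om u G.
Proof.
move=> lu lG H; split=> // e e0.
have e4 : 0 < e / 4 by rewrite divr_gt0.
have [w [K [[lw lK approx] wu KG]]] := H _ e4.
have [phi tphi [phiw phiK]] := approx _ e4.
have split4 f g h : L2O f -> L2O g -> L2O h ->
    I (fun x => (f x - g x) ^+ 2) <= e / 4 -> I (fun x => (g x - h x) ^+ 2) <= e / 4 ->
    I (fun x => (f x - h x) ^+ 2) <= e.
  move=> lf lg lh fg gh.
  have := I_sqrD mO (L2B mO lf lg) (L2B mO lg lh).
  have -> : (fun x => (f x - g x + (g x - h x)) ^+ 2) = (fun x => (f x - h x) ^+ 2).
    by apply/funext => x; ring.
  by move=> /le_trans; apply; lra.
exists phi => //; split; first by apply: split4 phiw wu => //; exact: test_L2.
by move=> i; apply: split4 (phiK i) (KG i) => //; exact: test_partial_L2.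
Qed.

Lemma strong_gradD u w G H : strong_grad Om u G -> strong_grad Om w H ->
  strong_grad Om (fun x => u x + w x) (fun x => G x + H x).
Proof.
move=> [lu lG aG] [lw lH aH].
have lGH i : L2O (fun x => (G x + H x) ord0 i).
  by have := L2D mO (lG i) (lH i); congr (L2 mu Om); apply/funext => x; rewrite mxE.
split=> //; first exact: L2D.
move=> e e0; have e4 : 0 < e / 4 by rewrite divr_gt0.
have [p tp [pu pG]] := aG _ e4; have [q tq [qw qH]] := aH _ e4.
have sum4 f g h k : L2O f -> L2O g -> L2O h -> L2O k ->
    I (fun x => (f x - g x) ^+ 2) <= e / 4 -> I (fun x => (h x - k x) ^+ 2) <= e / 4 ->
    I (fun x => (f x + h x - (g x + k x)) ^+ 2) <= e.
  move=> lf lg lh lk fg hk.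
  have := I_sqrD mO (L2B mO lf lg) (L2B mO lh lk).
  have -> : (fun x => (f x - g x + (h x - k x)) ^+ 2) = (fun x => (f x + h x - (g x + k x)) ^+ 2).
    by apply/funext => x; ring.
  by move=> /le_trans; apply; lra.
exists (fun x => p x + q x); first exact: testD.
split; first by apply: sum4 => //; exact: test_L2.
move=> i.
have -> : (fun x => (partial i (fun y => p y + q y) x - (G x + H x) ord0 i) ^+ 2) =
    (fun x => (partial i p x + partial i q x - (G x ord0 i + H x ord0 i)) ^+ 2).
  by apply/funext => x; rewrite (partialD i x (test_Ck1 tp) (test_Ck1 tq)) mxE.
by apply: sum4 => //; exact: test_partial_L2.
Qed.

Lemma strong_gradZ c u G : strong_grad Om u G ->
  strong_grad Om (fun x => c * u x) (fun x => c *: G x).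
Proof.
move=> [lu lG aG].
have lcG i : L2O (fun x => (c *: G x) ord0 i).
  by have := L2Z mO c (lG i); congr (L2 mu Om); apply/funext => x; rewrite mxE.
split=> //; first exact: L2Z.
move=> e e0; pose k := c ^+ 2 + 1; have k0 : 0 < k by rewrite /k ltr_wpDl// sqr_ge0.
have ek : 0 < e / k by rewrite divr_gt0.
have [p tp [pu pG]] := aG _ ek.
have sc f g : L2O f -> L2O g -> I (fun x => (f x - g x) ^+ 2) <= e / k ->
    I (fun x => (c * f x - c * g x) ^+ 2) <= e.
  move=> lf lg fg.
  have -> : (fun x => (c * f x - c * g x) ^+ 2) = (fun x => c ^+ 2 * (f x - g x) ^+ 2).
    by apply/funext => x; ring.
  rewrite (I_Z mO _ (L2B mO lf lg).2).
  apply: (@le_trans _ _ (k * (e / k))); last by rewrite mulrCA divff ?mulr1// gt_eqF.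
  apply: ler_pM => //; [exact: sqr_ge0|by apply: I_sqr_ge0 => //; exact: (L2B mO lf lg).1|].
  by rewrite /k lerDl.
exists (fun x => c * p x); first exact: testZ.
split; first by apply: sc => //; exact: test_L2.
move=> i.
have -> : (fun x => (partial i (fun y => c * p y) x - (c *: G x) ord0 i) ^+ 2) =
    (fun x => (c * partial i p x - c * G x ord0 i) ^+ 2).
  by apply/funext => x; rewrite (partialZ c i x (test_Ck1 tp)) mxE.
by apply: sc => //; exact: test_partial_L2.
Qed.

Lemma strong_grad0 : strong_grad Om (fun=> 0) (fun=> 0).
Proof.
have t0 : test_function Om (fun=> 0).
  split; first by move=> k; exact: Ck_cst.
    rewrite /tsupport (_ : [set _ | _] = set0) ?closure0//; first exact: compact0.
    by apply/seteqP; split => // x /=; rewrite eqxx.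
  rewrite /tsupport (_ : [set _ | _] = set0) ?closure0//.
  by apply/seteqP; split => // x /=; rewrite eqxx.
have := test_strong t0; congr strong_grad; apply/funext => x; apply/rowP => i.
by rewrite !mxE /partial derive_cst.
Qed.

Lemma strong_gradN u G : strong_grad Om u G ->
  strong_grad Om (fun x => - u x) (fun x => - G x).
Proof.
by move=> /(strong_gradZ (-1)); congr strong_grad; apply/funext => x; rewrite ?mulN1r ?scaleN1r.
Qed.

Lemma strong_gradB u w G H : strong_grad Om u G -> strong_grad Om w H ->
  strong_grad Om (fun x => u x - w x) (fun x => G x - H x).
Proof. by move=> sG /strong_gradN sH; exact: (strong_gradD sG sH). Qed.

Lemma strong_ae u w G : strong_grad Om u G -> measurable_fun Om w ->
  aeO (fun x => u x = w x) -> strong_grad Om w G.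
Proof.
move=> sG mw uw; have [lu lG _] := sG.
have lw : L2O w by apply: (L2_dom mO mw lu); apply: filterS uw => x /[apply] ->.
apply: strong_closed => // e e0; exists u, G; split => //.
  rewrite (_ : I _ = 0) ?ltW//.
  rewrite -(I_0 mu mO); apply: I_ae_eq => //; first exact: (L2B mO lu lw).2.
    exact: L1_0.
  by apply: filterS uw => x /[apply] ->; rewrite subrr expr0n.
by move=> i; under eq_Rintegral do rewrite subrr expr0n; rewrite I_0// ltW.
Qed.

Lemma grad_ae u G : strong_grad Om u G -> aeO (fun x => grad Om u x = G x).
Proof.
move=> sG; have wG := strong_weak oO sG.
have : {ae mu, forall x i, Om x -> grad Om u x ord0 i = G x ord0 i}.
  by apply: filter_forall => i; exact: (weak_unique oO bO (grad_weak wG) wG i).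
by apply: filterS => x Hx Ox; apply/rowP => i; exact: Hx.
Qed.

Lemma H10_L2 u : H10 Om u -> L2O u.
Proof. by move=> /(H10_strong_grad oO bO)[]. Qed.

Lemma H10D u w : H10 Om u -> H10 Om w -> H10 Om (fun x => u x + w x).
Proof. by move=> /(H10_strong_grad oO bO) su /(H10_strong_grad oO bO) sw; exact: (strong_H10 oO bO (strong_gradD su sw)). Qed.

Lemma H10Z c u : H10 Om u -> H10 Om (fun x => c * u x).
Proof. by move=> /(H10_strong_grad oO bO) su; exact: (strong_H10 oO bO (strong_gradZ c su)). Qed.

Lemma H10_0 : H10 Om (fun=> 0).
Proof. exact: (strong_H10 oO bO strong_grad0). Qed.

Lemma H10_test phi : test_function Om phi -> H10 Om phi.
Proof. by move=> /test_strong; exact: strong_H10. Qed.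

Lemma H10_ae u w : H10 Om u -> measurable_fun Om w -> aeO (fun x => u x = w x) -> H10 Om w.
Proof. by move=> /(H10_strong_grad oO bO) su mw uw; exact: (strong_H10 oO bO (strong_ae su mw uw)). Qed.

Definition dirichlet G : R := \sum_(i < d) I (fun x => G x ord0 i ^+ 2).

(** Poincare's inequality; it passes to the limit from test functions. *)
Lemma poincare (i : 'I_d) : exists2 C, 0 < C & forall u G, strong_grad Om u G ->
  I (fun x => u x ^+ 2) <= C * dirichlet G.
Proof.
have [M [_ bM]] := bO.
pose r := `|M| + 1; have Mr : M < r by rewrite /r; have := ler_norm M; lra.
exists (4 * r ^+ 2) => [|u G sG].
  by rewrite mulr_gt0// exprn_gt0// /r ltr_wpDl.
have [lu lG _] := sG; have [phi [tphi cvu cvG]] := strong_seq oO sG.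
have h1 : (fun n => I (fun x => phi n x ^+ 2)) @ \oo --> I (fun x => u x ^+ 2).
  exact: (form_cvg_sqr (L2_form oO) (fun n => test_L2 mO (tphi n)) lu cvu).
have h2 : (fun n => I (fun x => partial i (phi n) x ^+ 2)) @ \oo -->
    I (fun x => G x ord0 i ^+ 2).
  exact: (form_cvg_sqr (L2_form oO) (u := fun n => partial i (phi n))
    (u0 := fun x => G x ord0 i) (fun n => test_partial_L2 mO i (tphi n)) (lG i) (cvG i)).
apply: (@le_trans _ _ (4 * r ^+ 2 * I (fun x => G x ord0 i ^+ 2))).
  apply: ler_cvg_to h1 (cvgM (cvg_cst _) h2) _; apply: nearW => n /=.
  rewrite I_setT => [|x nO]; last by rewrite (test_supp0 (tphi n) nO) expr0n.
  rewrite I_setT => [|x nO]; last by rewrite (test_partial_supp0 i (tphi n) nO) expr0n.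
  apply: poincare_C1c; first exact: (test_C1c (tphi n)).
  move=> x rx; apply: (test_supp0 (tphi n)) => Ox.
  have xr : `|x| <= r := bM _ Mr _ Ox.
  by rewrite leNgt rx in xr.
apply: ler_wpM2l; first by rewrite mulr_ge0 ?sqr_ge0.
rewrite /dirichlet (bigD1 i)//= lerDl; apply: sumr_ge0 => j _.
by apply: I_sqr_ge0 => //; exact: (lG j).1.
Qed.

End strong_gradients.

Section dirichlet_form.
Context (R : realType) (d : nat) (Om : set 'rV[R]_d) (A : 'rV[R]_d -> 'M[R]_d)
  (alpha beta : R).
Local Notation E := 'rV[R]_d.
Local Notation mu := (lebesgue_rV R d).
Hypotheses (oO : open Om) (bO : bounded_set Om).
Hypotheses (alpha_gt0 : 0 < alpha) (HA : elliptic_field Om alpha beta A).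
Variable i0 : 'I_d.
Local Notation I f := (Rintegral mu Om f).
Local Notation L1O := (L1 mu Om).
Local Notation L2O := (L2 mu Om).
Local Notation aeO P := {ae mu, forall x, Om x -> P x}.
Implicit Types (u w phi : E -> R) (G H : E -> E).

Let mO : measurable Om. Proof. exact: open_measurable_rV. Qed.
Let muO : (mu Om < +oo)%E. Proof. exact: bounded_lebesgue_lty. Qed.

Definition L2_field G := forall i, L2O (fun x => G x ord0 i).

Definition density G H x : R := dot (mxapply (A x) (G x)) (H x).

Definition energy u w : R := I (density (grad Om u) (grad Om w)).

Lemma dotE (a b : E) : dot a b = \sum_i a ord0 i * b ord0 i.
Proof. by rewrite /dot mxE; apply: eq_bigr => i _; rewrite mxE. Qed.

Lemma dotDl (a b c : E) : dot (a + b) c = dot a c + dot b c.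
Proof. by rewrite /dot mulmxDl mxE. Qed.

Lemma dotZl k (a b : E) : dot (k *: a) b = k * dot a b.
Proof. by rewrite /dot -scalemxAl mxE. Qed.

Lemma dotC (a b : E) : dot a b = dot b a.
Proof. by rewrite !dotE; apply: eq_bigr => i _; rewrite mulrC. Qed.

Lemma dot_mxapplyC (M : 'M[R]_d) (a b : E) : M^T = M ->
  dot (mxapply M a) b = dot (mxapply M b) a.
Proof.
move=> MT; rewrite [RHS]dotC /dot /mxapply trmx_mul trmxK -mulmxA.
by rewrite mulmxA MT mulmxA.
Qed.

Lemma densityE G H x :
  density G H x = \sum_i (\sum_j G x ord0 j * A x i j) * H x ord0 i.
Proof.
rewrite /density dotE; apply: eq_bigr => i _; congr (_ * _).
by rewrite /mxapply mxE; apply: eq_bigr => j _; rewrite mxE.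
Qed.

Lemma L2_sum n (f : 'I_n -> E -> R) : (forall i, L2O (f i)) ->
  L2O (fun x => \sum_(i < n) f i x).
Proof.
elim: n f => [|n IH] f lf.
  by under eq_fun do rewrite big_ord0; exact: L2_0.
under eq_fun do rewrite big_ord_recl.
by apply: L2D => //; apply: IH.
Qed.

Lemma L2_mul_bounded (f g : E -> R) (M : R) : L2O f -> measurable_fun Om g ->
  aeO (fun x => `|g x| <= M) -> L2O (fun x => f x * g x).
Proof.
move=> lf mg gM; apply: (@L2_dom _ _ _ _ _ mO _ (fun x => M * f x)).
- exact: measurable_funM lf.1 mg.
- exact: L2Z.
- apply: filterS gM => x /[apply] gM; rewrite !normrM mulrC.
  by rewrite ler_wpM2r// (le_trans gM)// ler_norm.
Qed.

Lemma L2_flux G i : L2_field G -> L2O (fun x => \sum_j G x ord0 j * A x i j).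
Proof.
move=> lG; apply: L2_sum => j; have [Aoo _ _] := HA.
have [mA [M _ AM]] := in_Loo_bounded mO (Aoo i j).
exact: (L2_mul_bounded (lG j) mA AM).
Qed.

Lemma L1_density G H : L2_field G -> L2_field H -> L1O (density G H).
Proof.
move=> lG lH.
have : L1O (fun x => \sum_i (\sum_j G x ord0 j * A x i j) * H x ord0 i).
  by apply: L1_sum => // i; apply: L2M => //; exact: L2_flux.
by apply: (L1_eq mO) => x _; rewrite densityE.
Qed.

Lemma strong_field u G : strong_grad Om u G -> L2_field G.
Proof. by case. Qed.

Lemma H10_field u : H10 Om u -> L2_field (grad Om u).
Proof. by move=> /(H10_strong_grad oO bO)/strong_field. Qed.

(** The chosen gradients can be replaced by any others under the integral. *)
Lemma energyE u w G H : strong_grad Om u G -> strong_grad Om w H ->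
  energy u w = I (density G H).
Proof.
move=> su sw; apply: I_ae_eq => //.
- by apply: L1_density; apply: H10_field; [exact: strong_H10 su|exact: strong_H10 sw].
- by apply: L1_density; [exact: strong_field su|exact: strong_field sw].
- apply: filterS2 (grad_ae oO bO su) (grad_ae oO bO sw) => x + + Ox.
  by move=> /(_ Ox) Gx /(_ Ox) Hx; rewrite /density Gx Hx.
Qed.

Lemma dirichletE G : L2_field G -> dirichlet Om G = I (fun x => dot (G x) (G x)).
Proof.
move=> lG; rewrite /dirichlet -I_sum//; last by move=> i; exact: (lG i).2.
by apply: eq_Rintegral => x _; rewrite dotE.
Qed.

Lemma L1_dot G : L2_field G -> L1O (fun x => dot (G x) (G x)).
Proof.
move=> lG; have : L1O (fun x => \sum_i G x ord0 i ^+ 2).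
  by apply: L1_sum => // i; exact: (lG i).2.
by apply: (L1_eq mO) => x _; rewrite dotE.
Qed.

Lemma dirichlet_ge0 G : L2_field G -> 0 <= dirichlet Om G.
Proof. by move=> lG; apply: sumr_ge0 => i _; apply: I_sqr_ge0 => //; exact: (lG i).1. Qed.

Lemma density_ge G : L2_field G -> alpha * dirichlet Om G <= I (density G G).
Proof.
move=> lG; rewrite dirichletE// -I_Z//; last exact: L1_dot.
apply: I_le => //; [by apply: L1Z => //; exact: L1_dot|exact: L1_density|].
by have [_ _] := HA; apply: filterS => x /[apply] /(_ (G x)) /andP[].
Qed.

Lemma density_le G : L2_field G -> I (density G G) <= beta * dirichlet Om G.
Proof.
move=> lG; rewrite dirichletE// -I_Z//; last exact: L1_dot.
apply: I_le => //; [exact: L1_density|by apply: L1Z => //; exact: L1_dot|].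
by have [_ _] := HA; apply: filterS => x /[apply] /(_ (G x)) /andP[].
Qed.

Lemma energy_form : psd_form (H10 Om) energy.
Proof.
split.
- exact: H10_0.
- by move=> u w; exact: H10D.
- by move=> c u; exact: H10Z.
- move=> u w Hu Hw; have lu := H10_field Hu; have lw := H10_field Hw.
  apply: I_ae_eq => //; [exact: L1_density|exact: L1_density|].
  by have [_ AT _] := HA; apply: filterS AT => x /[apply] AT; exact: dot_mxapplyC.
- move=> u1 u2 w H1 H2 Hw.
  have s1 := H10_strong_grad oO bO H1; have s2 := H10_strong_grad oO bO H2; have sw := H10_strong_grad oO bO Hw.
  rewrite (energyE (strong_gradD oO s1 s2) sw) -I_D//.
  + by apply: eq_Rintegral => x _; rewrite /density /mxapply mulmxDl dotDl.
  + by apply: L1_density; exact: H10_field.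
  + by apply: L1_density; exact: H10_field.
- move=> c u w Hu Hw.
  have su := H10_strong_grad oO bO Hu; have sw := H10_strong_grad oO bO Hw.
  rewrite (energyE (strong_gradZ oO c su) sw) -I_Z//.
  + by apply: eq_Rintegral => x _; rewrite /density /mxapply -scalemxAl dotZl.
  + by apply: L1_density; exact: H10_field.
- move=> u Hu; have lu := H10_field Hu; apply: le_trans (density_ge lu).
  by rewrite mulr_ge0 ?dirichlet_ge0// ltW.
Qed.

Lemma poincare_energy : exists2 C, 0 < C & forall u, H10 Om u ->
  I (fun x => u x ^+ 2) <= C * energy u u.
Proof.
have [C C0 CP] := poincare oO bO i0.
exists (C / alpha) => [|u Hu]; first by rewrite divr_gt0.
apply: (le_trans (CP _ _ (H10_strong_grad oO bO Hu))).
rewrite -mulrA ler_pM2l// ler_pdivlMl//.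
exact: density_ge (H10_field Hu).
Qed.

Lemma H10_complete (u : nat -> E -> R) : (forall n, H10 Om (u n)) ->
  form_cauchy energy u -> exists2 u0, H10 Om u0 &
  (fun k => energy (fun x => u k x - u0 x) (fun x => u k x - u0 x)) @ \oo --> (0 : R).
Proof.
move=> Hu uC; have [C C0 CP] := poincare_energy.
have su n := H10_strong_grad oO bO (Hu n).
have lg n := H10_field (Hu n).
have uB n m := strong_gradB oO (su n) (su m).
have lu n := H10_L2 oO bO (Hu n).
have [u0 lu0 cv0] : exists2 f, L2O f &
    (fun n => I (fun x => (u n x - f x) ^+ 2)) @ \oo --> (0 : R).
  apply: L2_complete => // e e0.
  have [N NP] := uC (C^-1 * e) (ltac:(by rewrite mulr_gt0// invr_gt0)).
  exists N => n m Nn Nm; apply: (le_trans (CP _ (strong_H10 oO bO (uB n m)))).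
  by have := NP _ _ Nn Nm; rewrite ler_pdivlMl.
have cauchy_i i e : 0 < e -> exists N, forall n m, (N <= n)%N -> (N <= m)%N ->
    I (fun x => (grad Om (u n) x ord0 i - grad Om (u m) x ord0 i) ^+ 2) <= e.
  move=> e0; have [N NP] := uC (alpha * e) (ltac:(by rewrite mulr_gt0)).
  exists N => n m Nn Nm; have := NP _ _ Nn Nm.
  rewrite (energyE (uB n m) (uB n m)) => h.
  have := le_trans (density_ge (strong_field (uB n m))) h.
  rewrite ler_pM2l//; apply: le_trans.
  rewrite /dirichlet (bigD1 i)//=.
  have -> : (fun x => (grad Om (u n) x - grad Om (u m) x) ord0 i ^+ 2) =
      (fun x => (grad Om (u n) x ord0 i - grad Om (u m) x ord0 i) ^+ 2).
    by apply/funext => x; rewrite !mxE.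
  rewrite lerDl; apply: sumr_ge0 => j _; apply: I_sqr_ge0 => //.
  exact: (strong_field (uB n m) j).1.
have comp i : exists f, L2O f /\
    (fun n => I (fun x => (grad Om (u n) x ord0 i - f x) ^+ 2)) @ \oo --> (0 : R).
  have [f lf cf] := L2_complete mO muO (fun n => lg n i) (cauchy_i i).
  by exists f.
have [g gP] := choice comp.
pose G x : E := \row_i g i x.
have GE i : (fun x => G x ord0 i) = g i by apply/funext => x; rewrite mxE.
have lG : L2_field G by move=> i; rewrite GE; exact: (gP i).1.
have s0 : strong_grad Om u0 G.
  apply: strong_closed => // e e0.
  have [N0 _ N0P] := cvgr_le _ cv0 _ e0.
  have near_i i : exists N, forall n, (N <= n)%N ->
      I (fun x => (grad Om (u n) x ord0 i - g i x) ^+ 2) <= e.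
    by have [N _ NP] := cvgr_le _ (gP i).2 _ e0; exists N => n; exact: NP.
  have [N NP] := choice near_i.
  pose n := maxn N0 (\max_i N i).
  exists (u n), (grad Om (u n)); split=> //; first by apply: N0P; exact: leq_maxl.
  move=> i; under eq_Rintegral do rewrite mxE.
  by apply: NP; apply: leq_trans (leq_maxr _ _); exact: leq_bigmax.
exists u0; first exact: strong_H10 s0.
have cvd : (fun n => beta * dirichlet Om (fun x => grad Om (u n) x - G x)) @ \oo --> (0 : R).
  apply: (@eq_cvg_to _ (fun n => beta * \sum_i I (fun x => (grad Om (u n) x ord0 i - g i x) ^+ 2))
    _ (beta * \sum_(i < d) 0)).
  + move=> n; congr (_ * _); apply: eq_bigr => i _; apply: eq_Rintegral => x _.
    by rewrite !mxE.
  + by rewrite big1// mulr0.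
  + by apply: cvgM; [exact: cvg_cst|apply: cvg_sum_ord => i; exact: (gP i).2].
apply: squeeze0 cvd => n; have sB := strong_gradB oO (su n) s0.
apply/andP; split; first exact: (form_ge0 energy_form (strong_H10 oO bO sB)).
by rewrite (energyE sB sB) density_le//; exact: strong_field sB.
Qed.

Lemma energy_L2_cvg (u : nat -> E -> R) u0 : (forall n, H10 Om (u n)) -> H10 Om u0 ->
  (fun k => energy (fun x => u k x - u0 x) (fun x => u k x - u0 x)) @ \oo --> (0 : R) ->
  (fun k => I (fun x => (u k x - u0 x) ^+ 2)) @ \oo --> (0 : R).
Proof.
move=> Hu Hu0 cv; have [C C0 CP] := poincare_energy.
apply: (@squeeze0 _ _ (fun k => C * energy (fun x => u k x - u0 x) (fun x => u k x - u0 x))).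
  move=> n; have HB := formB_in energy_form (Hu n) Hu0.
  by rewrite CP// andbT; apply: I_sqr_ge0 => //; exact: (H10_L2 oO bO HB).1.
by apply: (@eq_cvg_to _ _ _ (C * 0) _ (fun _ => erefl) (mulr0 C)); apply: cvgM => //; exact: cvg_cst.
Qed.

(** Almost minimal functions of energy at most [M] within shrinking mean-square
    distance from [w] converge strongly, by uniform convexity, and their limit
    can only be [w]. *)
Lemma H10_lsc (u : nat -> E -> R) w M : (forall n, H10 Om (u n)) -> L2O w ->
  (forall n, energy (u n) (u n) <= M) ->
  (fun n => I (fun x => (u n x - w x) ^+ 2)) @ \oo --> (0 : R) ->
  exists w0, [/\ H10 Om w0, aeO (fun x => w0 x = w x) & energy w0 w0 <= M].
Proof.
move=> Hu lw uM cv.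
pose Cs (k : nat) : set (E -> R) := [set z | H10 Om z /\
  I (fun x => (z x - w x) ^+ 2) <= k.+1%:R^-1].
have F := energy_form.
have Cmid k z1 z2 : Cs k z1 -> Cs k z2 -> Cs k (fun x => 2^-1 * (z1 x + z2 x)).
  move=> [H1 d1] [H2 d2]; split; first exact: (formZ_in F _ (formD_in F H1 H2)).
  have l1 := L2B mO (H10_L2 oO bO H1) lw; have l2 := L2B mO (H10_L2 oO bO H2) lw.
  have -> : (fun x => (2^-1 * (z1 x + z2 x) - w x) ^+ 2) =
      (fun x => 4^-1 * ((z1 x - w x) + (z2 x - w x)) ^+ 2).
    by apply/funext => x; field.
  rewrite (I_Z mO _ (L2D mO l1 l2).2).
  by have := I_sqrD mO l1 l2; move: (k.+1%:R^-1) d1 d2 => e d1 d2; lra.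
have Cdecr k l : (k <= l)%N -> Cs l `<=` Cs k.
  move=> kl z [Hz dz]; split=> //; apply: (le_trans dz).
  by rewrite lef_pV2 ?posrE// ler_nat.
have Fmid z1 z2 : Cs 0%N z1 -> Cs 0%N z2 ->
    energy (fun x => 2^-1 * (z1 x + z2 x)) (fun x => 2^-1 * (z1 x + z2 x)) <=
    (energy z1 z1 + energy z2 z2) / 2 -
    4^-1 * energy (fun x => z1 x - z2 x) (fun x => z1 x - z2 x).
  by move=> [H1 _] [H2 _]; rewrite (form_mid F).
have Fge0 z : Cs 0%N z -> 0 <= energy z z by move=> [Hz _]; exact: (form_ge0 F).
have CM k : exists2 z, Cs k z & energy z z <= M.
  have k0 : 0 < k.+1%:R^-1 :> R by rewrite invr_gt0.
  have [N _ NP] := cvgr_le _ cv _ k0.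
  by exists (u N); [split=> //; exact: (NP N (leqnn N))|exact: uM].
have [z [Cz zmin zC]] := cauchy_near_minimizers Cdecr Cmid Fmid Fge0 CM.
have Hz n : H10 Om (z n) by have [] := Cz n.
have [w0 Hw0 zw0] : exists2 u0, H10 Om u0 &
    (fun k => energy (fun x => z k x - u0 x) (fun x => z k x - u0 x)) @ \oo --> (0 : R).
  apply: H10_complete => // e e0.
  have [N NP] := zC (4^-1 * e) (ltac:(by rewrite mulr_gt0)).
  by exists N => n m Nn Nm; have := NP _ _ Nn Nm; lra.
have lw0 := H10_L2 oO bO Hw0.
have lz n := H10_L2 oO bO (Hz n).
have zw : (fun k => I (fun x => (z k x - w x) ^+ 2)) @ \oo --> (0 : R).
  apply: (@squeeze0 _ _ (fun k => k.+1%:R^-1)); last exact: cvg_harmonic.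
  move=> k; have [_ ->] := Cz k; rewrite andbT.
  by apply: I_sqr_ge0 => //; exact: (L2B mO (lz k) lw).1.
have w0w : aeO (fun x => w0 x = w x).
  have lB := L2B mO lw0 lw.
  suff : aeO (fun x => (w0 x - w x) ^+ 2 = 0).
    apply: filterS => x /[apply] /eqP; rewrite sqrf_eq0 subr_eq0.
    by move=> /eqP.
  apply: I_eq0 => //; first exact: lB.2.
    by apply: aeW => x _; exact: sqr_ge0.
  have cv2 : (fun k => 2 * I (fun x => (z k x - w0 x) ^+ 2) + 2 * I (fun x => (z k x - w x) ^+ 2))
      @ \oo --> 2 * 0 + 2 * (0 : R).
    apply: cvgD; apply: cvgM => //; try exact: cvg_cst.
    exact: energy_L2_cvg.
  rewrite mulr0 addr0 in cv2.
  apply: (cvgr_to_ge cv2); apply: nearW => k.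
  have := I_sqrD mO (L2N mO (L2B mO (lz k) lw0)) (L2B mO (lz k) lw).
  have -> : (fun x => (- (z k x - w0 x) + (z k x - w x)) ^+ 2) = (fun x => (w0 x - w x) ^+ 2).
    by apply/funext => x; ring.
  by under [X in _ <= 2 * X + _ -> _]eq_Rintegral do rewrite sqrrN.
exists w0; split=> //.
have h : (fun k => M + k.+1%:R^-1) @ \oo --> M + (0 : R).
  by apply: cvgD; [exact: cvg_cst|exact: cvg_harmonic].
rewrite addr0 in h.
apply: ler_cvg_to (form_cvg_sqr F Hz Hw0 zw0) h _; apply: nearW => k.
have [y Cy yM] := CM k.
by rewrite (le_trans (zmin k y Cy))// lerD2r.
Qed.

(** The smooth function [sqrt (t ^+ 2 + s ^+ 2) - s] contracts differences and
    vanishes at 0, hence it maps test functions to test functions without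
    raising the energy; it tends to the absolute value as [s] tends to 0. *)
Definition smooth_abs (s t : R) : R := Num.sqrt (t ^+ 2 + s ^+ 2) - s.

Lemma smooth_abs_near s t : 0 < s -> `|smooth_abs s t - `|t| | <= s.
Proof.
move=> s0; rewrite /smooth_abs.
have h1 : `|t| <= Num.sqrt (t ^+ 2 + s ^+ 2).
  by rewrite -sqrtr_sqr ler_sqrt ?lerDl ?sqr_ge0// addr_ge0 ?sqr_ge0.
have h2 : Num.sqrt (t ^+ 2 + s ^+ 2) <= `|t| + s.
  rewrite -[leRHS]ger0_norm; last by rewrite addr_ge0// ltW.
  rewrite -sqrtr_sqr ler_sqrt ?sqr_ge0// sqrrD real_normK ?num_real//.
  by rewrite lerD2r lerDl mulrn_wge0// mulr_ge0// ltW.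
by rewrite ler_norml; apply/andP; split; lra.
Qed.

Lemma smooth_abs_test s phi : 0 < s -> test_function Om phi ->
  test_function Om (fun x => smooth_abs s (phi x)) /\
  forall x, exists2 c, c ^+ 2 <= 1 &
    pgrad (fun x => smooth_abs s (phi x)) x = c *: pgrad phi x.
Proof.
move=> s0 tphi.
have pos x : 0 < phi x ^+ 2 + s ^+ 2 by rewrite ltr_wpDl ?sqr_ge0// exprn_gt0.
have smphi k : Ck k phi by case: tphi => + _ _; apply.
have smq k : Ck k (fun x => phi x ^+ 2 + s ^+ 2).
  by apply: CkD; [rewrite (_ : (fun x => _) = (fun x => phi x * phi x))//; exact: CkM|exact: Ck_cst].
have smr k : Ck k (fun x => Num.sqrt (phi x ^+ 2 + s ^+ 2)) by exact: Ck_sqrt.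
split.
  apply: (test_op tphi tphi) => [k|x p0 _].
    by apply: CkD; [exact: smr|exact: Ck_cst].
  by rewrite /smooth_abs p0 expr0n add0r sqrtr_sqr gtr0_norm// subrr.
move=> x; exists (phi x / Num.sqrt (phi x ^+ 2 + s ^+ 2)).
  rewrite expr_div_n (sqr_sqrtr (ltW (pos x))) ler_pdivrMr// mul1r lerDl.
  exact: sqr_ge0.
apply/rowP => i; rewrite !mxE.
have dphi := CkS_derive (smphi 1%N) i x.
have dq : is_derive x (delta_mx ord0 i) (fun x => phi x ^+ 2 + s ^+ 2)
    (2 * phi x * partial i phi x).
  have dc := is_derive_cst (s ^+ 2) x (delta_mx ord0 i : E).
  apply: (is_derive_eq (is_deriveD (is_deriveM dphi dphi) dc)).
  by rewrite /GRing.scale/=; ring.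
have dr := is_derive_comp dq (is_derive1_sqrt (pos x)).
have dc := is_derive_cst (- s) x (delta_mx ord0 i : E).
have [_] := is_deriveD dr dc; rewrite /partial => ->.
have r0 : Num.sqrt (phi x ^+ 2 + s ^+ 2) != 0 by rewrite gt_eqF// sqrtr_gt0.
by rewrite addr0; move: (Num.sqrt _) r0 => r r0; field.
Qed.

Lemma energy_smooth_abs s phi : 0 < s -> test_function Om phi ->
  energy (fun x => smooth_abs s (phi x)) (fun x => smooth_abs s (phi x)) <= energy phi phi.
Proof.
move=> s0 tphi; have [ts H] := smooth_abs_test s0 tphi.
rewrite (energyE (test_strong oO ts) (test_strong oO ts)).
rewrite (energyE (test_strong oO tphi) (test_strong oO tphi)).
apply: I_le => //.
- by apply: L1_density; exact: strong_field (test_strong oO ts).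
- by apply: L1_density; exact: strong_field (test_strong oO tphi).
- have [_ _ Aell] := HA; apply: filterS Aell => x /[apply] Ax.
  have [c c1 Hc] := H x; have /andP[h _] := Ax (pgrad phi x).
  rewrite /density Hc /mxapply -scalemxAl dotZl [dot _ (c *: _)]dotC dotZl mulrA.
  rewrite -expr2 [dot (pgrad _ _) _]dotC; apply: ler_piMl => //.
  apply: le_trans h; apply: mulr_ge0; first exact: ltW.
  rewrite dotE; apply: sumr_ge0 => i _.
  exact: sqr_ge0.
Qed.

(** The smooth approximations are known to converge in mean square only, so that
    the limit is taken by lower semicontinuity of the energy. *)
Lemma H10_abs w : H10 Om w ->
  H10 Om (fun x => `|w x|) /\ energy (fun x => `|w x|) (fun x => `|w x|) <= energy w w.
Proof.
move=> Hw; have sw := H10_strong_grad oO bO Hw; have lw := H10_L2 oO bO Hw.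
have F := energy_form.
have [phi [tphi cvu cvG]] := strong_seq oO sw.
have labs : L2O (fun x => `|w x|).
  apply: (L2_dom mO _ lw); first exact: measurableT_comp lw.1.
  by apply: aeW => x _; rewrite normr_id.
pose s (n : nat) : R := n.+1%:R^-1.
have s0 n : 0 < s n by rewrite invr_gt0.
have cvE : (fun n => energy (phi n) (phi n)) @ \oo --> energy w w.
  apply: (form_cvg_sqr F (fun n => H10_test oO bO (tphi n)) Hw).
  have cvd : (fun n => beta * dirichlet Om (fun x => pgrad (phi n) x - grad Om w x)) @ \oo --> (0 : R).
    apply: (@eq_cvg_to _ (fun n => beta * \sum_i I (fun x => (partial i (phi n) x - grad Om w x ord0 i) ^+ 2))
      _ (beta * \sum_(i < d) 0)).
    + move=> n; congr (_ * _); apply: eq_bigr => i _; apply: eq_Rintegral => x _.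
      by rewrite !mxE.
    + by rewrite big1// mulr0.
    + by apply: cvgM; [exact: cvg_cst|apply: cvg_sum_ord => i; exact: cvG].
  apply: squeeze0 cvd => n; have sB := strong_gradB oO (test_strong oO (tphi n)) sw.
  apply/andP; split; first exact: (form_ge0 F (strong_H10 oO bO sB)).
  by rewrite (energyE sB sB) density_le//; exact: strong_field sB.
have cvabs : (fun n => I (fun x => (smooth_abs (s n) (phi n x) - `|w x|) ^+ 2)) @ \oo --> (0 : R).
  apply: (@squeeze0 _ _ (fun n => 2 * I (fun x => (phi n x - w x) ^+ 2) + 2 * fine (mu Om) * s n)).
    move=> n; have ts := (smooth_abs_test (s0 n) (tphi n)).1.
    have lB := L2B mO (test_L2 mO ts) labs; rewrite I_sqr_ge0//=; last exact: lB.1.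
    have lpw := L2B mO (test_L2 mO (tphi n)) lw.
    rewrite -(I_Z mO _ lpw.2) -mulrA [fine _ * _]mulrC mulrA -(Rintegral_cst mu mO).
    rewrite -I_D//; last 2 first.
      exact: (L1Z mO _ lpw.2).
      exact: L1_cst.
    apply: I_le => //; first exact: lB.2.
      by apply: L1D => //; [exact: (L1Z mO _ lpw.2)|exact: L1_cst].
    apply: aeW => x _.
    have h1 := smooth_abs_near (phi n x) (s0 n).
    have h2 := ler_dist_dist (phi n x) (w x).
    have sn1 : s n <= 1 by rewrite invf_le1// ler1n.
    rewrite -(real_normK (num_real (_ - `|w x|))) -(real_normK (num_real (phi n x - w x))).
    have h3 : `|smooth_abs (s n) (phi n x) - `|w x| | <= s n + `|phi n x - w x|.
      have -> : smooth_abs (s n) (phi n x) - `|w x| =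
        (smooth_abs (s n) (phi n x) - `|phi n x|) + (`|phi n x| - `|w x|) by ring.
      by apply: (le_trans (ler_normD _ _)); exact: lerD.
    have a0 : 0 <= `|smooth_abs (s n) (phi n x) - `|w x| | by [].
    have b0 : 0 <= `|phi n x - w x| by [].
    move: h3 a0 b0.
    move: `|smooth_abs (s n) (phi n x) - `|w x| | `|phi n x - w x| => a b h3 a0 b0.
    have ab : a ^+ 2 <= (s n + b) ^+ 2 by rewrite lerXn2r ?nnegrE// (le_trans a0).
    have := s0 n; move: (s n) ab sn1 => c ab c1 c0.
    by have := sqr_ge0 (c - b); nra.
  apply: (@eq_cvg_to _ _ _ (2 * 0 + 2 * fine (mu Om) * 0) _ (fun _ => erefl)).
    by rewrite !mulr0 addr0.
  apply: cvgD; apply: cvgM => //; try exact: cvg_cst.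
  exact: cvg_harmonic.
have Hs n : H10 Om (fun x => smooth_abs (s n) (phi n x)).
  by apply: H10_test => //; exact: (smooth_abs_test (s0 n) (tphi n)).1.
have key e : 0 < e -> exists w0, [/\ H10 Om w0, aeO (fun x => w0 x = `|w x|) &
    energy w0 w0 <= energy w w + e].
  move=> e0.
  have e1 : energy w w < energy w w + e by rewrite ltrDl.
  have [N _ NP] := cvgr_le _ cvE _ e1.
  pose v n : E -> R := fun x => smooth_abs (s (n + N)%N) (phi (n + N)%N x).
  have vM n : energy (v n) (v n) <= energy w w + e.
    apply: (le_trans (energy_smooth_abs (s0 _) (tphi _))).
    by apply: NP; rewrite /= leq_addl.
  have vcv : (fun n => I (fun x => (v n x - `|w x|) ^+ 2)) @ \oo --> (0 : R).
    by rewrite -(cvg_shiftn N) in cvabs.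
  exact: (H10_lsc (fun n => Hs (n + N)%N) labs vM vcv).
have [w1 [Hw1 w1w _]] := key 1 ltr01.
have Habs : H10 Om (fun x => `|w x|) by apply: (H10_ae oO bO Hw1) => //; exact: labs.1.
split; first exact: Habs.
apply/ler_addgt0Pr => e e0; have [w0 [Hw0 w0w h]] := key e e0.
have s1 := strong_ae oO (H10_strong_grad oO bO Hw0) labs.1 w0w.
by rewrite (energyE s1 s1).
Qed.

End dirichlet_form.

(** * Locally constant sets *)

Section locally_constant.
Context (R : realType) (d : nat).
Local Notation E := 'rV[R]_d.
Local Notation mu := (lebesgue_rV R d).
Implicit Types (x h : E).

Lemma L1_indic_supp (B : set E) (f : E -> R) x0 r M : measurable B -> B `<=` ball x0 r ->
  measurable_fun setT f -> (forall x, `|f x| <= M) ->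
  L1 mu setT (fun x => \1_B x * f x).
Proof.
move=> mB Br mf fM; apply: (@L1_bounded_supp _ _ _ (`|x0| + r) M).
- by apply: measurable_funM => //; exact: measurable_indic.
- move=> x; rewrite normrM (le_trans _ (fM x))// ler_piMl//.
  by rewrite indicE; case: (_ \in _); rewrite /= ?normr1 ?normr0.
- move=> x xr; rewrite indicE memNset ?mul0r// => /Br.
  rewrite -ball_normE /= => xx0.
  have := ler_normB x0 (x0 - x); rewrite opprB addrCA subrr addr0.
  lra.
Qed.

(** Dividing a translation into [n] steps gains a factor [n], as the bound is
    quadratic. *)
Lemma shift_invariant_set (Z : set E) x0 r C : measurable Z -> 0 < r ->
  (forall h, `|h| < r ->
     Rintegral mu setT (fun x => \1_(ball x0 r) x * `|\1_Z (x + h) - \1_Z x|) <=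
     C * `|h| ^+ 2) ->
  forall h, `|h| < r / 2 ->
  {ae mu, forall x, ball x0 (r / 2) x -> (\1_Z (x + h) : R) = \1_Z x}.
Proof.
move=> mZ r0 HC h hr.
have mB e : measurable (ball x0 e) by exact: measurable_ball.
pose q e k (x : E) : R := \1_(ball x0 e) x * `|\1_Z (x + k) - \1_Z x|.
have m1 k : measurable_fun setT (fun x : E => `|\1_Z (x + k) - \1_Z x| : R).
  apply: measurableT_comp => //; apply: measurable_funB; last exact: measurable_indic.
  by apply: (measurableT_comp (measurable_indic _)) => //; exact: measurable_shift.
have b1 k x : `| `|\1_Z (x + k) - \1_Z x| : R| <= 1.
  rewrite normr_id !indicE; case: (_ \in _); case: (_ \in _) => /=;
  by rewrite ?subrr ?subr0 ?sub0r ?normrN ?normr0 ?normr1.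
have lq e k : L1 mu setT (q e k).
  by apply: (L1_indic_supp (mB e) (@subset_refl _ _) (m1 k) (b1 k)).
have q0 e k x : 0 <= q e k x by rewrite /q mulr_ge0// indicE.
suff Iq0 : Rintegral mu setT (q (r / 2) h) <= 0.
  have := I_eq0 measurableT (lq _ _) (aeW _ (fun x _ => q0 _ _ x)) Iq0.
  apply: filterS => x /(_ Logic.I) /eqP + Bx.
  by rewrite /q indicE mem_set// mul1r normr_eq0 subr_eq0 => /eqP.
have C0 : 0 <= `|C| by [].
have key n : Rintegral mu setT (q (r / 2) h) <= `|C| * `|h| ^+ 2 * n.+1%:R^-1.
  have n0 : 0 < n.+1%:R :> R by rewrite ltr0n.
  pose t : E := n.+1%:R^-1 *: h.
  have tn : n.+1%:R * `|t| = `|h|.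
    by rewrite /t normrZ ger0_norm ?invr_ge0// mulrA mulfV ?mul1r// gt_eqF.
  have tr : `|t| < r.
    have : `|t| <= `|h| by rewrite -tn ler_peMl// ler1n.
    by lra.
  have step : Rintegral mu setT (q (r / 2) h) <=
      \sum_(k < n.+1) Rintegral mu setT (fun x => q r t (x + k%:R *: t)).
    rewrite -I_sum//; last by move=> k; exact: (L1_shift _ (lq r t)).
    apply: I_le => //.
      by apply: L1_sum => // k; exact: (L1_shift _ (lq r t)).
    apply: aeW => x _; rewrite {1}/q [\1_(ball x0 (r / 2)) _]indicE.
    have [/set_mem Bx|nB] := boolP (x \in (ball x0 (r / 2) : set E)); last first.
      by rewrite mul0r; apply: sumr_ge0 => k _.
    rewrite mul1r.
    have -> : \1_Z (x + h) - \1_Z x =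
        \sum_(0 <= k < n.+1) (\1_Z (x + k.+1%:R *: t) - \1_Z (x + k%:R *: t)) :> R.
      rewrite (telescope_sumr (fun k => \1_Z (x + k%:R *: t) : R))//.
      by rewrite scale0r addr0 /t scalerA mulfV ?scale1r// gt_eqF.
    rewrite big_mkord; apply: (le_trans (ler_norm_sum _ _ _)).
    apply: ler_sum => k _; rewrite /q [\1_(ball x0 r) _]indicE mem_set.
      have -> : x + (k : nat)%:R *: t + t = x + k.+1%:R *: t.
        by rewrite -addrA -natr1 scalerDl scale1r.
      by rewrite mul1r.
    move: Bx; rewrite -!ball_normE /= => Bx.
    have : `|(k : nat)%:R *: t| <= `|h|.
      rewrite normrZ -tn ger0_norm// ler_wpM2r// ler_nat.
      by apply: ltnW; exact: ltn_ord.
    have := ler_normD (x0 - x) (- ((k : nat)%:R *: t)).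
    rewrite normrN -addrA -opprD => h1 h2.
    by apply: (le_lt_trans h1); lra.
  apply: (le_trans step).
  have IE k : Rintegral mu setT (fun x => q r t (x + k%:R *: t)) = Rintegral mu setT (q r t).
    exact: (I_shift _ (lq r t)).
  under eq_bigr do rewrite IE.
  rewrite sumr_const card_ord -(mulr_natl (Rintegral mu setT (q r t))).
  apply: (@le_trans _ _ (n.+1%:R * (`|C| * `|t| ^+ 2))).
    rewrite ler_pM2l//; apply: (le_trans (HC _ tr)).
    by rewrite ler_wpM2r ?sqr_ge0// ler_norm.
  rewrite -tn; move: (n.+1%:R) n0 => c c0; rewrite le_eqVlt; apply/orP; left; apply/eqP.
  by field; rewrite gt_eqF.
apply: (cvgr_to_ge (inv_nat_cvg0 (`|C| * `|h| ^+ 2))).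
by apply: nearW.
Qed.

(** By Fubini's theorem, some point [x] near the centre is such that [x + h]
    belongs to [Z] exactly if [x] does, for almost all small [h]. *)
Lemma locally_constant_set (Z : set E) x0 r : measurable Z -> 0 < r ->
  (forall h, `|h| < r ->
    {ae mu, forall x, ball x0 r x -> (\1_Z (x + h) : R) = \1_Z x}) ->
  {ae mu, forall x, ball x0 (r / 2) x -> Z x} \/
  {ae mu, forall x, ball x0 (r / 2) x -> ~ Z x}.
Proof.
move=> mZ r0 H.
pose plus (xh : E * E) : E := xh.1 + xh.2.
have mplus : measurable_fun setT plus.
  apply: measurable_fun_rVP => i.
  rewrite (_ : _ \o _ = fun xh : E * E => rV_coord i xh.1 + rV_coord i xh.2); last first.
    by apply/funext => xh; rewrite /= /rV_coord mxE.
  apply: measurable_funD.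
    by apply: (measurableT_comp (measurable_rV_coord i)) => //; exact: measurable_fst.
  by apply: (measurableT_comp (measurable_rV_coord i)) => //; exact: measurable_snd.
have mP : measurable (plus @^-1` Z) by rewrite -[X in measurable X]setTI; exact: mplus.
have mF : measurable ((@fst E E) @^-1` Z).
  by rewrite -[X in measurable X]setTI; exact: measurable_fst.
pose A : set (E * E) := (ball x0 r `*` ball 0 r) `&`
  ((plus @^-1` Z `\` fst @^-1` Z) `|` (fst @^-1` Z `\` plus @^-1` Z)).
have mA : measurable A.
  apply: measurableI; first by apply: measurableX; exact: measurable_ball.
  by apply: measurableU; exact: measurableD.
have ysec0 h : mu (ysection A h) = 0%E.
  have [hr|hr] := ltP `|h| r; last first.
    rewrite (_ : ysection A h = set0) ?measure0//; apply/seteqP; split=> // x.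
    rewrite /ysection /= inE => -[[_]]; rewrite -ball_normE /= sub0r normrN => hr' _.
    by move: hr; rewrite leNgt hr'.
  apply/negligibleP; first exact: measurable_ysection.
  apply: negligibleS (H h hr) => x; rewrite /ysection /= inE => -[[/= Bx _] Zx] Hx.
  have := Hx Bx; rewrite !indicE; case: Zx => -[/= Z1 Z2].
    by rewrite mem_set// memNset// => /eqP; rewrite oner_eq0.
  by rewrite memNset// mem_set// => /eqP; rewrite eq_sym oner_eq0.
have : (\int[mu]_x mu (xsection A x) = 0)%E.
  have := indic_fubini_tonelli mu mu mA.
  rewrite indic_fubini_tonelli_FE// indic_fubini_tonelli_GE//= => ->.
  by under eq_integral do rewrite ysec0; rewrite integral0.
have mx : measurable_fun setT (fun x => mu (xsection A x)) by exact: measurable_fun_xsection.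
move=> I0; have : (\int[mu]_x `|mu (xsection A x)| = 0)%E.
  by rewrite -I0; apply: eq_integral => x _; rewrite gee0_abs.
move/(ae_eq_integral_abs _ measurableT mx) => xsec0.
have [x Bx xA0] : exists2 x, ball x0 (r / 2) x & mu (xsection A x) = 0%E.
  apply: ae_open_ex.
  - exact: ball_open.
  - by exists x0; apply: ballxx; rewrite divr_gt0.
  - by apply: filterS xsec0 => x /(_ Logic.I) xA _.
have Bxr : ball x0 r x by apply: le_ball Bx; lra.
have ae_y : {ae mu, forall y, ball x0 (r / 2) y -> (Z y <-> Z x)}.
  exists ((fun y => y + (- x)) @^-1` xsection A x); split.
  - rewrite -[X in measurable X]setTI; apply: measurable_shift => //.
    exact: measurable_xsection.
  - by rewrite lebesgue_shift//; exact: measurable_xsection.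
  - move=> y /= /not_implyP[By nZ]; rewrite /xsection /= inE; split.
      split=> //=; rewrite -ball_normE /= sub0r normrN.
      move: Bx By; rewrite -!ball_normE /= => Bx By.
      have := ler_normD (y - x0) (x0 - x); rewrite addrA subrK (distrC y x0).
      lra.
    rewrite /plus/= addrC subrK.
    have [Zx|nZx] := pselect (Z x); [right|left]; split=> //.
      by move=> Zy; apply: nZ; split.
    by apply: contrapT => nZy; apply: nZ; split.
have [Zx|nZx] := pselect (Z x); [left|right];
  by apply: filterS ae_y => y + By => /(_ By)[? ?]; auto.
Qed.

End locally_constant.

(** * Dirichlet forms *)

Section positive_part.
Context (T : Type) (R : realType).
Implicit Types (w : T -> R).

Definition pos w : T -> R := fun x => Num.max 0 (w x).

Lemma posE w x : pos w x = 2^-1 * (`|w x| + w x).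
Proof.
rewrite /pos; case: (ltgtP 0 (w x)) => [w0|w0|<-].
- by rewrite gtr0_norm//; lra.
- by rewrite ltr0_norm//; lra.
- by rewrite normr0; lra.
Qed.

Lemma pos_ge0 w x : 0 <= pos w x.
Proof. by rewrite /pos le_max lexx. Qed.

Lemma pos_le w x c : 0 <= c -> w x <= c -> pos w x <= c.
Proof. by move=> c0 wc; rewrite /pos ge_max c0 wc. Qed.

Lemma pos_gt0 w x : 0 < pos w x -> pos w x = w x.
Proof. by rewrite /pos; case: (ltP 0 (w x)) => // _; rewrite ltxx. Qed.

Lemma pos_sub_opp w x : pos w x - pos (fun y => - w y) x = w x.
Proof. by rewrite !posE /= normrN; field. Qed.

End positive_part.

Section dirichlet_form.
Context dd (T : measurableType dd) (R : realType).
Variables (mu : {measure set T -> \bar R}) (D : set T).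
Local Notation I f := (Rintegral mu D f).
Local Notation aeD P := {ae mu, forall x, D x -> P x}.
Implicit Types (u w : T -> R).

(** All that is used of the energy on the Sobolev space: completeness, the
    Poincare inequality, and the contraction property of the absolute value,
    which is the source of every maximum principle. *)
Record dirichlet_form (V : set (T -> R)) (a : (T -> R) -> (T -> R) -> R) : Prop :=
  DirichletForm {
  df_psd : psd_form V a ;
  df_L2 : forall w, V w -> L2 mu D w ;
  df_complete : forall u : nat -> T -> R, (forall n, V (u n)) -> form_cauchy a u ->
    exists2 u0, V u0 &
    (fun k => a (fun x => u k x - u0 x) (fun x => u k x - u0 x)) @ \oo --> (0 : R) ;
  df_poincare : exists2 C, 0 < C & forall w, V w -> I (fun x => w x ^+ 2) <= C * a w w ;
  df_abs : forall w, V w -> V (fun x => `|w x|) /\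
    a (fun x => `|w x|) (fun x => `|w x|) <= a w w }.

Hypotheses (mD : measurable D) (muD : (mu D < +oo)%E).
Context (V : set (T -> R)) (a : (T -> R) -> (T -> R) -> R).
Hypothesis Fd : dirichlet_form V a.
Let F := df_psd Fd.

Lemma df_pos_in w : V w -> V (pos w).
Proof.
move=> Vw; have [Va _] := df_abs Fd Vw.
have -> : pos w = (fun x => 2^-1 * (`|w x| + w x)) by apply/funext => x; exact: posE.
exact: (formZ_in F _ (formD_in F Va Vw)).
Qed.

(** Equivalently, the positive and the negative part have a nonpositive mutual
    energy. *)
Lemma df_pos_le w : V w -> a (pos w) (pos w) <= a w (pos w).
Proof.
move=> Vw; have [Va ale] := df_abs Fd Vw.
have -> : pos w = (fun x => 2^-1 * (`|w x| + w x)) by apply/funext => x; exact: posE.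
rewrite (form_sqrZ F _ (formD_in F Va Vw)) (form_sqrD F Va Vw).
rewrite (formZr F _ Vw (formD_in F Va Vw)) (formDr F Vw Va Vw) (formC F Vw Va).
lra.
Qed.

Lemma df_eq0 w : V w -> a w w <= 0 -> aeD (fun x => w x = 0).
Proof.
move=> Vw w0; have [C C0 CP] := df_poincare Fd.
have : aeD (fun x => w x ^+ 2 = 0).
  apply: I_eq0 => //; first exact: (df_L2 Fd Vw).2.
    by apply: aeW => x _; exact: sqr_ge0.
  by apply: (le_trans (CP _ Vw)); rewrite pmulr_rle0.
by apply: filterS => x /[apply] /eqP; rewrite sqrf_eq0 => /eqP.
Qed.

Lemma df_cvg_ae_subseq (u : nat -> T -> R) u0 : (forall n, V (u n)) -> V u0 ->
  (fun k => a (fun x => u k x - u0 x) (fun x => u k x - u0 x)) @ \oo --> (0 : R) ->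
  exists2 s : nat -> nat, (forall n, (n <= s n)%N) &
    aeD (fun x => (fun k => u (s k) x) @ \oo --> u0 x).
Proof.
move=> Vu Vu0 cv; have [C C0 CP] := df_poincare Fd.
apply: (L2_cvg_ae_subseq mD muD (fun n => df_L2 Fd (Vu n)) (df_L2 Fd Vu0)).
apply: (@squeeze0 _ _ (fun k => C * a (fun x => u k x - u0 x) (fun x => u k x - u0 x))).
  move=> n; have VB := formB_in F (Vu n) Vu0.
  by rewrite CP// andbT; apply: I_sqr_ge0 => //; exact: (df_L2 Fd VB).1.
by rewrite -[X in _ --> X](mulr0 C); apply: cvgM => //; exact: cvg_cst.
Qed.

(** The weak maximum principle. *)
Lemma supersolution_ge0 w : V w ->
  (forall psi, V psi -> aeD (fun x => 0 <= psi x) -> 0 <= a w psi) ->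
  aeD (fun x => 0 <= w x).
Proof.
move=> Vw H; have Vn := formN_in F Vw.
have Vp := df_pos_in Vn.
have : aeD (fun x => pos (fun y => - w y) x = 0).
  apply: df_eq0 => //; apply: (le_trans (df_pos_le Vn)).
  rewrite (formN F Vw Vp) oppr_le0; apply: H => //.
  by apply: aeW => x _; exact: pos_ge0.
apply: filterS => x /[apply] p0.
have := pos_sub_opp (fun y => - w y) x; rewrite p0.
have := pos_ge0 (fun y => - - w y) x; lra.
Qed.

(** The torsion function, by Poincare's inequality. *)
Lemma torsion_exists : exists2 e, V e & forall psi, V psi -> a e psi = I psi.
Proof.
have [C C0 CP] := df_poincare Fd.
have lV w : V w -> L1 mu D w by move=> Vw; exact: (L2_L1 mD muD (df_L2 Fd Vw)).
apply: (riesz F (df_complete Fd) (C := (fine (mu D) + 1) * C)).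
- by move=> u w Vu Vw; rewrite (I_D mD (lV _ Vu) (lV _ Vw)).
- by move=> c u Vu; rewrite (I_Z mD c (lV _ Vu)).
move=> u Vu; set m := fine (mu D).
have m0 : 0 <= m by exact: fine_ge0.
have lu := df_L2 Fd Vu.
have H c : 2 * c * I u <= I (fun x => u x ^+ 2) + c ^+ 2 * m.
  rewrite -(Rintegral_cst mu mD) -(I_Z mD (2 * c) (lV _ Vu)).
  rewrite -(I_D mD lu.2 (L1_cst mD muD _)).
  apply: (I_le mD (L1Z mD _ (lV _ Vu)) (L1D mD lu.2 (L1_cst mD muD _))).
  by apply: aeW => x _; have := sqr_ge0 (u x - c); rewrite sqrrB mulr2n; lra.
have m1 : 0 < m + 1 by rewrite ltr_wpDl.
have := H (I u / (m + 1)); rewrite -mulrA => h.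
have CPu := CP _ Vu; move: (I (fun x => u x ^+ 2)) (I u) h CPu => q p h CPu.
have -> : p ^+ 2 = (m + 1) * (2 * (p / (m + 1) * p) - (p / (m + 1)) ^+ 2 * (m + 1)).
  by field; exact: lt0r_neq0.
rewrite -[leRHS]mulrA ler_pM2l//; have := sqr_ge0 (p / (m + 1)); lra.
Qed.

End dirichlet_form.

(** * The strong maximum principle *)

Section maximum_principle.
Context (R : realType) (d : nat) (Om : set 'rV[R]_d) (A : 'rV[R]_d -> 'M[R]_d)
  (alpha beta : R).
Local Notation E := 'rV[R]_d.
Local Notation mu := (lebesgue_rV R d).
Hypotheses (oO : open Om) (bO : bounded_set Om) (cO : connected Om).
Hypotheses (alpha_gt0 : 0 < alpha) (HA : elliptic_field Om alpha beta A).
Variable i0 : 'I_d.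
Local Notation I f := (Rintegral mu Om f).
Local Notation L1O := (L1 mu Om).
Local Notation L2O := (L2 mu Om).
Local Notation aeO P := {ae mu, forall x, Om x -> P x}.
Local Notation V := (H10 Om).
Local Notation a := (energy Om A).
Implicit Types (u w phi : E -> R).

Let mO : measurable Om. Proof. exact: open_measurable_rV. Qed.
Lemma energy_dirichlet_form : dirichlet_form mu Om V a.
Proof.
split.
- exact: (energy_form oO bO alpha_gt0 HA).
- by move=> w Vw; exact: (H10_L2 oO bO Vw).
- exact: (H10_complete oO bO alpha_gt0 HA i0).
- exact: (poincare_energy oO bO alpha_gt0 HA i0).
- exact: (H10_abs oO bO alpha_gt0 HA i0).
Qed.
Let Fd := energy_dirichlet_form.
Let F := df_psd Fd.

Lemma L2_ext0 w : (forall x, ~ Om x -> w x = 0) -> L2O w -> L2 mu setT w.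
Proof.
move=> w0 [mw lw]; split.
  by rewrite -(restrict_zero w0); exact: ((measurable_restrictT _ mO).1 mw).
by apply/(L1_setT mO) => // x /w0 ->; rewrite expr0n.
Qed.

Lemma shift_le_H10 w : V w -> (forall x, ~ Om x -> w x = 0) ->
  exists C, forall h, Rintegral mu setT (fun x => (w (x + h) - w x) ^+ 2) <= C * `|h| ^+ 2.
Proof.
move=> Vw w0; have [lw lG approx] := H10_strong_grad oO bO Vw.
have lwT := L2_ext0 w0 lw.
pose K := \sum_i (2 + 2 * I (fun x => grad Om w x ord0 i ^+ 2)).
exists (2 * (d%:R * K)) => h; apply/ler_addgt0Pr => e e0.
have e8 : 0 < Num.min (e / 8) 1 by rewrite lt_min ltr01 divr_gt0.
have [phi tphi [phiw phiG]] := approx _ e8.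
have cphi := test_C1c tphi; have lphi := C1c_L2 cphi.
have ldiff := L2B measurableT lwT lphi.
have dist0 x : ~ Om x -> w x - phi x = 0.
  by move=> nO; rewrite w0// (test_supp0 tphi nO) subrr.
have dE : Rintegral mu setT (fun x => (w x - phi x) ^+ 2) <= e / 8.
  rewrite -(I_setT (Om := Om)); last by move=> x /dist0 ->; rewrite expr0n.
  have -> : (fun x => (w x - phi x) ^+ 2) = (fun x => (phi x - w x) ^+ 2).
    by apply/funext => x; ring.
  by apply: (le_trans phiw); rewrite ge_min lexx.
have gK : grad_sqr phi <= K.
  apply: ler_sum => i _.
  rewrite -(I_setT (Om := Om)); last first.
    by move=> x nO; rewrite (test_partial_supp0 i tphi nO) expr0n.
  have lp := test_partial_L2 mO i tphi.
  have := I_sqrD mO (L2B mO lp (lG i)) (lG i).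
  under eq_Rintegral do rewrite subrK.
  move=> /le_trans; apply; rewrite lerD2r -[leRHS]mulr1 ler_pM2l//.
  by apply: (le_trans (phiG i)); rewrite ge_min lexx orbT.
have s1 := shift_le h cphi.
have lsw := L2_shift h ldiff.
have := I_sqrD measurableT (L2B measurableT (L2_shift h lphi) lphi)
                           (L2B measurableT lsw ldiff).
have -> : (fun x => (phi (x + h) - phi x + (w (x + h) - phi (x + h) - (w x - phi x))) ^+ 2)
    = (fun x => (w (x + h) - w x) ^+ 2) by apply/funext => x; ring.
have s2 := I_sqrD measurableT lsw (L2N measurableT ldiff).
have s3 := I_shift h ldiff.2.
move: s2; under [X in _ <= _ + 2 * X -> _]eq_Rintegral do rewrite sqrrN.
rewrite s3 => s2 s4.
have s5 : d%:R * `|h| ^+ 2 * grad_sqr phi <= d%:R * `|h| ^+ 2 * K.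
  by rewrite ler_wpM2l// mulr_ge0// sqr_ge0.
have -> : 2 * (d%:R * K) * `|h| ^+ 2 = 2 * (d%:R * `|h| ^+ 2 * K) by ring.
lra.
Qed.

(** The capped multiples [pos (phi - n w)] have bounded energy and decrease to
    [phi] restricted to the zero set of [w]. *)
Lemma H10_zero_set w phi C : V w -> aeO (fun x => 0 <= w x) ->
  test_function Om phi -> (forall x, 0 <= phi x) ->
  (forall n : nat, - C <= n.+1%:R * a w (pos (fun x => phi x - n.+1%:R * w x))) ->
  V (fun x => phi x * \1_(Om `&` [set x | w x <= 0]) x).
Proof.
move=> Vw w0 tphi phi0 HC; have Vphi := H10_test oO bO tphi.
have lw := H10_L2 oO bO Vw; have lphi := test_L2 mO tphi.
set Z := Om `&` _.
have mZ : measurable Z.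
  have -> : Z = Om `&` w @^-1` `]-oo, 0].
    by rewrite /Z; congr (_ `&` _); apply/funext => x; rewrite /= in_itv.
  by apply: lw.1 => //; exact: measurable_itv.
pose zeta n := pos (fun x => phi x - n.+1%:R * w x).
have Vd n : V (fun x => phi x - n.+1%:R * w x).
  exact: (formB_in F Vphi (formZ_in F _ Vw)).
have Vz n : V (zeta n) by exact: (df_pos_in Fd (Vd n)).
have lz n := H10_L2 oO bO (Vz n).
have zM n : a (zeta n) (zeta n) <= a phi phi + 2 * C.
  have h1 := df_pos_le Fd (Vd n); have h2 := HC n.
  have := form_young F Vphi (Vz n).
  move: h1 h2; rewrite -/(zeta n) (formB F Vphi (formZ_in F _ Vw) (Vz n)).
  rewrite (formZ F _ Vw (Vz n)).
  move: (a (zeta n) (zeta n)) (a phi (zeta n)) (n.+1%:R * _) (a phi phi) => p q r s.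
  lra.
have lpZ : L2O (fun x => phi x * \1_Z x).
  apply: (L2_dom mO _ lphi).
    by apply: measurable_funM; [exact: lphi.1|apply: measurable_funTS; exact: measurable_indic].
  apply: aeW => x _; rewrite normrM ler_piMr// indicE.
  by case: (_ \in _); rewrite /= ?normr1 ?normr0.
have cv : (fun n => I (fun x => (zeta n x - phi x * \1_Z x) ^+ 2)) @ \oo --> (0 : R).
  have [_] : L1O (fun=> 0) /\ (fun n => I (fun x => (zeta n x - phi x * \1_Z x) ^+ 2)) @ \oo
      --> I (fun=> 0).
    apply: (dominated_L1 mO (g := fun x => phi x ^+ 2)) => //.
    - by move=> n; apply: measurable_funX; exact: (L2B mO (lz n) lpZ).1.
    - exact: lphi.2.
    - move=> n; apply: filterS w0 => x /[apply] wx.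
      have nw : 0 <= n.+1%:R * w x by rewrite mulr_ge0.
      have z0 := pos_ge0 (fun x => phi x - n.+1%:R * w x) x.
      have z1 : zeta n x <= phi x by rewrite /zeta /pos ge_max phi0 lerBlDr lerDl.
      have z2 : 0 <= phi x * \1_Z x <= phi x.
        rewrite indicE; case: (_ \in _); rewrite /= ?mulr1 ?mulr0 ?lexx ?phi0//.
      case/andP: z2 => z2 z3; rewrite ger0_norm ?sqr_ge0//.
      rewrite -(real_normK (num_real (zeta n x - _))) lerXn2r ?nnegrE// ler_norml.
      by rewrite -/(zeta n x) in z0; apply/andP; split; lra.
    - apply: filterS w0 => x + Ox => /(_ Ox) wx.
      rewrite le_eqVlt in wx; case/predU1P: wx => wx.
        apply: (@eq_cvg_to _ (fun=> 0) _ 0) => // n; last exact: cvg_cst.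
        rewrite indicE mem_set; last by split=> //=; rewrite -wx.
        by rewrite /zeta /pos -wx mulr0 subr0 mulr1 max_r// subrr expr0n.
      apply: cvg_near_cst.
      have [N NP] : exists N, forall n, (N <= n)%N -> phi x <= n.+1%:R * w x.
        exists (Num.truncn (phi x / w x)) => n Nn.
        rewrite -ler_pdivrMr//; apply: (le_trans (ltW (truncnS_gt _))).
        by rewrite ler_nat ltnS.
      exists N => // n /= Nn; rewrite indicE memNset; last first.
        by move=> [_ /=]; rewrite leNgt wx.
      by rewrite mulr0 subr0 /zeta /pos max_l ?expr0n// subr_le0 NP.
  by rewrite I_0.
have [z [Vz' zZ _]] := H10_lsc oO bO alpha_gt0 HA i0 Vz lpZ zM cv.
exact: (H10_ae oO bO Vz' lpZ.1 zZ).
Qed.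

Lemma bump_lower (x0 : E) (r : R) (x : E) : 0 < r -> ball x0 r x ->
  flat 0 r ^+ 2 ^+ d <= bump 1 (x0 - const_mx (2 * r)) (x0 + const_mx (2 * r)) x.
Proof.
move=> r0; rewrite ball_box// => xb.
rewrite /bump -[X in _ ^+ X]card_ord -prodr_const; apply: ler_prod => i _.
have := xb i; rewrite /= in_itv/= /rV_coord !mxE => /andP[h1 h2].
have mono (s t : R) : 0 < s -> s <= t -> flat 0 s <= flat 0 t.
  move=> s0 st; have t0 := lt_le_trans s0 st.
  rewrite /flat s0 t0 !expr0 !mul1r ler_expR lerN2 lef_pV2 ?posrE//.
rewrite sqr_ge0/= expr2; apply: ler_pM; rewrite ?flat_ge0//; apply: mono => //; lra.
Qed.

(** The zero set [Z] of [w] is locally constant, as [phi] times the indicator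
    function of [Z] belongs to the space for all test functions [phi]: near a
    point where [phi] is bounded below, the translates of this product control
    those of the indicator function. *)
Lemma strong_maximum_principle w : V w -> aeO (fun x => 0 <= w x) ->
  (forall phi, test_function Om phi -> (forall x, 0 <= phi x <= 1) ->
   exists C, forall n : nat,
     - C <= n.+1%:R * a w (pos (fun x => phi x - n.+1%:R * w x))) ->
  aeO (fun x => w x = 0) \/ aeO (fun x => 0 < w x).
Proof.
move=> Vw w0 H; have lw := H10_L2 oO bO Vw.
pose Z := Om `&` [set x | w x <= 0].
have mZ : measurable Z.
  have -> : Z = Om `&` w @^-1` `]-oo, 0].
    by rewrite /Z; congr (_ `&` _); apply/funext => x; rewrite /= in_itv.
  by apply: lw.1 => //; exact: measurable_itv.
have local x0 : Om x0 -> exists2 r, 0 < r & ball x0 r `<=` Om /\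
    ({ae mu, forall x, ball x0 r x -> Z x} \/ {ae mu, forall x, ball x0 r x -> ~ Z x}).
  move=> Ox0.
  have [c /= c0 cOm] : nbhs_ball x0 Om by apply/nbhs_ballP; exact: open_nbhs_nbhs.
  pose r := c / 4; have r0 : 0 < r by rewrite divr_gt0.
  pose aa := x0 - const_mx (2 * r); pose bb := x0 + const_mx (2 * r).
  pose phi := bump 1 aa bb.
  have cb : cbox aa bb `<=` Om.
    move=> y yb; apply: cOm; rewrite ball_box// => i.
    have := yb i; rewrite /= in_itv/= /rV_coord !mxE /r => /andP[? ?].
    by apply/andP; split; lra.
  have tphi : test_function Om phi by exact: bump_test.
  have [C HC] := H phi tphi (ltac:(by move=> x; rewrite bump_ge0 bump_le1)).
  have VZ := H10_zero_set Vw w0 tphi (bump_ge0 1 aa bb) HC.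
  have Z0 x : ~ Om x -> phi x * \1_Z x = 0.
    by move=> nO; rewrite (test_supp0 tphi nO) mul0r.
  have [C1 H1] := shift_le_H10 VZ Z0.
  have [C2 H2] := shift_le_H10 (H10_test oO bO tphi) (fun x => test_supp0 tphi).
  pose q := flat 0 (r : R) ^+ 2 ^+ d.
  have q0 : 0 < q.
    by rewrite /q !exprn_gt0// /flat r0 expr0 mul1r expR_gt0.
  have r2 : 0 < r / 2 by rewrite divr_gt0.
  have mB e : measurable (ball x0 e) by exact: measurable_ball.
  have key h : `|h| < r / 2 ->
      Rintegral mu setT (fun x => \1_(ball x0 (r / 2)) x * `|\1_Z (x + h) - \1_Z x|)
      <= (2 * C1 + 2 * C2) / q ^+ 2 * `|h| ^+ 2.
    move=> hr.
    have lphi := C1c_L2 (test_C1c tphi).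
    have lphZ : L2 mu setT (fun x => phi x * \1_Z x) by exact: (L2_ext0 Z0 (H10_L2 oO bO VZ)).
    have la := L2B measurableT (L2_shift h lphZ) lphZ.
    have lb := L2B measurableT (L2_shift h lphi) lphi.
    have m1 : measurable_fun setT (fun x : E => `|\1_Z (x + h) - \1_Z x| : R).
      apply: measurableT_comp => //; apply: measurable_funB; last exact: measurable_indic.
      by apply: (measurableT_comp (measurable_indic _)) => //; exact: measurable_shift.
    have b1 x : `| `|\1_Z (x + h) - \1_Z x| : R| <= 1.
      rewrite normr_id !indicE; case: (_ \in _); case: (_ \in _) => /=;
      by rewrite ?subrr ?subr0 ?sub0r ?normrN ?normr0 ?normr1.
    have lq := L1_indic_supp (mB (r / 2)) (@subset_refl _ _) m1 b1.
    rewrite [leRHS]mulrAC ler_pdivlMr; last exact: exprn_gt0.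
    rewrite mulrC -(I_Z measurableT _ lq).
    apply: (@le_trans _ _ (Rintegral mu setT (fun x =>
       2 * (phi (x + h) * \1_Z (x + h) - phi x * \1_Z x) ^+ 2 +
       2 * (phi (x + h) - phi x) ^+ 2))).
      apply: I_le => //.
      - exact: L1Z.
      - apply: L1D => //; [exact: (L1Z measurableT _ la.2)|exact: (L1Z measurableT _ lb.2)].
      apply: aeW => x _.
      set rhs := (X in _ <= X).
      have rhs0 : 0 <= rhs by rewrite addr_ge0// mulr_ge0// sqr_ge0.
      rewrite [\1_(ball _ _) x]indicE.
      have [/set_mem Bx|_] := boolP (x \in (ball x0 (r / 2) : set E)); last first.
        by rewrite mul0r mulr0.
      rewrite mul1r.
      have Bxh : ball x0 r (x + h).
        move: Bx; rewrite -!ball_normE /= opprD addrA => Bx.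
        by apply: (le_lt_trans (ler_normB _ _)); lra.
      have phq : q <= phi (x + h) by exact: bump_lower.
      have sq : `|\1_Z (x + h) - \1_Z x : R| = (\1_Z (x + h) - \1_Z x) ^+ 2.
        rewrite !indicE; case: (_ \in _); case: (_ \in _) => /=;
        by rewrite ?subrr ?subr0 ?sub0r ?normrN ?sqrrN ?normr0 ?normr1 ?expr1n ?expr0n.
      rewrite sq.
      apply: (@le_trans _ _ (phi (x + h) ^+ 2 * (\1_Z (x + h) - \1_Z x) ^+ 2)).
        by apply: ler_wpM2r; rewrite ?sqr_ge0// lerXn2r ?nnegrE// ltW// (lt_le_trans q0).
      have z01 : \1_Z x ^+ 2 <= 1 :> R.
        by rewrite indicE; case: (_ \in _); rewrite /= ?expr1n ?expr0n.
      rewrite /rhs; move: (phi (x + h)) (phi x) (\1_Z (x + h) : R) (\1_Z x : R) z01.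
      move=> p s zh z z1.
      have := sqr_ge0 ((p * zh - s * z) + (p - s) * z).
      have : 0 <= (p - s) ^+ 2 * (1 - z ^+ 2) by rewrite mulr_ge0 ?sqr_ge0// subr_ge0.
      lra.
    rewrite I_D//; last 2 first.
      exact: (L1Z measurableT _ la.2).
      exact: (L1Z measurableT _ lb.2).
    rewrite (I_Z measurableT _ la.2) (I_Z measurableT _ lb.2).
    by have := H1 h; have := H2 h; lra.
  have inv := shift_invariant_set mZ r2 key.
  have r4 : 0 < r / 2 / 2 by rewrite divr_gt0.
  exists (r / 2 / 2 / 2); first by rewrite divr_gt0.
  split; first by apply: subset_trans cOm; apply: le_ball; rewrite /r; lra.
  exact: locally_constant_set mZ r4 inv.
pose isZ (x0 : E) := exists2 r, 0 < r & ball x0 r `<=` Om /\ {ae mu, forall x, ball x0 r x -> Z x}.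
pose isN (x0 : E) := exists2 r, 0 < r & ball x0 r `<=` Om /\ {ae mu, forall x, ball x0 r x -> ~ Z x}.
have cover x0 : Om x0 -> isZ x0 \/ isN x0.
  by move=> /local[r r0 [rO [h|h]]]; [left|right]; exists r.
have subball (x0 : E) r y : ball x0 r y -> exists2 s, 0 < s & ball y s `<=` ball x0 r.
  move=> xy; have : nbhs y (ball x0 r) by apply: open_nbhs_nbhs; split => //; exact: ball_open.
  by move=> /nbhs_ballP[s /= s0 sb]; exists s.
have openZ : open isZ.
  rewrite openE => x0 [r r0 [rO h]]; apply/nbhs_ballP; exists r => // y xy.
  have [s s0 sr] := subball _ _ _ xy; exists s => //; split; first exact: subset_trans sr rO.
  by apply: filterS h => z + /sr; apply.
have openN : open isN.
  rewrite openE => x0 [r r0 [rO h]]; apply/nbhs_ballP; exists r => // y xy.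
  have [s s0 sr] := subball _ _ _ xy; exists s => //; split; first exact: subset_trans sr rO.
  by apply: filterS h => z + /sr; apply.
have disj x0 : isZ x0 -> isN x0 -> False.
  move=> [r r0 [_ h1]] [s s0 [_ h2]].
  have rs : 0 < Num.min r s by rewrite lt_min r0 s0.
  have [x _ []] : exists2 x, ball x0 (Num.min r s) x & False.
    apply: ae_open_ex; [exact: ball_open|by exists x0; exact: ballxx|].
    apply: filterS2 h1 h2 => x + + xb.
    have xr : ball x0 r x by apply: le_ball xb; rewrite ge_min lexx.
    have xs : ball x0 s x by apply: le_ball xb; rewrite ge_min lexx orbT.
    by move=> /(_ xr) zx /(_ xs).
have isZO x : isZ x -> Om x by move=> [r r0 [rO _]]; apply: rO; exact: ballxx.
have isNO x : isN x -> Om x by move=> [r r0 [rO _]]; apply: rO; exact: ballxx.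
have [[x1 Zx1]|noZ] := pselect (exists x, isZ x); [left|right].
  have ZE : isZ = Om.
    apply: cO; first by exists x1.
      by exists isZ => //; apply/seteqP; split=> x; [move=> Zx; split => //; exact: isZO|case].
    exists (~` isN); first exact: open_closedC.
    apply/seteqP; split=> x; first by move=> Zx; split; [exact: isZO|move=> /(disj _ Zx)].
    by move=> [/cover[//|Nx]] /(_ Nx).
  apply: ae_local => x; rewrite -ZE => -[r r0 [rO h]]; exists (ball x r).
    exact: nbhsx_ballx.
  apply: filterS2 w0 h => y + + yb => /(_ (rO _ yb)) wy /(_ yb) [_ /= wy'].
  by apply/eqP; rewrite eq_le wy wy'.
apply: ae_local => x /[dup] Ox /cover[Zx|[r r0 [rO h]]]; first by exfalso; apply: noZ; exists x.
exists (ball x r); first exact: nbhsx_ballx.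
apply: filterS h => y + yb => /(_ yb) nZ; rewrite ltNge; apply/negP => wy.
by apply: nZ; split=> //; exact: rO.
Qed.

End maximum_principle.

(** * Real powers *)

Section powers.
Context (R : realType).
Implicit Types (a b s t q x : R).

(** The weighted inequality between the arithmetic and geometric means, from
    [1 + y <= expR y]. *)
Lemma powR_le_tangent1 s x : 0 < s <= 1 -> 0 <= x -> x `^ s <= s * x + (1 - s).
Proof.
move=> /andP[s0 s1]; rewrite le_eqVlt => /predU1P[<-|x0].
  by rewrite powR0 ?gt_eqF// mulr0 add0r subr_ge0.
rewrite /powR gt_eqF//; set l := ln x.
have -> : x = expR (s * l) * expR ((1 - s) * l).
  by rewrite -expRD -mulrDl addrC subrK mul1r lnK.
have -> : s * (expR (s * l) * expR ((1 - s) * l)) + (1 - s) =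
    expR (s * l) * (s * expR ((1 - s) * l) + (1 - s) * expR (- (s * l))).
  rewrite mulrDr mulrA [s * _]mulrC -mulrA; congr (_ + _).
  by rewrite mulrCA -expRD subrr expR0 mulr1.
rewrite -[leLHS]mulr1 ler_wpM2l ?expR_ge0//.
have h1 := expR_ge1Dx ((1 - s) * l); have h2 := expR_ge1Dx (- (s * l)).
have h3 : s * (1 + (1 - s) * l) <= s * expR ((1 - s) * l) by rewrite ler_pM2l.
have h4 : (1 - s) * (1 + - (s * l)) <= (1 - s) * expR (- (s * l)).
  by rewrite ler_wpM2l// subr_ge0.
by apply: le_trans (lerD h3 h4); rewrite le_eqVlt; apply/orP; left; apply/eqP; ring.
Qed.

Lemma powRB1 a q : 0 < a -> a `^ (q - 1) = a `^ q / a.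
Proof.
move=> a0; rewrite powRB; last by rewrite (gt_eqF a0) implybT.
by rewrite powRr1// ltW.
Qed.

Lemma powR_concave_tangent s a b : 0 < s <= 1 -> 0 < a -> 0 <= b ->
  b `^ s <= a `^ s + s * a `^ (s - 1) * (b - a).
Proof.
move=> s01 a0 b0; have x0 : 0 <= b / a by rewrite divr_ge0// ltW.
have -> : b `^ s = a `^ s * (b / a) `^ s.
  by rewrite -(powRM _ (ltW a0) x0) mulrC divfK// gt_eqF.
have -> : a `^ s + s * a `^ (s - 1) * (b - a) = a `^ s * (s * (b / a) + (1 - s)).
  by rewrite powRB1//; field; exact: lt0r_neq0.
by rewrite ler_wpM2l ?powR_ge0// powR_le_tangent1.
Qed.

Lemma powR_convex_tangent q a b : 1 < q -> 0 <= a -> 0 <= b ->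
  a `^ q + q * a `^ (q - 1) * (b - a) <= b `^ q.
Proof.
move=> q1; have q0 : 0 < q by exact: lt_trans q1.
rewrite le_eqVlt => /predU1P[<- b0|a0 b0].
  by rewrite !powR0 ?gt_eqF ?subr_gt0// mulr0 mul0r addr0 powR_ge0.
have x0 : 0 <= b / a by rewrite divr_ge0// ltW.
have -> : b `^ q = a `^ q * (b / a) `^ q.
  by rewrite -(powRM _ (ltW a0) x0) mulrC divfK// gt_eqF.
have -> : a `^ q + q * a `^ (q - 1) * (b - a) = a `^ q * (q * (b / a) + (1 - q)).
  by rewrite powRB1//; field; exact: lt0r_neq0.
rewrite ler_wpM2l ?powR_ge0//.
have qi : 0 < q^-1 <= 1 by rewrite invr_gt0 q0 invf_le1// ltW.
have := powR_le_tangent1 qi (powR_ge0 (b / a) q).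
rewrite -powRrM mulfV ?gt_eqF// powRr1// => h.
have : q * (b / a) <= q * (q^-1 * (b / a) `^ q + (1 - q^-1)) by rewrite ler_pM2l.
have -> : q * (q^-1 * (b / a) `^ q + (1 - q^-1)) = (b / a) `^ q + (q - 1).
  by field; exact: lt0r_neq0.
lra.
Qed.

Lemma powR_convex q t a b : 1 < q -> 0 <= t <= 1 -> 0 <= a -> 0 <= b ->
  ((1 - t) * a + t * b) `^ q <= (1 - t) * a `^ q + t * b `^ q.
Proof.
move=> q1 /andP[t0 t1] a0 b0; have t1' : 0 <= 1 - t by rewrite subr_ge0.
set c := _ + _; have c0 : 0 <= c by rewrite addr_ge0// mulr_ge0.
have h1 := ler_wpM2l t1' (powR_convex_tangent q1 c0 a0).
have h2 := ler_wpM2l t0 (powR_convex_tangent q1 c0 b0).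
apply: le_trans (lerD h1 h2); rewrite le_eqVlt; apply/orP; left; apply/eqP.
by rewrite /c; ring.
Qed.

Lemma powR_concave_diff s a b : 0 < s <= 1 -> 0 <= a -> 0 <= b ->
  s * ((a + b) `^ (s - 1) * b) <= (a + b) `^ s - a `^ s.
Proof.
move=> s01 a0; rewrite le_eqVlt => /predU1P[<-|b0].
  by rewrite addr0 !mulr0 subrr.
have ab0 : 0 < a + b by rewrite ltr_wpDl.
have := powR_concave_tangent s01 ab0 a0.
have -> : a - (a + b) = - b by ring.
by rewrite mulrN -mulrA; lra.
Qed.

Lemma powR_convex_diff q a b : 1 < q -> 0 <= a -> 0 <= b ->
  (a + b) `^ q - a `^ q <= q * ((a + b) `^ (q - 1) * b).
Proof.
move=> q1 a0 b0; have := powR_convex_tangent q1 (addr_ge0 a0 b0) a0.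
have -> : a - (a + b) = - b by ring.
by rewrite mulrN -mulrA; lra.
Qed.

Lemma powR_concave_mid s a b : 0 < s <= 1 -> 0 <= a -> 0 <= b ->
  2^-1 * (a `^ s + b `^ s) <= (2^-1 * (a + b)) `^ s.
Proof.
move=> s01 a0 b0; have /andP[s0 _] := s01.
set c := 2^-1 * (a + b); have : 0 <= c by rewrite mulr_ge0// addr_ge0.
rewrite le_eqVlt => /predU1P[c0|c0].
  have -> : a = 0 by apply/eqP; rewrite eq_le a0 andbT; move: c0; rewrite /c; lra.
  have -> : b = 0 by apply/eqP; rewrite eq_le b0 andbT; move: c0; rewrite /c; lra.
  by rewrite powR0 ?gt_eqF// addr0 mulr0 powR_ge0.
have h1 := powR_concave_tangent s01 c0 a0; have h2 := powR_concave_tangent s01 c0 b0.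
have : s * c `^ (s - 1) * (a - c) + s * c `^ (s - 1) * (b - c) = 0 by rewrite /c; field.
lra.
Qed.

Lemma powR_le1 q a : 0 <= q -> 0 <= a <= 1 -> a `^ q <= 1.
Proof.
move=> q0 /andP[a0 a1]; have <- : 1 `^ q = 1 :> R by rewrite powR1.
by apply: ge0_ler_powR; rewrite ?nnegrE.
Qed.

Lemma powR_add_le q a b : 0 <= q -> 0 <= a -> 0 <= b ->
  (a + b) `^ q <= 2 `^ q * (a `^ q + b `^ q).
Proof.
move=> q0; wlog ab : a b / a <= b.
  move=> H a0 b0; case: (leP a b) => ab; first exact: H.
  by rewrite addrC [X in _ * X]addrC; apply: H => //; exact: ltW.
move=> a0 b0; apply: (@le_trans _ _ ((2 * b) `^ q)).
  by apply: ge0_ler_powR; rewrite ?nnegrE ?addr_ge0 ?mulr_ge0//; lra.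
by rewrite powRM// ler_wpM2l ?powR_ge0// lerDr powR_ge0.
Qed.

Lemma powR_cvg_pos q (x_ : nat -> R) x : 0 < x -> x_ @ \oo --> x ->
  (fun n => x_ n `^ q) @ \oo --> x `^ q.
Proof.
move=> x0; apply: (@continuous_cvg _ _ _ _ _ x_ (fun y => y `^ q) x).
apply: differentiable_continuous; apply/derivable1_diffP.
by apply: derivable_powR; rewrite in_itv/= x0.
Qed.

Lemma powR_cvg q (x_ : nat -> R) x : 0 < q -> (forall n, 0 <= x_ n) ->
  x_ @ \oo --> x -> (fun n => x_ n `^ q) @ \oo --> x `^ q.
Proof.
move=> q0 x_0 cx; have : 0 <= x by apply: (cvgr_to_ge cx); exact: nearW.
rewrite le_eqVlt => /predU1P[x0|x0]; last exact: powR_cvg_pos.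
rewrite -x0 powR0 ?gt_eqF//; apply/cvgr0Pnorm_le => e e0.
rewrite -x0 in cx.
have e1 : 0 < e `^ q^-1 by exact: powR_gt0.
have [N _ NP] := cvgr_le _ cx _ e1; exists N => // n /= Nn.
rewrite ger0_norm ?powR_ge0//.
have -> : e = (e `^ q^-1) `^ q by rewrite -powRrM mulVf ?gt_eqF// powRr1// ltW.
by apply: ge0_ler_powR; rewrite ?nnegrE ?powR_ge0//; [exact: ltW|exact: NP].
Qed.

(** Two cases, according to whether [c] exceeds [delta * t `^ (r + g)]. *)
Lemma powR_absorb (r g delta c t : R) : 0 < r -> 0 < g < 1 -> 0 < delta ->
  0 <= c -> 0 <= t ->
  c * t `^ (1 - g) <= delta * (t `^ r * t) +
    delta^-1 `^ ((1 - g) / (r + g)) * c `^ ((r + 1) / (r + g)).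
Proof.
move=> r0 /andP[g0 g1] d0 c0; have rg : 0 < r + g by rewrite addr_gt0.
have g1' : 0 < 1 - g by rewrite subr_gt0.
rewrite le_eqVlt => /predU1P[<-|t0].
  by rewrite powR0 ?gt_eqF// !mulr0 add0r mulr_ge0 ?powR_ge0.
have [h|h] := leP c (delta * t `^ (r + g)).
  rewrite -[leLHS]addr0 lerD ?mulr_ge0 ?powR_ge0//.
  apply: (le_trans (ler_wpM2r (powR_ge0 _ _) h)).
  rewrite -mulrA -powRD; last by rewrite (gt_eqF t0) implybT.
  rewrite -[X in _ * (_ * X)](powRr1 (ltW t0)) -powRD; last by rewrite (gt_eqF t0) implybT.
  by rewrite (_ : r + g + (1 - g) = r + 1)//; ring.
rewrite -[leLHS]add0r; apply: lerD; first exact: (mulr_ge0 (ltW d0) (mulr_ge0 (powR_ge0 _ _) (ltW t0))).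
have c0' : 0 < c by apply: le_lt_trans h; rewrite mulr_ge0 ?powR_ge0// ltW.
have ht : t `^ (r + g) <= delta^-1 * c by rewrite ler_pdivlMl// ltW.
have -> : t `^ (1 - g) = (t `^ (r + g)) `^ ((1 - g) / (r + g)).
  by rewrite -powRrM mulrCA mulfV ?mulr1// gt_eqF.
have -> : (r + 1) / (r + g) = 1 + (1 - g) / (r + g) by field; exact: lt0r_neq0.
rewrite (@powRD _ c); last by rewrite (gt_eqF c0') implybT.
rewrite (powRr1 (ltW c0')) [leRHS]mulrCA ler_wpM2l//.
have di0 : 0 <= delta^-1 by rewrite invr_ge0 ltW.
rewrite -(powRM _ di0 c0).
apply: ge0_ler_powR => //; rewrite ?nnegrE ?powR_ge0//; last exact: mulr_ge0.
by apply: divr_ge0; exact: ltW.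
Qed.

End powers.

(** * The constrained variational problem *)

Section minimiser.
Context dd (T : measurableType dd) (R : realType).
Variables (mu : {measure set T -> \bar R}) (D : set T).
Hypotheses (mD : measurable D) (muD : (mu D < +oo)%E).
Context (V : set (T -> R)) (a : (T -> R) -> (T -> R) -> R).
Hypothesis Fd : dirichlet_form mu D V a.
Variables (r gamma : R) (f : T -> R).
Hypotheses (r2 : 2 <= r) (g01 : 0 < gamma < 1).
Local Notation I g := (Rintegral mu D g).
Local Notation L1mu := (L1 mu D).
Local Notation aeD P := {ae mu, forall x, D x -> P x}.
Local Notation s := (1 - gamma).
Hypotheses (mf : measurable_fun D f) (f0 : aeD (fun x => 0 <= f x)).
Hypothesis f_absorb : forall delta : R, 0 < delta -> exists2 h, L1mu h &
  aeD (fun x => forall t : R, 0 <= t -> f x * t `^ s <= delta * (t `^ r * t) + h x).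
Implicit Types (u v w phi psi : T -> R).
Let F := df_psd Fd.
Let r1 : 1 < r. Proof. by move: r2; lra. Qed.
Let r0 : 0 < r. Proof. by move: r2; lra. Qed.
Let s01 : 0 < s <= 1. Proof. by move: g01; lra. Qed.
Let s0 : 0 < s. Proof. by case/andP: s01. Qed.
Let mV w : V w -> measurable_fun D w. Proof. by move=> /(df_L2 Fd)[]. Qed.
Let mP q w : measurable_fun D w -> measurable_fun D (fun x => w x `^ q).
Proof. exact: measurableT_comp (measurable_powR q). Qed.

(** The pairs [(u, v)] with [v] a supersolution of the second equation.  In
    contrast to its solutions, these form a convex set, because [r] exceeds 1. *)
Definition sub_pair u v : Prop := [/\ V u, V v, aeD (fun x => 0 <= u x) &
  forall psi, V psi -> aeD (fun x => 0 <= psi x) ->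
    L1mu (fun x => u x `^ r * psi x) /\ I (fun x => u x `^ r * psi x) <= a v psi].

(** With the factor [1 / r] in front of the energy of [v], the constraint has [v]
    itself, up to that factor, as its Lagrange multiplier; this produces the
    coupling term [v * u `^ (r - 1)]. *)
Definition functional u v : R :=
  2^-1 * a u u + (2 * r)^-1 * a v v - s^-1 * I (fun x => f x * u x `^ s).

Lemma sub_pair_L1 u v psi : sub_pair u v -> V psi -> L1mu (fun x => u x `^ r * psi x).
Proof.
move=> [Vu Vv u0 H] Vp; have [Va _] := df_abs Fd Vp.
have [l _] := H _ Va (ltac:(by apply: aeW => x _; exact: normr_ge0)).
apply: (L1_dom mD _ l).
  by apply: measurable_funM; [exact: mP (mV Vu)|exact: mV].
by apply: aeW => x _; rewrite normrM ger0_norm ?powR_ge0.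
Qed.

Lemma sub_pair0 : sub_pair (fun=> 0) (fun=> 0).
Proof.
have V0 := form0_in F.
have E psi : (fun x => 0 `^ r * psi x) = (fun=> 0 : R) :> (T -> R).
  by apply/funext => x; rewrite powR0 ?mul0r// gt_eqF.
split=> //; first by apply: aeW => x _.
move=> psi Vp _; rewrite E; split; first exact: L1_0.
have -> : a (fun=> 0) psi = 0.
  by have := formZ F 0 V0 Vp; rewrite /= !mul0r.
by rewrite I_0.
Qed.

Lemma sub_pair_convex (t : R) u1 v1 u2 v2 : 0 <= t <= 1 -> sub_pair u1 v1 -> sub_pair u2 v2 ->
  sub_pair (fun x => (1 - t) * u1 x + t * u2 x) (fun x => (1 - t) * v1 x + t * v2 x).
Proof.
move=> /[dup] t01 /andP[t0 t1] [Vu1 Vv1 u10 H1] [Vu2 Vv2 u20 H2].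
have t1' : 0 <= 1 - t by rewrite subr_ge0.
have Vu := formD_in F (formZ_in F (1 - t) Vu1) (formZ_in F t Vu2).
split=> //; first exact: (formD_in F (formZ_in F (1 - t) Vv1) (formZ_in F t Vv2)).
  by apply: filterS2 u10 u20 => x + + Dx => /(_ Dx) ? /(_ Dx) ?; rewrite addr_ge0// mulr_ge0.
move=> psi Vp p0; have [l1 i1] := H1 _ Vp p0; have [l2 i2] := H2 _ Vp p0.
have l := L1D mD (L1Z mD (1 - t) l1) (L1Z mD t l2).
have ae1 : aeD (fun x => ((1 - t) * u1 x + t * u2 x) `^ r * psi x <=
    (1 - t) * (u1 x `^ r * psi x) + t * (u2 x `^ r * psi x)).
  apply: filterS3 u10 u20 p0 => x + + + Dx => /(_ Dx) h1 /(_ Dx) h2 /(_ Dx) h3.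
  by rewrite !mulrA -mulrDl ler_wpM2r// powR_convex.
have ll : L1mu (fun x => ((1 - t) * u1 x + t * u2 x) `^ r * psi x).
  apply: (L1_dom mD _ l).
    by apply: measurable_funM; [exact: mP (mV Vu)|exact: mV].
  apply: filterS2 ae1 p0 => x + + Dx => /(_ Dx) h /(_ Dx) h3.
  by rewrite ger0_norm// mulr_ge0 ?powR_ge0.
split=> //; apply: (le_trans (I_le mD ll l ae1)).
rewrite (I_D mD (L1Z mD _ l1) (L1Z mD _ l2)) (I_Z mD _ l1) (I_Z mD _ l2).
rewrite (formD F (formZ_in F _ Vv1) (formZ_in F _ Vv2) Vp) (formZ F _ Vv1 Vp) (formZ F _ Vv2 Vp).
by apply: lerD; apply: ler_wpM2l.
Qed.

Lemma sub_pair_mid p q : sub_pair p.1 p.2 -> sub_pair q.1 q.2 ->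
  sub_pair (fun x => 2^-1 * (p.1 x + q.1 x)) (fun x => 2^-1 * (p.2 x + q.2 x)).
Proof.
have h01 : 0 <= (2^-1 : R) <= 1 by lra.
move=> Kp Kq; have := sub_pair_convex h01 Kp Kq.
have E (w1 w2 : T -> R) : (fun x => (1 - 2^-1) * w1 x + 2^-1 * w2 x) =
    (fun x => 2^-1 * (w1 x + w2 x)) by apply/funext => x; field.
by rewrite !E.
Qed.

Lemma sub_pair_energy u v : sub_pair u v ->
  0 <= I (fun x => u x `^ r * u x) <= 2^-1 * (a u u + a v v).
Proof.
move=> [Vu Vv u0 H]; have [l i] := H _ Vu u0; apply/andP; split.
  apply: (I_ge0 mD _ (L1_measurable l)).
  by apply: filterS u0 => x /[apply] ux; rewrite mulr_ge0 ?powR_ge0.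
by apply: (le_trans i); have := form_young F Vv Vu; lra.
Qed.

Lemma sub_pair_singular u v : sub_pair u v -> L1mu (fun x => f x * u x `^ s).
Proof.
move=> K; have [Vu _ u0 _] := K; have [h lh hP] := f_absorb ltr01.
apply: (L1_dom mD _ (L1D mD (L1Z mD 1 (sub_pair_L1 K Vu)) lh)).
  by apply: measurable_funM => //; exact: mP (mV Vu).
apply: filterS3 u0 hP f0 => x + + + Dx => /(_ Dx) ux /(_ Dx) hx /(_ Dx) fx.
by rewrite ger0_norm ?mulr_ge0 ?powR_ge0// hx.
Qed.

Lemma singular_ge0 u : measurable_fun D u -> 0 <= I (fun x => f x * u x `^ s).
Proof.
move=> mu_; apply: (I_ge0 mD); last by apply: measurable_funM => //; exact: mP.
by apply: filterS f0 => x /[apply] fx; rewrite mulr_ge0 ?powR_ge0.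
Qed.

(** Coercivity: the constraint turns the energy into a bound of [u] in a
    Lebesgue space that absorbs the singular term. *)
Lemma functional_coercive : exists m, forall u v, sub_pair u v ->
  m + 4^-1 * a u u + (4 * r)^-1 * a v v <= functional u v.
Proof.
pose delta := s / (2 * r).
have d0 : 0 < delta by rewrite divr_gt0// mulr_gt0.
have [h lh hP] := f_absorb d0.
exists (- (s^-1 * I h)) => u v K; have [Vu Vv u0 _] := K.
have lu := sub_pair_L1 K Vu.
have := I_le mD (sub_pair_singular K) (L1D mD (L1Z mD delta lu) lh).
rewrite (I_D mD (L1Z mD _ lu) lh) (I_Z mD _ lu) => Ih.
have := Ih (ltac:(by apply: filterS2 u0 hP => x + + Dx => /(_ Dx) ux /(_ Dx); apply)).
have /andP[_ iu] := sub_pair_energy K.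
have au := form_ge0 F Vu; have av := form_ge0 F Vv.
move=> h1; rewrite /functional -(ler_pM2l s0).
have h2 : delta * I (fun x => u x `^ r * u x) <= delta * (2^-1 * (a u u + a v v)).
  by rewrite ler_pM2l.
have h3 : delta * (2^-1 * (a u u + a v v)) = s * ((4 * r)^-1 * (a u u + a v v)).
  by rewrite /delta; field; exact: lt0r_neq0.
have h4 : (4 * r)^-1 * a u u <= 4^-1 * a u u.
  by rewrite ler_wpM2r// lef_pV2 ?posrE ?mulr_gt0// ler_peMr// ltW.
have h5 : s * ((4 * r)^-1 * a u u) <= s * (4^-1 * a u u) by rewrite ler_pM2l.
have -> : s * (2^-1 * a u u + (2 * r)^-1 * a v v - s^-1 * I (fun x => f x * u x `^ s)) =
   s * (4^-1 * a u u) + s * (4^-1 * a u u) + s * ((4 * r)^-1 * a v v) + s * ((4 * r)^-1 * a v v)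
   - I (fun x => f x * u x `^ s).
  by field; rewrite !lt0r_neq0.
have -> : s * (- (s^-1 * I h) + 4^-1 * a u u + (4 * r)^-1 * a v v) =
   - I h + s * (4^-1 * a u u) + s * ((4 * r)^-1 * a v v).
  by field; rewrite !lt0r_neq0.
move: h2; rewrite h3 [s * (_ * (_ + _))](_ : _ = s * ((4 * r)^-1 * a u u) + s * ((4 * r)^-1 * a v v)); last by ring.
lra.
Qed.

Lemma functional_mid u1 v1 u2 v2 : sub_pair u1 v1 -> sub_pair u2 v2 ->
  functional (fun x => 2^-1 * (u1 x + u2 x)) (fun x => 2^-1 * (v1 x + v2 x)) <=
  (functional u1 v1 + functional u2 v2) / 2 -
  (8^-1 * a (fun x => u1 x - u2 x) (fun x => u1 x - u2 x) +
   (8 * r)^-1 * a (fun x => v1 x - v2 x) (fun x => v1 x - v2 x)).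
Proof.
move=> K1 K2; have [Vu1 Vv1 u10 _] := K1; have [Vu2 Vv2 u20 _] := K2.
have l1 := sub_pair_singular K1; have l2 := sub_pair_singular K2.
have K := sub_pair_mid (p := (u1, v1)) (q := (u2, v2)) K1 K2.
have l := sub_pair_singular K.
have := I_le mD (L1Z mD 2^-1 (L1D mD l1 l2)) l.
rewrite (I_Z mD _ (L1D mD l1 l2)) (I_D mD l1 l2) => H.
have {}H := H (ltac:(by apply: filterS3 u10 u20 f0 => x + + + Dx =>
  /(_ Dx) h1 /(_ Dx) h2 /(_ Dx) fx; rewrite -mulrDr mulrCA ler_wpM2l// powR_concave_mid)).
rewrite /functional (form_mid F Vu1 Vu2) (form_mid F Vv1 Vv2).
have {}H : s^-1 * (2^-1 * (I (fun x => f x * u1 x `^ s) + I (fun x => f x * u2 x `^ s))) <=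
  s^-1 * I (fun x => f x * (2^-1 * (u1 x + u2 x)) `^ s).
  by rewrite ler_pM2l// invr_gt0.
move: (a u1 u1) (a u2 u2) (a v1 v1) (a v2 v2) => p1 p2 q1 q2.
move: (a _ _) (a _ _) H => q p H.
move: (I (fun x => f x * u1 x `^ s)) (I (fun x => f x * u2 x `^ s)) H => i1 i2 H.
move: (I _) H => i H.
have -> : (8 * r)^-1 * q = 4^-1 * ((2 * r)^-1 * q) by field; rewrite lt0r_neq0.
lra.
Qed.

(** The supersolution bounds the right-hand side in the dual space, and it has
    more energy than the solution. *)
Lemma sub_pair_solution u v : sub_pair u v -> exists v0,
  [/\ sub_pair u v0, a v0 v0 <= a v v &
      forall psi, V psi -> a v0 psi = I (fun x => u x `^ r * psi x)].
Proof.
move=> K; have [Vu Vv u0 H] := K.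
have lK psi Vp := @sub_pair_L1 _ _ psi K Vp.
have bnd psi : V psi -> I (fun x => u x `^ r * psi x) ^+ 2 <= a v v * a psi psi.
  move=> Vp; have [Va ale] := df_abs Fd Vp.
  have [la ia] := H _ Va (ltac:(by apply: aeW => x _; exact: normr_ge0)).
  have h : `|I (fun x => u x `^ r * psi x)| <= a v (fun x => `|psi x|).
    apply: le_trans ia; apply: (le_trans (I_norm mD (lK _ Vp))).
    apply: (I_le mD (L1_norm mD (lK _ Vp)) la); apply: aeW => x _.
    by rewrite normrM (ger0_norm (powR_ge0 _ _)).
  have h0 : 0 <= a v (fun x => `|psi x|) by apply: le_trans h.
  rewrite -(real_normK (num_real (I _))).
  apply: (@le_trans _ _ (a v (fun x => `|psi x|) ^+ 2)); first by rewrite lerXn2r ?nnegrE.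
  apply: (le_trans (form_CS F Vv Va)); apply: ler_wpM2l => //.
  exact: (form_ge0 F Vv).
have [v0 Vv0 v0P] : exists2 v0, V v0 & forall psi, V psi -> a v0 psi = I (fun x => u x `^ r * psi x).
  apply: (riesz F (df_complete Fd) (C := a v v)) => //.
  - move=> w1 w2 V1 V2; rewrite -(I_D mD (lK _ V1) (lK _ V2)).
    by apply: eq_Rintegral => x _; ring.
  - move=> c w Vw; rewrite -(I_Z mD _ (lK _ Vw)).
    by apply: eq_Rintegral => x _; ring.
exists v0; split=> //.
  by split=> // psi Vp p0; split; [exact: lK|rewrite v0P].
have := bnd _ Vv0; rewrite -v0P// expr2.
have := form_ge0 F Vv0; rewrite le_eqVlt => /predU1P[<- _|h]; first exact: (form_ge0 F Vv).
by rewrite ler_pM2r.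
Qed.

(** Minimising sequences converge strongly, by uniform convexity; Fatou's
    lemma passes to the limit in the constraint, and in the singular term,
    which the power of [u] that the constraint controls dominates up to an
    arbitrarily small factor.  Replacing [v] by the solution of the second
    equation does not increase the functional. *)
Lemma minimal_pair_exists : exists u v, [/\ sub_pair u v,
  forall psi, V psi -> a v psi = I (fun x => u x `^ r * psi x) &
  forall u' v', sub_pair u' v' -> functional u v <= functional u' v'].
Proof.
have [m mF] := functional_coercive.
pose Fp (p : (T -> R) * (T -> R)) := functional p.1 p.2.
pose C (k : nat) : set ((T -> R) * (T -> R)) := [set p | sub_pair p.1 p.2].
have Fm p : C 0%N p -> m <= Fp p.
  move=> K; apply: le_trans (mF _ _ K); have [Vu Vv _ _] := K.
  rewrite -addrA lerDl addr_ge0// mulr_ge0 ?invr_ge0 ?mulr_ge0 ?(ltW r0)//.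
    exact: (form_ge0 F Vu).
  exact: (form_ge0 F Vv).
have h01 : 0 <= (2^-1 : R) <= 1 by lra.
have [z [zK zmin zC]] := @cauchy_near_minimizers R _ Fp
  (fun p q => (fun x => 2^-1 * (p.1 x + q.1 x), fun x => 2^-1 * (p.2 x + q.2 x)))
  (fun p q => 8^-1 * a (fun x => p.1 x - q.1 x) (fun x => p.1 x - q.1 x) +
     (8 * r)^-1 * a (fun x => p.2 x - q.2 x) (fun x => p.2 x - q.2 x))
  C m (functional (fun=> 0) (fun=> 0)) (fun k l _ => @subset_refl _ _)
  (fun k p q Kp Kq => sub_pair_mid Kp Kq)
  (fun p q Kp Kq => functional_mid Kp Kq) Fm
  (fun k => ex_intro2 _ _ (fun=> 0, fun=> 0) sub_pair0 (lexx _)).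
pose u k := (z k).1; pose v k := (z k).2.
have Vu k : V (u k) by case: (zK k).
have Vv k : V (v k) by case: (zK k).
have uge0 k : aeD (fun x => 0 <= u k x) by case: (zK k).
have r8 : 0 < (8 * r)^-1 by rewrite invr_gt0 mulr_gt0.
have au k l := form_ge0 F (formB_in F (Vu k) (Vu l)).
have av k l := form_ge0 F (formB_in F (Vv k) (Vv l)).
have [u0 Vu0 cu] := df_complete Fd Vu (ltac:(
  move=> e e0; have [N NP] := zC (8^-1 * e) (ltac:(by rewrite mulr_gt0));
  exists N => k l Nk Nl; have := NP _ _ Nk Nl; have := mulr_ge0 (ltW r8) (av k l);
  by rewrite -/(u k) -/(u l) -/(v k) -/(v l); lra)).
have [v0 Vv0 cv] := df_complete Fd Vv (ltac:(
  move=> e e0; have [N NP] := zC ((8 * r)^-1 * e) (ltac:(by rewrite mulr_gt0));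
  exists N => k l Nk Nl; have := NP _ _ Nk Nl; have := au k l;
  rewrite -/(u k) -/(u l) -/(v k) -/(v l) -[_ <= e](ler_pM2l r8); lra)).
have [sq sqP uae] := df_cvg_ae_subseq mD muD Fd Vu Vu0 cu.
have uall : aeD (fun x => forall k, 0 <= u k x).
  have : {ae mu, forall x k, D x -> 0 <= u k x} by apply: ae_foralln => k; exact: uge0.
  by apply: filterS => x + + k => /(_ k)/[apply].
have u0ge0 : aeD (fun x => 0 <= u0 x).
  apply: filterS2 uall uae => x + + Dx => /(_ Dx) ux /(_ Dx) cx.
  by apply: (cvgr_to_ge cx); exact: nearW.
have K0 : sub_pair u0 v0.
  split=> // psi Vp p0.
  apply: (fatou_L1 mD (fun k => sub_pair_L1 (zK (sq k)) Vp)
    (measurable_funM (mP r (mV Vu0)) (mV Vp)) (c_ := fun k => a (v (sq k)) psi)).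
  - move=> k; apply: filterS p0 => x /[apply] px.
    by rewrite mulr_ge0 ?powR_ge0.
  - apply: filterS2 uall uae => x + + Dx => /(_ Dx) ux /(_ Dx) cx.
    by apply: cvgM; [exact: (powR_cvg r0 (fun k => ux (sq k)) cx)|exact: cvg_cst].
  - by move=> k; have [_ _ _ H] := zK (sq k); exact: (H _ Vp p0).2.
  - apply: (cvg_subseq (y := fun k => a (v k) psi) sqP).
    apply: eq_cvg_to (form_cvg F Vv Vv0 Vp cv) => [k|].
      exact: (formC F Vp (Vv k)).
    exact: (formC F Vp Vv0).
have cau := cvg_subseq sqP (form_cvg_sqr F Vu Vu0 cu).
have cav := cvg_subseq sqP (form_cvg_sqr F Vv Vv0 cv).
have minK u' v' : sub_pair u' v' -> functional u0 v0 <= functional u' v'.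
  move=> K'; set y := functional u' v'.
  set M := 2^-1 * (a u0 u0 + a v0 v0).
  have M0 : 0 <= M.
    by rewrite mulr_ge0// addr_ge0//; [exact: (form_ge0 F Vu0)|exact: (form_ge0 F Vv0)].
  have l0 := sub_pair_L1 K0 Vu0; have ls0 := sub_pair_singular K0.
  have key delta : 0 < delta ->
      - I (fun x => f x * u0 x `^ s) <=
      delta * M + s * (y - 2^-1 * a u0 u0 - (2 * r)^-1 * a v0 v0).
    move=> d0; have [h lh hP] := f_absorb d0.
    pose c k := delta * (2^-1 * (a (u (sq k)) (u (sq k)) + a (v (sq k)) (v (sq k)))) + I h +
      s * (y + (sq k).+1%:R^-1 - 2^-1 * a (u (sq k)) (u (sq k))
        - (2 * r)^-1 * a (v (sq k)) (v (sq k))).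
    have lk k := sub_pair_L1 (zK (sq k)) (Vu (sq k)).
    have lsk k := sub_pair_singular (zK (sq k)).
    have [l Il] : L1mu (fun x => delta * (u0 x `^ r * u0 x) + h x - f x * u0 x `^ s) /\
      I (fun x => delta * (u0 x `^ r * u0 x) + h x - f x * u0 x `^ s) <= delta * M + I h +
        s * (y + 0 - 2^-1 * a u0 u0 - (2 * r)^-1 * a v0 v0).
      apply: (fatou_L1 mD
        (fun k => L1B mD (L1D mD (L1Z mD delta (lk k)) lh) (lsk k))
        (L1_measurable (L1B mD (L1D mD (L1Z mD delta l0) lh) ls0)) (c_ := c)).
      - move=> k; apply: filterS2 uall hP => x + + Dx => /(_ Dx) ux /(_ Dx) hx.
        by rewrite subr_ge0 hx// ux.
      - apply: filterS2 uall uae => x + + Dx => /(_ Dx) ux /(_ Dx) cx.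
        apply: cvgB; first (apply: cvgD; last exact: cvg_cst).
          apply: cvgM; first exact: cvg_cst.
          by apply: cvgM => //; exact: (powR_cvg r0 (fun k => ux (sq k)) cx).
        by apply: cvgM; [exact: cvg_cst|exact: (powR_cvg s0 (fun k => ux (sq k)) cx)].
      - move=> k; rewrite (I_B mD (L1D mD (L1Z mD delta (lk k)) lh) (lsk k)).
        rewrite (I_D mD (L1Z mD delta (lk k)) lh) (I_Z mD _ (lk k)) /c.
        have /andP[_ /(ler_wpM2l (ltW d0)) h1] := sub_pair_energy (zK (sq k)).
        have := zmin (sq k) (u', v') K'.
        rewrite /Fp /functional /= -/(functional u' v') -/y -(ler_pM2l s0).
        rewrite -/(u (sq k)) -/(v (sq k)) mulrBr mulVKf; last by rewrite gt_eqF.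
        move: h1; rewrite -/(u (sq k)) -/(v (sq k)).
        move: (I (fun x => u _ x `^ r * _)) (I (fun x => f x * _)) (I h) => i1 i2 i3.
        move: (a (u _) _) (a (v _) _) ((2 * r)^-1) ((sq k).+1%:R^-1) => p q n n'.
        rewrite !mulrDr !mulrN.
        lra.
      - apply: cvgD; first (apply: cvgD; last exact: cvg_cst).
          by apply: cvgM; [exact: cvg_cst|apply: cvgM; [exact: cvg_cst|exact: cvgD]].
        apply: cvgM; first exact: cvg_cst.
        apply: cvgB; last by apply: cvgM => //; exact: cvg_cst.
        apply: cvgB; last by apply: cvgM => //; exact: cvg_cst.
        apply: cvgD; first exact: cvg_cst.
        exact: (cvg_subseq sqP (@cvg_harmonic R)).
    move: Il; rewrite (I_B mD (L1D mD (L1Z mD delta l0) lh) ls0).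
    rewrite (I_D mD (L1Z mD delta l0) lh) (I_Z mD _ l0) addr0.
    have /andP[i0 _] := sub_pair_energy K0; have := mulr_ge0 (ltW d0) i0.
    move: (I (fun x => u0 x `^ r * _)) (I (fun x => f x * _)) (I h) => i1 i2 i3.
    lra.
  apply/ler_addgt0Pr => e e0.
  have M1 : 0 < M + 1 by rewrite ltr_wpDl.
  have d0 : 0 < s * e / (M + 1) by rewrite divr_gt0// mulr_gt0.
  rewrite {1}/functional -(ler_pM2l s0) [leLHS]mulrBr mulVKf; last by rewrite gt_eqF.
  have := key _ d0.
  have : s * e / (M + 1) * M <= s * e.
    by rewrite -mulrA ler_piMr ?mulr_ge0 ?(ltW s0) ?(ltW e0)// ler_pdivrMl// mulr1 lerDl.
  move: (I _) (s * e / _ * M) (a u0 u0) (a v0 v0) ((2 * r)^-1) => i j p q n.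
  rewrite !mulrDr !mulrN; lra.
have [v1 [K1 le1 v1P]] := sub_pair_solution K0.
exists u0, v1; split; [exact: K1|exact: v1P|move=> u' v' /minK; apply: le_trans].
by rewrite /functional lerD2r lerD2l ler_wpM2l// invr_ge0 mulr_ge0// ltW.
Qed.

End minimiser.

(** * The Euler-Lagrange equation of a minimal pair *)

Section euler_lagrange.
Context dd (T : measurableType dd) (R : realType).
Variables (mu : {measure set T -> \bar R}) (D : set T).
Hypotheses (mD : measurable D) (muD : (mu D < +oo)%E).
Context (V : set (T -> R)) (a : (T -> R) -> (T -> R) -> R).
Hypothesis Fd : dirichlet_form mu D V a.
Variables (r gamma : R) (f : T -> R).
Hypotheses (r2 : 2 <= r) (g01 : 0 < gamma < 1).
Local Notation I g := (Rintegral mu D g).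
Local Notation L1mu := (L1 mu D).
Local Notation aeD P := {ae mu, forall x, D x -> P x}.
Local Notation s := (1 - gamma).
Hypotheses (mf : measurable_fun D f) (f0 : aeD (fun x => 0 <= f x)).
Hypothesis f_absorb : forall delta : R, 0 < delta -> exists2 h, L1mu h &
  aeD (fun x => forall t : R, 0 <= t -> f x * t `^ s <= delta * (t `^ r * t) + h x).
Variables (u v : T -> R).
Hypothesis K : sub_pair mu D V a r u v.
Hypothesis v_solution : forall psi, V psi -> a v psi = I (fun x => u x `^ r * psi x).
Hypothesis minimal : forall u' v', sub_pair mu D V a r u' v' ->
  functional mu D a r gamma f u v <= functional mu D a r gamma f u' v'.
Implicit Types (g w phi psi : T -> R).
Let F := df_psd Fd.
Let r1 : 1 < r. Proof. by move: r2; lra. Qed.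
Let r0 : 0 < r. Proof. by move: r2; lra. Qed.
Let r10 : 0 < r - 1. Proof. by move: r2; lra. Qed.
Let s01 : 0 < s <= 1. Proof. by move: g01; lra. Qed.
Let s0 : 0 < s. Proof. by case/andP: s01. Qed.
Let mV w : V w -> measurable_fun D w. Proof. by move=> /(df_L2 Fd)[]. Qed.
Let lV w : V w -> L1mu w. Proof. by move=> /(df_L2 Fd)/(L2_L1 mD muD). Qed.
Let mP q w : measurable_fun D w -> measurable_fun D (fun x => w x `^ q).
Proof. exact: measurableT_comp (measurable_powR q). Qed.
Let Vu : V u. Proof. by case: K. Qed.
Let Vv : V v. Proof. by case: K. Qed.
Let u0 : aeD (fun x => 0 <= u x). Proof. by case: K. Qed.
Let mu_ := mV Vu.
Let mv := mV Vv.

Lemma minimal_v_supersolution psi : V psi -> aeD (fun x => 0 <= psi x) -> 0 <= a v psi.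
Proof.
move=> Vp p0; rewrite v_solution//; apply: (I_ge0 mD).
  by apply: filterS p0 => x /[apply] px; rewrite mulr_ge0 ?powR_ge0.
exact: measurable_funM (mP r mu_) (mV Vp).
Qed.

Lemma minimal_v_ge0 : aeD (fun x => 0 <= v x).
Proof. exact: (supersolution_ge0 mD Fd Vv minimal_v_supersolution). Qed.
Let v0 := minimal_v_ge0.

(** The bound makes [(u + phi) `^ r] at most a multiple of [u `^ r + 1], so that
    the second equation can still be solved with this source. *)
Definition admissible phi : Prop := V phi /\ exists2 CM : R * R,
  0 <= CM.1 /\ 0 <= CM.2 & aeD (fun x => 0 <= phi x <= CM.1 * u x + CM.2).

Lemma admissible_ge0 phi : admissible phi -> aeD (fun x => 0 <= phi x).
Proof. by move=> [_ [CM _]]; apply: filterS => x /[apply] /andP[]. Qed.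

Lemma admissibleZ c phi : 0 <= c -> admissible phi -> admissible (fun x => c * phi x).
Proof.
move=> c0 [Vp [[C M] /= [C0 M0] pCM]]; split; first exact: (formZ_in F).
exists (c * C, c * M) => /=; first by rewrite !mulr_ge0.
apply: filterS pCM => x /[apply] /andP[p0 pC].
by rewrite mulr_ge0//= -mulrA -mulrDr ler_wpM2l.
Qed.

(** The torsion function accounts for the constant in the bound of
    [(u + phi) `^ r] by [u `^ r + 1]. *)
Lemma admissible_solution phi : admissible phi -> exists w,
  sub_pair mu D V a r (fun x => u x + phi x) w /\
  forall psi, V psi -> a w psi = I (fun x => (u x + phi x) `^ r * psi x).
Proof.
move=> [Vp [[C M] /= [C0 M0] pCM]].
have [e Ve eP] := torsion_exists mD muD Fd.
have Vve := formD_in F Vv Ve; have Vup := formD_in F Vu Vp.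
pose c := 2 `^ r * ((C + 1) `^ r + M `^ r).
have c0 : 0 <= c by rewrite mulr_ge0 ?addr_ge0 ?powR_ge0.
suff KU : sub_pair mu D V a r (fun x => u x + phi x) (fun x => c * (v x + e x)).
  by have [w [Kw _ wP]] := sub_pair_solution mD Fd KU; exists w.
have bnd : aeD (fun x => (u x + phi x) `^ r <= c * (u x `^ r + 1)).
  apply: filterS2 u0 pCM => x + + Dx => /(_ Dx) ux /(_ Dx) /andP[px pC].
  have C1 : 0 <= C + 1 by rewrite addr_ge0.
  have h1 : (u x + phi x) `^ r <= ((C + 1) * u x + M) `^ r.
    apply: ge0_ler_powR; rewrite ?nnegrE ?addr_ge0 ?mulr_ge0 ?addr_ge0//; first exact: ltW.
    by rewrite mulrDl mul1r [_ + u x]addrC -addrA lerD2l.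
  apply: (le_trans h1); have := powR_add_le (ltW r0) (mulr_ge0 C1 ux) M0.
  move=> /le_trans; apply; rewrite powRM// /c -mulrA ler_wpM2l ?powR_ge0//.
  have := powR_ge0 (C + 1) r; have := powR_ge0 M r; have := powR_ge0 (u x) r.
  move: (u x `^ r) (M `^ r) ((C + 1) `^ r) => p q t p0 q0 t0.
  by have := mulr_ge0 q0 p0; rewrite mulrDl !mulrDr !mulr1; lra.
split=> //; first exact: (formZ_in F _ Vve).
  by apply: filterS2 u0 pCM => x + + Dx => /(_ Dx) ux /(_ Dx) /andP[px _]; rewrite addr_ge0.
move=> psi Vpsi psi0.
have l1 := sub_pair_L1 mD Fd K Vpsi.
have l := L1Z mD c (L1D mD l1 (lV Vpsi)).
have ae1 : aeD (fun x => (u x + phi x) `^ r * psi x <= c * (u x `^ r * psi x + psi x)).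
  apply: filterS2 bnd psi0 => x + + Dx => /(_ Dx) h1 /(_ Dx) h2.
  by apply: (le_trans (ler_wpM2r h2 h1)); rewrite -mulrA mulrDl mul1r.
have ll : L1mu (fun x => (u x + phi x) `^ r * psi x).
  apply: (L1_dom mD _ l); first exact: measurable_funM (mP r (mV Vup)) (mV Vpsi).
  apply: filterS2 ae1 psi0 => x + + Dx => /(_ Dx) h /(_ Dx) h3.
  by rewrite ger0_norm// mulr_ge0 ?powR_ge0.
split=> //; apply: (le_trans (I_le mD ll l ae1)).
rewrite (I_Z mD _ (L1D mD l1 (lV Vpsi))) (I_D mD l1 (lV Vpsi)).
by rewrite (formZ F c Vve Vpsi) (formD F Vv Ve Vpsi) v_solution// eP.
Qed.

Lemma coupling_L1 phi : admissible phi ->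
  L1mu (fun x => v x * ((u x + phi x) `^ (r - 1) * phi x)).
Proof.
move=> Ap; have [w [Kw _]] := admissible_solution Ap; have [Vp _] := Ap.
apply: (L1_dom mD _ (sub_pair_L1 mD Fd Kw Vv)).
  apply: measurable_funM => //; apply: measurable_funM; last exact: mV.
  by apply: mP; exact: (mV (formD_in F Vu Vp)).
apply: filterS3 u0 v0 (admissible_ge0 Ap) => x + + + Dx => /(_ Dx) ux /(_ Dx) vx /(_ Dx) px.
rewrite ger0_norm ?mulr_ge0 ?powR_ge0// mulrC ler_wpM2r//.
rewrite -(mulr_powRB1 (addr_ge0 ux px) r0) mulrC ler_wpM2r ?powR_ge0//.
by rewrite lerDr.
Qed.

(** The minimal pair is compared with the points of the segment to
    [(u + phi, w)], for [w] the exact solution with source [(u + phi) `^ r]. *)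
Lemma first_variation phi : admissible phi -> exists c, forall t, 0 < t <= 1 ->
  L1mu (fun x => f x * ((u x + t * phi x) `^ (- gamma) * phi x)) /\
  I (fun x => f x * ((u x + t * phi x) `^ (- gamma) * phi x)) <=
  a u phi + I (fun x => v x * ((u x + phi x) `^ (r - 1) * phi x)) + t * c.
Proof.
move=> Ap; have [Vp _] := Ap; have p0 := admissible_ge0 Ap.
have [w [Kw wP]] := admissible_solution Ap; have [_ Vw _ _] := Kw.
have Vz := formB_in F Vw Vv.
exists (2^-1 * a phi phi + (2 * r)^-1 * a (fun x => w x - v x) (fun x => w x - v x)).
move=> t /andP[t0 t1]; have t01 : 0 <= t <= 1 by rewrite ltW.
have Kt : sub_pair mu D V a r (fun x => u x + t * phi x) (fun x => v x + t * (w x - v x)).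
  have := sub_pair_convex mD Fd r2 t01 K Kw.
  have -> : (fun x => (1 - t) * u x + t * (u x + phi x)) = (fun x => u x + t * phi x).
    by apply/funext => x; ring.
  have -> // : (fun x => (1 - t) * v x + t * w x) = (fun x => v x + t * (w x - v x)).
  by apply/funext => x; ring.
have lt_ := sub_pair_singular mD Fd mf f0 f_absorb Kt.
have ls := sub_pair_singular mD Fd mf f0 f_absorb K.
have lJ := coupling_L1 Ap.
have lUv := sub_pair_L1 mD Fd Kw Vv; have luv := sub_pair_L1 mD Fd K Vv.
have aeS : aeD (fun x => s * t * (f x * ((u x + t * phi x) `^ (- gamma) * phi x)) <=
    f x * (u x + t * phi x) `^ s - f x * u x `^ s).
  apply: filterS3 u0 p0 f0 => x + + + Dx => /(_ Dx) ux /(_ Dx) px /(_ Dx) fx.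
  have := powR_concave_diff s01 ux (mulr_ge0 (ltW t0) px).
  have -> : s - 1 = - gamma by ring.
  rewrite -mulrBr => h; apply: le_trans (ler_wpM2l fx h).
  by rewrite le_eqVlt; apply/orP; left; apply/eqP; ring.
have st0 : 0 < s * t by exact: mulr_gt0.
have lS : L1mu (fun x => f x * ((u x + t * phi x) `^ (- gamma) * phi x)).
  apply: (L1_dom mD _ (L1Z mD (s * t)^-1 (L1B mD lt_ ls))).
    apply: measurable_funM => //; apply: measurable_funM; last exact: mV.
    by apply: mP; have [] := Kt => /mV.
  apply: filterS3 aeS p0 f0 => x + + + Dx => /(_ Dx) h /(_ Dx) px /(_ Dx) fx.
  by rewrite ger0_norm ?mulr_ge0 ?powR_ge0// ler_pdivlMl.
split=> //.
have IS := I_le mD (L1Z mD _ lS) (L1B mD lt_ ls) aeS.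
rewrite (I_Z mD _ lS) (I_B mD lt_ ls) in IS.
have aeJ : aeD (fun x => (u x + phi x) `^ r * v x - u x `^ r * v x <=
    r * (v x * ((u x + phi x) `^ (r - 1) * phi x))).
  apply: filterS3 u0 p0 v0 => x + + + Dx => /(_ Dx) ux /(_ Dx) px /(_ Dx) vx.
  rewrite -mulrBl; apply: (le_trans (ler_wpM2r vx (powR_convex_diff r1 ux px))).
  by rewrite le_eqVlt; apply/orP; left; apply/eqP; ring.
have IJ := I_le mD (L1B mD lUv luv) (L1Z mD _ lJ) aeJ.
rewrite (I_Z mD _ lJ) (I_B mD lUv luv) -wP// -v_solution// in IJ.
have := minimal Kt; rewrite /functional.
rewrite (form_sqrD F Vu (formZ_in F t Vp)) (formZr F t Vu Vp) (form_sqrZ F t Vp).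
rewrite (form_sqrD F Vv (formZ_in F t Vz)) (formZr F t Vv Vz) (form_sqrZ F t Vz).
rewrite (formBr F Vv Vw Vv) (formC F Vv Vw).
move: (I (fun x => f x * (u x + t * phi x) `^ s)) (I (fun x => f x * u x `^ s)) IS => i1 i2.
move: (I (fun x => f x * _)) (I (fun x => v x * _)) IJ => i j.
move: (a w v) (a v v) (a u u) (a u phi) (a phi phi) => wv vv uu up pp IJ IS.
move: (a _ _) => zz H.
rewrite -(ler_pM2l t0).
have : s^-1 * (s * t * i) <= s^-1 * (i1 - i2) by rewrite ler_pM2l// invr_gt0.
rewrite -!mulrA mulKf ?gt_eqF// => IS'.
have : (2 * r)^-1 * (2 * t * (wv - vv)) <= (2 * r)^-1 * (2 * t * (r * j)).
  have t2 : 0 < 2 * t by exact: mulr_gt0.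
  have ri : 0 < (2 * r)^-1 by rewrite invr_gt0 mulr_gt0.
  by rewrite (ler_pM2l ri) (ler_pM2l t2).
have -> : (2 * r)^-1 * (2 * t * (r * j)) = t * j by field; exact: lt0r_neq0.
move: (2 * r)^-1 s^-1 H IS' => n k H IS' IJ'.
lra.
Qed.

(** Dividing the inequality for small multiples of [phi] by the factor. *)
Lemma linearised_inequality g : measurable_fun D g -> aeD (fun x => 0 <= g x) ->
  (forall phi, admissible phi -> L1mu (fun x => g x * phi x) /\
     I (fun x => g x * phi x) <=
     a u phi + I (fun x => v x * ((u x + phi x) `^ (r - 1) * phi x))) ->
  forall phi, admissible phi -> L1mu (fun x => v x * (u x `^ (r - 1) * phi x)) /\
     I (fun x => g x * phi x) <=
     a u phi + I (fun x => v x * (u x `^ (r - 1) * phi x)).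
Proof.
move=> mg g0 H phi Ap; have [Vp _] := Ap; have p0 := admissible_ge0 Ap.
pose tau (n : nat) : R := n.+1%:R^-1.
have tau0 n : 0 < tau n by rewrite invr_gt0.
have tau1 n : tau n <= 1 by rewrite invf_le1// ler1n.
have [l cv] : L1mu (fun x => v x * (u x `^ (r - 1) * phi x)) /\
    (fun n => I (fun x => v x * ((u x + tau n * phi x) `^ (r - 1) * phi x))) @ \oo -->
    I (fun x => v x * (u x `^ (r - 1) * phi x)).
  apply: (dominated_L1 mD (g := fun x => v x * ((u x + phi x) `^ (r - 1) * phi x))).
  - move=> n; apply: measurable_funM => //; apply: measurable_funM; last exact: mV.
    by apply: mP; exact: (mV (formD_in F Vu (formZ_in F _ Vp))).
  - apply: measurable_funM => //; apply: measurable_funM; last exact: mV.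
    exact: mP.
  - exact: coupling_L1.
  - move=> n; apply: filterS3 u0 v0 p0 => x + + + Dx => /(_ Dx) ux /(_ Dx) vx /(_ Dx) px.
    have h : 0 <= tau n * phi x by rewrite mulr_ge0// ltW.
    rewrite ger0_norm ?mulr_ge0 ?powR_ge0// ler_wpM2l// ler_wpM2r//.
    apply: (ge0_ler_powR (ltW r10)); rewrite ?nnegrE ?addr_ge0//.
    by rewrite lerD2l ler_piMl.
  - apply: filterS2 u0 p0 => x + + Dx => /(_ Dx) ux /(_ Dx) px.
    have cx : (fun n => u x + tau n * phi x) @ \oo --> u x + 0 * phi x.
      apply: cvgD; first exact: cvg_cst.
      by apply: cvgM; [exact: cvg_harmonic|exact: cvg_cst].
    rewrite mul0r addr0 in cx.
    have nn n : 0 <= u x + tau n * phi x by rewrite addr_ge0// mulr_ge0// ltW.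
    apply: cvgM; first exact: cvg_cst.
    by apply: cvgM; [exact: (powR_cvg r10 nn cx)|exact: cvg_cst].
split=> //.
have cv2 : (fun n => a u phi + I (fun x => v x * ((u x + tau n * phi x) `^ (r - 1) * phi x)))
    @ \oo --> a u phi + I (fun x => v x * (u x `^ (r - 1) * phi x)).
  by apply: cvgD => //; exact: cvg_cst.
apply: (cvgr_to_ge cv2); apply: nearW => n.
have An := admissibleZ (ltW (tau0 n)) Ap.
have [_] := H _ An; rewrite (formZr F _ Vu Vp).
have lg := (H _ Ap).1.
have -> : I (fun x => g x * (tau n * phi x)) = tau n * I (fun x => g x * phi x).
  by rewrite -(I_Z mD _ lg); apply: eq_Rintegral => x _; ring.
have ln : L1mu (fun x => v x * ((u x + tau n * phi x) `^ (r - 1) * phi x)).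
  have := L1Z mD (tau n)^-1 (coupling_L1 An); apply: (L1_eq mD) => x _ /=.
  by move: (_ `^ _) => q; field; exact: lt0r_neq0.
have -> : I (fun x => v x * ((u x + tau n * phi x) `^ (r - 1) * (tau n * phi x))) =
    tau n * I (fun x => v x * ((u x + tau n * phi x) `^ (r - 1) * phi x)).
  by rewrite -(I_Z mD _ ln); apply: eq_Rintegral => x _; ring.
by rewrite -mulrDr ler_pM2l.
Qed.

Lemma minimal_supersolution phi : admissible phi ->
  L1mu (fun x => v x * (u x `^ (r - 1) * phi x)) /\
  0 <= a u phi + I (fun x => v x * (u x `^ (r - 1) * phi x)).
Proof.
move=> Ap.
have E psi : (fun x => 0 * psi x) = (fun=> 0) :> (T -> R).
  by apply/funext => x; rewrite mul0r.
have [||psi Apsi|l] := @linearised_inequality (fun=> 0) _ _ _ phi Ap.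
- exact: measurable_cst.
- by apply: aeW => x _.
- rewrite E; split; first exact: L1_0.
  rewrite I_0// -oppr_le0.
  have [c cP] := first_variation Apsi; have p0 := admissible_ge0 Apsi.
  apply: (@le0_of_small _ _ c) => t /andP[t0 t1].
  have [l Il] := cP t (ltac:(by rewrite t0 ltW)).
  rewrite -subr_ge0 opprK addrC; apply: le_trans Il.
  apply: (I_ge0 mD _ (L1_measurable l)).
  apply: filterS2 p0 f0 => x + + Dx => /(_ Dx) px /(_ Dx) fx.
  by rewrite !mulr_ge0 ?powR_ge0.
- by rewrite E I_0.
Qed.

(** Where [phi - n u] is positive, both [n u] and [u] are at most 1, hence
    [n u `^ (r - 1)] is at most 1, as [r - 1 >= 1]. *)
Lemma minimal_u_bound phi : V phi -> aeD (fun x => 0 <= phi x <= 1) ->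
  forall n : nat, - I v <= n.+1%:R * a u (pos (fun x => phi x - n.+1%:R * u x)).
Proof.
move=> Vp p01 n; set N : R := n.+1%:R.
have N1 : 1 <= N by rewrite ler1n.
have N0 : 0 <= N by exact: le_trans N1.
have Vd := formB_in F Vp (formZ_in F N Vu); have Vz := df_pos_in Fd Vd.
set z := pos _ in Vz *.
have z01 : aeD (fun x => 0 <= z x <= 1).
  apply: filterS2 u0 p01 => x + + Dx => /(_ Dx) ux /(_ Dx) /andP[px p1].
  rewrite pos_ge0/= pos_le// lerBlDr (le_trans p1)// lerDl.
  exact: mulr_ge0.
have Az : admissible z.
  split=> //; exists (0, 1) => //=.
  by apply: filterS z01 => x /[apply]; rewrite mul0r add0r.
have [l h] := minimal_supersolution Az.
have ae1 : aeD (fun x => N * (v x * (u x `^ (r - 1) * z x)) <= v x).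
  apply: filterS3 u0 v0 p01 => x + + + Dx => /(_ Dx) ux /(_ Dx) vx /(_ Dx) /andP[px p1].
  have := pos_ge0 (fun x => phi x - N * u x) x; rewrite -/(z x) le_eqVlt => /predU1P[<-|zx].
    by rewrite !mulr0.
  have zE : z x = phi x - N * u x by exact: pos_gt0 zx.
  have Nu : N * u x <= 1 by move: zx; rewrite zE; lra.
  have u1 : u x <= 1 by apply: le_trans Nu; rewrite ler_peMl.
  have Nu0 : 0 <= N * u x by exact: mulr_ge0.
  have z1 : z x <= 1 by rewrite zE; lra.
  have pu : u x `^ (r - 1) <= u x.
    move: ux; rewrite le_eqVlt => /predU1P[<-|ux]; first by rewrite powR0 ?gt_eqF.
    by apply: ge1r_powR; [rewrite ux|move: r2; lra].
  rewrite mulrCA -[leRHS]mulr1 ler_wpM2l// mulrA.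
  apply: (@le_trans _ _ (N * u x * z x)).
    by rewrite ler_wpM2r ?(ltW zx)// ler_wpM2l// .
  by rewrite -[leRHS]mulr1 ler_pM// ltW.
have := I_le mD (L1Z mD _ l) (lV Vv) ae1; rewrite (I_Z mD _ l).
have : 0 <= N * (a u z + I (fun x => v x * (u x `^ (r - 1) * z x))).
  by exact: mulr_ge0.
rewrite mulrDr; lra.
Qed.

(** If [u] vanished, the singular term would make the first variation of the
    functional infinite in every direction [phi] with [f phi] nonzero. *)
Lemma minimal_u_eq0 phi : V phi -> aeD (fun x => 0 <= phi x <= 1) ->
  aeD (fun x => u x = 0) -> aeD (fun x => f x * phi x = 0).
Proof.
move=> Vp p01 u00.
have Ap : admissible phi.
  split=> //; exists (0, 1) => //=.
  by apply: filterS p01 => x /[apply]; rewrite mul0r add0r.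
have [c cP] := first_variation Ap; have p0 := admissible_ge0 Ap.
have /andP[g0 g1] := g01.
have low t : 0 < t <= 1 -> aeD (fun x => t `^ (- gamma) * (f x * phi x) <=
    f x * ((u x + t * phi x) `^ (- gamma) * phi x)).
  move=> /andP[t0 t1]; apply: filterS3 u00 p01 f0 => x + + + Dx.
  move=> /(_ Dx) -> /(_ Dx) /andP[px p1] /(_ Dx) fx; rewrite add0r.
  move: px; rewrite le_eqVlt => /predU1P[<-|px]; first by rewrite !mulr0.
  rewrite (powRM _ (ltW t0) (ltW px)).
  have -> : f x * (t `^ (- gamma) * phi x `^ (- gamma) * phi x) =
      t `^ (- gamma) * (f x * phi x) * phi x `^ (- gamma) by ring.
  apply: ler_peMr; first by rewrite !mulr_ge0 ?powR_ge0// ltW.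
  rewrite powRN invf_ge1 ?powR_gt0//.
  by apply: powR_le1; rewrite ?(ltW px) ?(ltW g0).
have one01 : 0 < (1 : R) <= 1 by rewrite ltr01 lexx.
have lfp : L1mu (fun x => f x * phi x).
  apply: (L1_dom mD _ (cP 1 one01).1); first exact: measurable_funM mf (mV Vp).
  apply: filterS3 (low 1 one01) f0 p0 => x + + + Dx => /(_ Dx) h /(_ Dx) fx /(_ Dx) px.
  by rewrite ger0_norm ?mulr_ge0//; move: h; rewrite powR1 mul1r.
apply: I_eq0 => //.
  by apply: filterS2 f0 p0 => x + + Dx => /(_ Dx) fx /(_ Dx) px; rewrite mulr_ge0.
set X := a u phi + I (fun x => v x * ((u x + phi x) `^ (r - 1) * phi x)) in cP.
apply: (@le0_of_small _ _ (`|X| + `|c|)) => tau /andP[tau0 tau1].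
pose t := tau `^ gamma^-1.
have t0 : 0 < t by exact: powR_gt0.
have t1 : t <= 1.
  have gi : 0 <= gamma^-1 by rewrite invr_ge0 ltW.
  by apply: powR_le1 => //; rewrite (ltW tau0) ltW.
have t01 : 0 < t <= 1 by rewrite t0.
have [l h] := cP t t01.
have := I_le mD (L1Z mD _ lfp) l (low t t01); rewrite (I_Z mD _ lfp).
have -> : t `^ (- gamma) = tau^-1.
  by rewrite powRN /t -powRrM mulVf ?gt_eqF// powRr1// ltW.
rewrite ler_pdivrMl// => /le_trans; apply.
rewrite ler_pM2l//; apply: (le_trans h); apply: lerD; first exact: ler_norm.
rewrite -[leRHS]mul1r; apply: (le_trans (ler_norm _)); rewrite normrM (gtr0_norm t0).
by rewrite ler_wpM2r.
Qed.

Lemma minimal_v_eq0 : aeD (fun x => v x = 0) -> aeD (fun x => u x = 0).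
Proof.
move=> v00; have luv := sub_pair_L1 mD Fd K Vv; have luu := sub_pair_L1 mD Fd K Vu.
have vv0 : a v v = 0.
  rewrite v_solution// -(I_0 mu mD); apply: (I_ae_eq mD luv (L1_0 mu D)).
  by apply: filterS v00 => x /[apply] ->; rewrite mulr0.
have vu0 : a v u = 0.
  by apply/eqP; rewrite -sqrf_eq0 eq_le sqr_ge0 andbT (le_trans (form_CS F Vv Vu))// vv0 mul0r.
have : aeD (fun x => u x `^ r * u x = 0).
  apply: I_eq0 => //; last by rewrite -v_solution// vu0.
  by apply: filterS u0 => x /[apply] ux; rewrite mulr_ge0 ?powR_ge0.
apply: filterS => x /[apply] /eqP; rewrite mulf_eq0 powR_eq0 => /orP[/andP[]|] /eqP//.
Qed.

(** Unlike the straight segment to 0, the curve [t |-> (t u, t `^ r v)] stays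
    among the solutions of the second equation; along it the functional is
    stationary at the minimal pair. *)
Lemma minimal_scaling :
  a u u + I (fun x => u x `^ r * v x) <= I (fun x => f x * u x `^ s).
Proof.
rewrite -v_solution//.
have ls := sub_pair_singular mD Fd mf f0 f_absorb K.
have X0 : 0 <= I (fun x => f x * u x `^ s) by exact: (singular_ge0 mD gamma mf f0 mu_).
set X := I _ in X0 *.
have auu := form_ge0 F Vu; have avv := form_ge0 F Vv.
rewrite -subr_le0; apply: (@le0_of_small _ _ (2 * a u u + (1 + 3 / 2 * r) * a v v)).
move=> t /andP[t0 t1]; pose k := 1 - t.
have k0 : 0 < k by rewrite subr_gt0.
have k1 : k <= 1 by rewrite /k; lra.
pose y := k `^ r.
have y0 : 0 <= y by exact: powR_ge0.
have Kk : sub_pair mu D V a r (fun x => k * u x) (fun x => y * v x).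
  split; first exact: (formZ_in F).
  - exact: (formZ_in F).
  - by apply: filterS u0 => x /[apply] ux; rewrite mulr_ge0// ltW.
  move=> psi Vpsi psi0; have l := sub_pair_L1 mD Fd K Vpsi.
  have ae1 : aeD (fun x => y * (u x `^ r * psi x) = (k * u x) `^ r * psi x).
    by apply: filterS u0 => x /[apply] ux; rewrite (powRM _ (ltW k0) ux) mulrA.
  have ll : L1mu (fun x => (k * u x) `^ r * psi x).
    apply: (L1_dom mD _ (L1Z mD y (L1_norm mD l))).
      by apply: measurable_funM; [exact: mP (mV (formZ_in F k Vu))|exact: mV].
    by apply: filterS ae1 => x /[apply] <-; rewrite [leLHS]normrM (ger0_norm y0).
  split=> //; rewrite -(I_ae_eq mD (L1Z mD y l) ll ae1) (I_Z mD _ l).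
  by rewrite (formZ F _ Vv Vpsi) v_solution.
have y1 : 1 - r * t <= y.
  have := powR_convex_tangent r1 ler01 (ltW k0); rewrite !powR1 -/y /k; lra.
have yr : y <= 1.
  by apply: powR_le1; [exact: ltW|rewrite (ltW k0)].
have y2 : y + r * t * y <= 1.
  have h := powR_convex_tangent r1 (ltW k0) ler01; rewrite powR1 -/y in h.
  have h2 : y <= k `^ (r - 1) by apply: ger_powR; [rewrite k0|rewrite gerBl].
  have : r * t * y <= r * t * k `^ (r - 1) by rewrite ler_wpM2l// mulr_ge0 ?ltW.
  by move: h; rewrite /k; lra.
pose z := k `^ (s - 1).
have zk : k * z <= 1.
  rewrite mulr_powRB1 ?(ltW k0)//.
  by apply: powR_le1; [exact: ltW|rewrite (ltW k0)].
have zs : 1 - k `^ s <= s * (z * t).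
  have := powR_concave_tangent s01 k0 ler01; rewrite powR1 -/z /k; lra.
have XE : I (fun x => f x * (k * u x) `^ s) = k `^ s * X.
  rewrite /X -(I_Z mD _ ls); apply: (I_ae_eq mD).
  - exact: (sub_pair_singular mD Fd mf f0 f_absorb Kk).
  - exact: (L1Z mD _ ls).
  by apply: filterS u0 => x /[apply] ux; rewrite (powRM _ (ltW k0) ux) mulrCA.
have := minimal Kk; rewrite /functional XE (form_sqrZ F _ Vu) (form_sqrZ F _ Vv) -/X.
move=> H.
have H1 : 2^-1 * a u u * (1 - k ^+ 2) + (2 * r)^-1 * (a v v * (1 - y ^+ 2)) <= z * t * X.
  have : s^-1 * (1 - k `^ s) * X <= s^-1 * (s * (z * t)) * X.
    by rewrite ler_wpM2r// ler_pM2l// invr_gt0.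
  rewrite mulKf ?gt_eqF//; lra.
have H2 : (2 * r)^-1 * (a v v * (2 * r * t * (1 - 3 / 2 * r * t))) <=
    (2 * r)^-1 * (a v v * (1 - y ^+ 2)).
  rewrite ler_pM2l ?invr_gt0 ?mulr_gt0// ler_wpM2l//.
  have h1 : r * t * y * (1 + y) <= (1 - y) * (1 + y) by rewrite ler_wpM2r//; lra.
  have h2 : r * t * (2 * (1 - 3 / 2 * r * t)) <= r * t * (y * (1 + y)).
    rewrite ler_wpM2l ?mulr_ge0 ?(ltW r0) ?(ltW t0)//.
    by have := sqr_ge0 (1 - y); lra.
  lra.
have E : (2 * r)^-1 * (a v v * (2 * r * t * (1 - 3 / 2 * r * t))) =
    t * (a v v * (1 - 3 / 2 * r * t)) by field; exact: lt0r_neq0.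
rewrite E in H2.
have H3 : t * (a u u * (1 - t / 2) + a v v * (1 - 3 / 2 * r * t)) <= t * (z * X).
  by move: H1 H2; rewrite /k; lra.
rewrite ler_pM2l// in H3.
have H4 := ler_wpM2l (ltW k0) H3; rewrite mulrA in H4.
have H5 : k * z * X <= X by rewrite ler_piMl.
have H6 : 0 <= t ^+ 2 * a u u by exact: (mulr_ge0 (sqr_ge0 t) auu).
have H7 : 0 <= t ^+ 2 * r * a v v by exact: (mulr_ge0 (mulr_ge0 (sqr_ge0 t) (ltW r0)) avv).
have H8 : 0 <= t * a u u by exact: (mulr_ge0 (ltW t0) auu).
have := le_trans H4 H5; move: H6 H7 H8; rewrite /k.
move: (a u u) (a v v) => p q; lra.
Qed.

Hypothesis u_gt0 : aeD (fun x => 0 < u x).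

(** Fatou's lemma, for the step [t] of the first variation tending to 0. *)
Lemma minimal_singular phi : admissible phi ->
  L1mu (fun x => f x * u x `^ (- gamma) * phi x) /\
  I (fun x => f x * u x `^ (- gamma) * phi x) <=
  a u phi + I (fun x => v x * (u x `^ (r - 1) * phi x)).
Proof.
move=> Ap; pose g x := f x * u x `^ (- gamma).
have mg : measurable_fun D g by apply: measurable_funM => //; exact: mP.
have g0 : aeD (fun x => 0 <= g x).
  by apply: filterS f0 => x /[apply] fx; rewrite mulr_ge0 ?powR_ge0.
have H psi : admissible psi -> L1mu (fun x => g x * psi x) /\
    I (fun x => g x * psi x) <=
    a u psi + I (fun x => v x * ((u x + psi x) `^ (r - 1) * psi x)).
  move=> Apsi; have [Vpsi _] := Apsi; have psi0 := admissible_ge0 Apsi.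
  have [c cP] := first_variation Apsi.
  pose tau (n : nat) : R := n.+1%:R^-1.
  have tau0 n : 0 < tau n by rewrite invr_gt0.
  have tau1 n : 0 < tau n <= 1 by rewrite tau0 invf_le1// ler1n.
  set X := a u psi + _ in cP *.
  apply: (fatou_L1 mD (fun n => (cP _ (tau1 n)).1) (measurable_funM mg (mV Vpsi))
    (f := fun x => g x * psi x) (c_ := fun n => X + tau n * c)).
  - move=> n; apply: filterS2 f0 psi0 => x + + Dx => /(_ Dx) fx /(_ Dx) px.
    by rewrite !mulr_ge0 ?powR_ge0.
  - apply: filterS2 u_gt0 psi0 => x + + Dx => /(_ Dx) ux /(_ Dx) px.
    have cx : (fun n => u x + tau n * psi x) @ \oo --> u x + 0 * psi x.
      apply: cvgD; first exact: cvg_cst.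
      by apply: cvgM; [exact: cvg_harmonic|exact: cvg_cst].
    rewrite mul0r addr0 in cx.
    rewrite (_ : g x * psi x = f x * (u x `^ (- gamma) * psi x)); last by rewrite /g mulrA.
    have cq := powR_cvg_pos (q := - gamma) ux cx.
    exact: (cvgM (cvg_cst (f x)) (cvgM cq (cvg_cst (psi x)))).
  - by move=> n; exact: (cP _ (tau1 n)).2.
  - rewrite -[X in _ --> X]addr0 -[X in _ --> _ + X](mul0r c).
    apply: cvgD; first exact: cvg_cst.
    by apply: cvgM; [exact: cvg_harmonic|exact: cvg_cst].
split; first exact: (H _ Ap).1.
exact: (linearised_inequality mg g0 H Ap).2.
Qed.

(** A nonnegative bounded [phi] is [(phi - n u)^+ - (n u - phi)^+ + n u].  The
    first variation [L] is nonnegative at the three functions and nonpositive at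
    [u], hence [L phi <= L ((phi - n u)^+)]; this is of the order of [1 / n],
    because [n u] does not exceed [phi] on the set where [(phi - n u)^+] lives. *)
Lemma minimal_equation_ge0 phi M : V phi -> aeD (fun x => 0 <= phi x <= M) ->
  [/\ L1mu (fun x => f x * u x `^ (- gamma) * phi x),
      L1mu (fun x => v x * (u x `^ (r - 1) * phi x)) &
      a u phi + I (fun x => v x * (u x `^ (r - 1) * phi x)) =
      I (fun x => f x * u x `^ (- gamma) * phi x)].
Proof.
wlog M0 : M / 0 <= M.
  move=> H Vp pM; apply: (H (Num.max 0 M) _ Vp); first by rewrite le_max lexx.
  by apply: filterS pM => x /[apply] /andP[-> pm]; rewrite le_max pm orbT.
move=> Vp pM.
have bounded_adm psi : V psi -> aeD (fun x => 0 <= psi x <= M) -> admissible psi.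
  move=> Vpsi psiM; split=> //; exists (0, M) => //=.
  by apply: filterS psiM => x /[apply]; rewrite mul0r add0r.
have Ap := bounded_adm _ Vp pM.
have Au : admissible u.
  split=> //; exists (1, 0) => //=.
  by apply: filterS u0 => x /[apply] ux; rewrite mul1r addr0 ux lexx.
have [lS SP] := minimal_singular Ap; have [lC _] := minimal_supersolution Ap.
have [lSu _] := minimal_singular Au; have [lCu _] := minimal_supersolution Au.
split=> //; apply/eqP; rewrite eq_le SP andbT -subr_le0.
have ucu : I (fun x => v x * (u x `^ (r - 1) * u x)) = I (fun x => u x `^ r * v x).
  apply: (I_ae_eq mD lCu (sub_pair_L1 mD Fd K Vv)).
  by apply: filterS u0 => x /[apply] ux; rewrite mulrC [_ * u x]mulrC mulr_powRB1.
have ufu : I (fun x => f x * u x `^ (- gamma) * u x) = I (fun x => f x * u x `^ s).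
  apply: (I_ae_eq mD lSu (sub_pair_singular mD Fd mf f0 f_absorb K)).
  apply: filterS u0 => x /[apply] ux; rewrite -mulrA [_ * u x]mulrC.
  by rewrite -(mulr_powRB1 ux s0) (_ : s - 1 = - gamma)//; ring.
have Lu := minimal_scaling; rewrite -ucu -ufu in Lu.
pose B := M * M `^ (r - 1 - 1) * M.
pose c := 4^-1 * a phi phi + B * I v.
set L := _ - _.
have key (n : nat) : n.+1%:R * L <= c.
  set N : R := n.+1%:R.
  have N1 : 1 <= N by rewrite ler1n.
  have N0 : 0 <= N by exact: le_trans N1.
  have Vd := formB_in F Vp (formZ_in F N Vu).
  have Vz := df_pos_in Fd Vd; have Vx := df_pos_in Fd (formN_in F Vd).
  have zp := df_pos_le Fd Vd; rewrite (formB F Vp (formZ_in F N Vu) Vz) (formZ F N Vu Vz) in zp.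
  have split x : phi x = pos (fun x => phi x - N * u x) x
      - pos (fun x => - (phi x - N * u x)) x + N * u x.
    by rewrite pos_sub_opp subrK.
  set z := pos (fun x => phi x - N * u x) in Vz zp split.
  set w := pos _ in Vx split.
  have z0 x : 0 <= z x by exact: pos_ge0.
  have Az : admissible z.
    apply: bounded_adm => //; apply: filterS2 u0 pM => x + + Dx.
    move=> /(_ Dx) ux /(_ Dx) /andP[px pm]; rewrite z0/= pos_le// lerBlDr (le_trans pm)// lerDl.
    exact: mulr_ge0.
  have Aw : admissible w.
    split=> //; exists (N, 0) => //=.
    apply: filterS2 u0 pM => x + + Dx => /(_ Dx) ux /(_ Dx) /andP[px pm].
    rewrite addr0 pos_ge0/= pos_le//; first exact: mulr_ge0.
    by rewrite opprB lerBlDr lerDl.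
  have [lSz _] := minimal_singular Az; have [lCz _] := minimal_supersolution Az.
  have [lSw wP] := minimal_singular Aw; have [lCw _] := minimal_supersolution Aw.
  have aE : a u phi = a u z - a u w + N * a u u.
    rewrite -(formZr F N Vu Vu) -(formBr F Vu Vz Vx) -(formDr F Vu (formB_in F Vz Vx) (formZ_in F N Vu)).
    by congr (a u _); apply/funext => x; exact: split.
  have IE g : L1mu (fun x => g x * z x) -> L1mu (fun x => g x * w x) ->
      L1mu (fun x => g x * u x) ->
      I (fun x => g x * phi x) = I (fun x => g x * z x) - I (fun x => g x * w x)
        + N * I (fun x => g x * u x).
    move=> l1 l2 l3; rewrite -(I_Z mD N l3) -(I_B mD l1 l2) -(I_D mD (L1B mD l1 l2) (L1Z mD N l3)).
    by apply: eq_Rintegral => x _; rewrite {1}split; ring.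
  have SE := IE _ lSz lSw lSu.
  have A (h : T -> R) : (fun x => v x * (u x `^ (r - 1) * h x)) = (fun x => v x * u x `^ (r - 1) * h x).
    by apply/funext => x; rewrite mulrA.
  have CE : I (fun x => v x * (u x `^ (r - 1) * phi x)) =
     I (fun x => v x * (u x `^ (r - 1) * z x)) - I (fun x => v x * (u x `^ (r - 1) * w x))
        + N * I (fun x => v x * (u x `^ (r - 1) * u x)).
    by rewrite !A IE// -A.
  have Sz0 : 0 <= I (fun x => f x * u x `^ (- gamma) * z x).
    apply: (I_ge0 mD _ (L1_measurable lSz)).
    by apply: filterS f0 => x /[apply] fx; rewrite !mulr_ge0 ?powR_ge0.
  have ae1 : aeD (fun x => N * (v x * (u x `^ (r - 1) * z x)) <= B * v x).
    apply: filterS3 u0 v0 pM => x + + + Dx => /(_ Dx) ux /(_ Dx) vx /(_ Dx) /andP[px pm].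
    have B0 : 0 <= B by rewrite !mulr_ge0 ?powR_ge0.
    have := z0 x; rewrite le_eqVlt => /predU1P[<-|zx].
      by rewrite !mulr0 mulr_ge0.
    have zE : z x = phi x - N * u x by exact: pos_gt0 zx.
    have Nu0 : 0 <= N * u x by exact: mulr_ge0.
    have Nu : N * u x <= M by move: zx; rewrite zE; lra.
    have uM : u x <= M by apply: le_trans Nu; rewrite ler_peMl.
    have zM : z x <= M by rewrite zE; lra.
    rewrite -(mulr_powRB1 ux r10).
    have -> : N * (v x * (u x * u x `^ (r - 1 - 1) * z x)) =
       N * u x * u x `^ (r - 1 - 1) * z x * v x by ring.
    rewrite ler_wpM2r// /B; apply: ler_pM => //; first by rewrite mulr_ge0 ?powR_ge0.
    apply: ler_pM => //; first exact: powR_ge0.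
    by apply: ge0_ler_powR; rewrite ?nnegrE//; move: r2; lra.
  have IC := I_le mD (L1Z mD N lCz) (L1Z mD B (lV Vv)) ae1.
  rewrite (I_Z mD N lCz) (I_Z mD B (lV Vv)) in IC.
  have yz := form_young F (formZ_in F 2^-1 Vp) Vz.
  rewrite (formZ F _ Vp Vz) (form_sqrZ F _ Vp) in yz.
  have NL : N * (a u u + I (fun x => v x * (u x `^ (r - 1) * u x))) <=
     N * I (fun x => f x * u x `^ (- gamma) * u x) by rewrite ler_wpM2l.
  have : L <= a u z + I (fun x => v x * (u x `^ (r - 1) * z x)).
    rewrite /L aE CE SE; rewrite mulrDr in NL.
    move: (N * _) (N * _) (N * _) NL wP Sz0 => x1 x2 x3.
    move: (I _) (I _) (I _) (I _) (a u w) (a u z) => i1 i2 i3 i4 aw az *.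
    lra.
  move=> /(ler_wpM2l N0) /le_trans; apply; rewrite mulrDr /c.
  move: (N * _) (N * _) (a z z) IC zp yz => x1 x2 azz.
  move: (a phi z) (a phi phi) (B * _) => pz pp b IC zp yz.
  have E4 : 2^-1 ^+ 2 = 4^-1 :> R by field.
  by move: yz; rewrite E4; lra.
have cv : (fun n => c * n.+1%:R^-1) @ \oo --> c * (0 : R).
  by apply: cvgM; [exact: cvg_cst|exact: cvg_harmonic].
rewrite mulr0 in cv; apply: (cvgr_to_ge cv); apply: nearW => n.
by rewrite ler_pdivlMr ?ltr0n// mulrC.
Qed.

Lemma minimal_equation phi M : V phi -> aeD (fun x => `|phi x| <= M) ->
  [/\ L1mu (fun x => f x * u x `^ (- gamma) * phi x),
      L1mu (fun x => v x * (u x `^ (r - 1) * phi x)) &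
      a u phi + I (fun x => v x * (u x `^ (r - 1) * phi x)) =
      I (fun x => f x * u x `^ (- gamma) * phi x)].
Proof.
move=> Vp pM; have Vn := formN_in F Vp.
have V1 := df_pos_in Fd Vp; have V2 := df_pos_in Fd Vn.
set p := pos phi in V1; set q := pos _ in V2.
have pE x : phi x = p x - q x by rewrite pos_sub_opp.
have [lp1 lp2 Ep] : [/\ L1mu (fun x => f x * u x `^ (- gamma) * p x),
      L1mu (fun x => v x * (u x `^ (r - 1) * p x)) &
      a u p + I (fun x => v x * (u x `^ (r - 1) * p x)) =
      I (fun x => f x * u x `^ (- gamma) * p x)].
  apply: (@minimal_equation_ge0 _ M V1); apply: filterS pM => x /[apply].
  by rewrite ler_norml pos_ge0 => /andP[h1 h2]; rewrite pos_le//; lra.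
have [lq1 lq2 Eq] : [/\ L1mu (fun x => f x * u x `^ (- gamma) * q x),
      L1mu (fun x => v x * (u x `^ (r - 1) * q x)) &
      a u q + I (fun x => v x * (u x `^ (r - 1) * q x)) =
      I (fun x => f x * u x `^ (- gamma) * q x)].
  apply: (@minimal_equation_ge0 _ M V2); apply: filterS pM => x /[apply].
  by rewrite ler_norml pos_ge0 => /andP[h1 h2]; rewrite pos_le//; lra.
have E1 : (fun x => f x * u x `^ (- gamma) * phi x) =
    (fun x => f x * u x `^ (- gamma) * p x - f x * u x `^ (- gamma) * q x).
  by apply/funext => x; rewrite pE mulrBr.
have E2 : (fun x => v x * (u x `^ (r - 1) * phi x)) =
    (fun x => v x * (u x `^ (r - 1) * p x) - v x * (u x `^ (r - 1) * q x)).
  by apply/funext => x; rewrite pE !mulrBr.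
have E3 : a u phi = a u p - a u q.
  by rewrite -(formBr F Vu V1 V2); congr (a u _); apply/funext => x; rewrite -pE.
rewrite E1 E2 E3; split; [exact: (L1B mD)|exact: (L1B mD)|].
by rewrite (I_B mD lp1 lq1) (I_B mD lp2 lq2) -Ep -Eq; ring.
Qed.

End euler_lagrange.

(** * Positivity and conclusion *)

Lemma conj_exponentE (R : realType) (r gamma : R) : 0 < r -> 0 < gamma < 1 ->
  conj_exponent ((r + 1) / (1 - gamma)) = (r + 1) / (r + gamma).
Proof.
move=> r0 /andP[g0 g1]; have rg : r + gamma != 0 by rewrite gt_eqF// addr_gt0.
have g1' : 1 - gamma != 0 by rewrite gt_eqF// subr_gt0.
rewrite /conj_exponent.
have -> : (r + 1) / (1 - gamma) - 1 = (r + gamma) / (1 - gamma) by field.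
by field; rewrite rg g1'.
Qed.

(** This is where the lower bound on the exponent of [f] enters. *)
Lemma source_absorbed dd (T : measurableType dd) (R : realType)
    (mu : {measure set T -> \bar R}) (D : set T) (r gamma m : R) (f : T -> R) :
  measurable D -> (mu D < +oo)%E -> 0 < r -> 0 < gamma < 1 ->
  (r + 1) / (r + gamma) <= m -> L1 mu D (fun x => `|f x| `^ m) ->
  {ae mu, forall x, D x -> 0 <= f x} ->
  forall delta : R, 0 < delta -> exists2 h, L1 mu D h &
    {ae mu, forall x, D x -> forall t : R, 0 <= t ->
      f x * t `^ (1 - gamma) <= delta * (t `^ r * t) + h x}.
Proof.
move=> mD muD r0 g01 m0 lf f0 delta d0.
set c := delta^-1 `^ ((1 - gamma) / (r + gamma)).
exists (fun x => c * (1 + `|f x| `^ m)).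
  by apply: (L1Z mD); apply: (L1D mD) => //; exact: L1_cst.
apply: filterS f0 => x /[apply] fx t t0.
apply: (le_trans (powR_absorb r0 g01 d0 fx t0)).
rewrite lerD2l ler_wpM2l ?powR_ge0// (ger0_norm fx).
have [f1|f1] := leP (f x) 1.
  rewrite -[leLHS]addr0 lerD ?powR_ge0//; apply: powR_le1; last by rewrite fx.
  have /andP[g0 _] := g01.
  by rewrite divr_ge0// addr_ge0// ltW.
rewrite -[leLHS]add0r lerD//.
exact: (ler_powR (ltW f1)).
Qed.

Section positivity.
Context (R : realType) (d : nat) (Om : set 'rV[R]_d) (A : 'rV[R]_d -> 'M[R]_d)
  (alpha beta r gamma : R) (f : 'rV[R]_d -> R).
Local Notation E := 'rV[R]_d.
Local Notation mu := (lebesgue_rV R d).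
Hypotheses (oO : open Om) (bO : bounded_set Om) (cO : connected Om).
Hypotheses (alpha_gt0 : 0 < alpha) (HA : elliptic_field Om alpha beta A).
Variable i0 : 'I_d.
Hypotheses (r2 : 2 <= r) (g01 : 0 < gamma < 1).
Local Notation I f := (Rintegral mu Om f).
Local Notation L1O := (L1 mu Om).
Local Notation aeO P := {ae mu, forall x, Om x -> P x}.
Local Notation V := (H10 Om).
Local Notation a := (energy Om A).
Hypotheses (mf : measurable_fun Om f) (f0 : aeO (fun x => 0 <= f x)).
Hypothesis f_neq0 : ~ aeO (fun x => f x = 0).
Hypothesis f_absorb : forall delta : R, 0 < delta -> exists2 h, L1O h &
  aeO (fun x => forall t : R, 0 <= t ->
    f x * t `^ (1 - gamma) <= delta * (t `^ r * t) + h x).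
Variables (u v : E -> R).
Hypothesis K : sub_pair mu Om V a r u v.
Hypothesis v_solution : forall psi, V psi -> a v psi = I (fun x => u x `^ r * psi x).
Hypothesis minimal : forall u' v', sub_pair mu Om V a r u' v' ->
  functional mu Om a r gamma f u v <= functional mu Om a r gamma f u' v'.

Let mO : measurable Om. Proof. exact: open_measurable_rV. Qed.
Let muO : (mu Om < +oo)%E. Proof. exact: bounded_lebesgue_lty. Qed.
Let Fd : dirichlet_form mu Om V a.
Proof. exact: (energy_dirichlet_form oO bO alpha_gt0 HA i0). Qed.

Lemma positive_test_function x0 : Om x0 -> exists2 phi,
  test_function Om phi /\ (forall x, 0 <= phi x <= 1) & nbhs x0 [set x | 0 < phi x].
Proof.
move=> Ox0; have [c /= c0 cOm] : nbhs_ball x0 Om.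
  by apply/nbhs_ballP; exact: open_nbhs_nbhs.
pose e := c / 2; have e0 : 0 < e by rewrite divr_gt0.
exists (bump 1 (x0 - const_mx e) (x0 + const_mx e)).
  split; last by move=> x; rewrite bump_ge0 bump_le1.
  apply: bump_test => y yb; apply: cOm; rewrite ball_box// => i.
  have := yb i; rewrite /= in_itv/= /rV_coord !mxE /e => /andP[? ?].
  by apply/andP; split; lra.
apply/nbhs_ballP; exists e => // y; rewrite ball_box// => yb.
exact: (bump_gt0 0 yb).
Qed.

Lemma minimal_u_gt0 : aeO (fun x => 0 < u x).
Proof.
have [Vu _ u0 _] := K.
have [u00|//] : aeO (fun x => u x = 0) \/ aeO (fun x => 0 < u x).
  apply: (strong_maximum_principle oO bO cO alpha_gt0 HA i0 Vu u0) => phi tphi p01.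
  exists (I v) => n.
  apply: (minimal_u_bound mO muO Fd r2 g01 mf f0 f_absorb K v_solution minimal).
    exact: (H10_test oO bO tphi).
  by apply: aeW => x _; exact: p01.
exfalso; apply: f_neq0; apply: ae_local => x0 Ox0.
have [phi [tphi p01] nphi] := positive_test_function Ox0.
exists ([set x | 0 < phi x] `&` Om).
  by apply: filterI nphi _; exact: open_nbhs_nbhs.
have := minimal_u_eq0 mO muO Fd r2 g01 mf f0 f_absorb K v_solution minimal
  (H10_test oO bO tphi) (ltac:(by apply: aeW => x _; exact: p01)) u00.
apply: filterS => x fp [/= px Ox]; have /eqP := fp Ox.
by rewrite mulf_eq0 (gt_eqF px) orbF => /eqP.
Qed.

Lemma minimal_v_gt0 : aeO (fun x => 0 < v x).
Proof.
have [_ Vv _ _] := K.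
have v_super := minimal_v_supersolution mO Fd K v_solution.
have [v00|//] : aeO (fun x => v x = 0) \/ aeO (fun x => 0 < v x).
  apply: (strong_maximum_principle oO bO cO alpha_gt0 HA i0 Vv).
    exact: (minimal_v_ge0 mO Fd K v_solution).
  move=> phi tphi _; exists 0 => n; rewrite oppr0; apply: mulr_ge0 => //.
  apply: v_super; last by apply: aeW => x _; exact: pos_ge0.
  apply: (df_pos_in Fd).
  exact: (formB_in (df_psd Fd) (H10_test oO bO tphi) (formZ_in (df_psd Fd) _ Vv)).
have u00 := minimal_v_eq0 mO Fd K v_solution v00.
exfalso; apply: f_neq0; apply: filterS2 u00 minimal_u_gt0 => x + + Ox.
by move=> /(_ Ox) -> /(_ Ox); rewrite ltxx.
Qed.

Lemma singular_termE x :
  singular_term gamma f u x = Num.max 0 (f x) * u x `^ (- gamma).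
Proof.
rewrite /singular_term powRN; case: (ltP 0 (f x)) => // _.
by rewrite mul0r.
Qed.

Lemma minimal_finite_energy_solution : finite_energy_solution Om A f r gamma u v.
Proof.
have [Vu Vv u0 _] := K.
have u_gt0 := minimal_u_gt0.
have lu := df_L2 Fd Vu; have lv := df_L2 Fd Vv.
have equ phi : V phi -> in_Lp Om +oo%E phi ->
  [/\ L1O (fun x => singular_term gamma f u x * phi x),
      L1O (fun x => v x * u x `^ (r - 1) * phi x) &
      a u phi + I (fun x => v x * u x `^ (r - 1) * phi x) =
      I (fun x => singular_term gamma f u x * phi x)].
  move=> Vp /(in_Loo_bounded mO)[mp [M _ pM]].
  have [l1 l2 E] := minimal_equation mO muO Fd r2 g01 mf f0 f_absorb K v_solution
    minimal u_gt0 Vp pM.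
  have ae1 : aeO (fun x => f x * u x `^ (- gamma) * phi x = singular_term gamma f u x * phi x).
    by apply: filterS f0 => x /[apply] fx; rewrite singular_termE max_r.
  have E2 : (fun x => v x * (u x `^ (r - 1) * phi x)) = (fun x => v x * u x `^ (r - 1) * phi x).
    by apply/funext => x; rewrite mulrA.
  have lS : L1O (fun x => singular_term gamma f u x * phi x).
    apply: (L1_dom mO _ (L1_norm mO l1)).
      apply: measurable_funM => //; rewrite (funext singular_termE).
      apply: measurable_funM; first exact: measurable_maxr.
      exact: (measurableT_comp (measurable_powR _) lu.1).
    by apply: filterS ae1 => x /[apply] <-.
  by rewrite -E2; split=> //; rewrite E; exact: (I_ae_eq mO l1 lS ae1).
have lE w phi : V w -> V phi ->
    L1O (fun x => dot (mxapply (A x) (grad Om w x)) (grad Om phi x)).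
  move=> Vw Vp.
  exact: (L1_density oO HA (H10_field oO bO Vw) (H10_field oO bO Vp)).
split=> //.
- exact: minimal_v_gt0.
- by apply: filterS u_gt0 => x + Ox _; apply.
- by move=> phi Vp /(equ _ Vp)[l _ _]; exact/(in_L1P mO).
- by move=> psi Vp; apply/(in_L1P mO); exact: (sub_pair_L1 mO Fd K Vp).
- move=> phi Vp /(equ _ Vp)[_ l _]; apply/(in_L1P mO).
  exact: (L1D mO (lE _ _ Vu Vp) l).
- move=> phi Vp /(equ _ Vp)[_ l <-].
  exact: (I_D mO (lE _ _ Vu Vp) l).
- by move=> psi Vp; apply/(in_L1P mO); exact: lE.
Qed.

Lemma minimal_u_Lp : in_Lp Om (r + 1)%:E u.
Proof.
have [Vu _ u0 _] := K; have [mu_ _] := df_L2 Fd Vu.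
have r0 : 0 < r by move: r2; lra.
apply/(in_LpP mO); first by rewrite lerDr ltW.
split=> //; apply: (L1_dom mO _ (sub_pair_L1 mO Fd K Vu)).
  by apply: (measurableT_comp (measurable_powR _)); exact: measurableT_comp.
apply: filterS u0 => x /[apply] ux; rewrite ger0_norm ?powR_ge0// (ger0_norm ux).
rewrite -(mulr_powRB1 ux (_ : 0 < r + 1)); last by rewrite addr_gt0.
by rewrite addrK mulrC.
Qed.

End positivity.

Theorem theorem2p8 (R : realType) (d : nat) (Om : set 'rV[R]_d)
    (A : 'rV[R]_d -> 'M[R]_d) (alpha beta r gamma m : R) (f : 'rV[R]_d -> R) :
  (3 <= d)%N ->
  bounded_domain Om ->
  0 < alpha -> alpha <= beta ->
  elliptic_field Om alpha beta A ->
  2 <= r ->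
  0 < gamma -> gamma < 1 ->
  sobolev_exponent R d - 1 < r ->
  conj_exponent ((r + 1) / (1 - gamma)) <= m ->
  m < conj_exponent (sobolev_exponent R d / (1 - gamma)) ->
  in_Lp Om m%:E f ->
  {ae lebesgue_rV R d, forall x, Om x -> 0 <= f x} ->
  ~ {ae lebesgue_rV R d, forall x, Om x -> f x = 0} ->
  exists u v : 'rV[R]_d -> R,
    finite_energy_solution Om A f r gamma u v /\ in_Lp Om (r + 1)%:E u.
Proof.
move=> d3 [_ oO cO bO] alpha0 _ HA r2 g0 g1 _ m_ge _ lf f0 f_neq0.
have g01 : 0 < gamma < 1 by rewrite g0.
have r0 : 0 < r by exact: lt_le_trans r2.
have i0 : 'I_d := Ordinal (ltn_trans (ltn0Sn 1) d3).
have mO : measurable Om by exact: open_measurable_rV.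
have muO := bounded_lebesgue_lty mO bO.
rewrite conj_exponentE// in m_ge.
have m1 : 1 <= m.
  by apply: le_trans m_ge; rewrite ler_pdivlMr ?addr_gt0// mul1r lerD2l ltW.
have [mf lfm] := (in_LpP mO f m1).1 lf.
have f_absorb := source_absorbed mO muO r0 g01 m_ge lfm f0.
have Fd := energy_dirichlet_form oO bO alpha0 HA i0.
have [u [v [K v_solution minimal]]] :=
  minimal_pair_exists mO muO Fd r2 g01 mf f0 f_absorb.
exists u, v; split; last exact: (minimal_u_Lp oO bO alpha0 HA i0 r2 K).
exact: (minimal_finite_energy_solution oO bO cO alpha0 HA i0 r2 g01 mf f0 f_neq0
  f_absorb K v_solution minimal).
Qed.
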